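(* The map $j:\mathfrak{B}^1(H)\to\mathfrak{B}^1(G)$ constructed as described in the context maps apartments into apartments. Furthermore, $j$ is toral if $\beta$ is separable.
   Context: **Basic setting.** $k$ is a non-Archimedean local field of odd residue characteristic; $D$ is a division algebra with centre $k$ and finite index $d$; $\nu$ is the valuation on $k$ with $\nu(k^\times)=\mathbb{Z}$, extended uniquely to $D$ and to every finite-dimensional division algebra over $k$; $\rho$ is an involution on $D$ (a ring isomorphism $D\to D^{op}$ of order one or two); $k_0$ is the fixed field of $\rho$ in $k$. For a division algebra $D'$ with discrete valuation, $o_{D'}$ and $\mathfrak{p}_{D'}$ are its valuation ring and maximal ideal. $V$ is an $m$-dimensional right $D$-vector space, $\epsilon\in\{1,-1\}$, $h:V\times V\to D$ is a non-degenerate $\epsilon$-hermitian form (biadditive, $h(v_1\lambda_1,v_2\lambda_2)=\epsilon\rho(\lambda_1)\rho(h(v_2,v_1))\lambda_2$), and $\sigma$ is its adjoint involution on $\mathrm{End}_D(V)$. $\mathbf{G}=\mathbf{U}(h)=\mathbf{U}(\sigma)$ is the unitary group over $k_0$, $G=\mathbf{G}(k_0)=\{g\in \mathrm{End}_D(V): \sigma(g)g=1\}$, $\mathfrak{g}=\mathrm{Lie}(\mathbf{G})(k_0)=\{a\in\mathrm{End}_D(V):\sigma(a)=-a\}$. **Lattice functions.** An $o_D$-lattice function in $V$ is a family $(\Lambda(r))_{r\in\mathbb{R}}$ of (full) $o_D$-lattices in $V$ with $\Lambda(r)\supseteq\Lambda(s)$ for $r<s$, $\Lambda(r)=\bigcap_{t<r}\Lambda(t)$,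 $\Lambda(r)\mathfrak{p}_D=\Lambda(r+\frac1d)$. $\mathrm{Latt}^1_{o_D}(V)$ is the set of these. $\Lambda$ corresponds to the norm $\alpha_\Lambda(v)=\sup\{t: v\in\Lambda(t)\}$. $\Lambda$ is split by a direct sum decomposition of $V$ into $D$-subspaces $W$ if each $\Lambda(t)$ is the direct sum of the $\Lambda(t)\cap W$. Any two lattice functions are split by a common decomposition into lines $v_iD$; convex combinations are defined by convex combination of the values of the norms at the $v_i$; this is the affine structure. For $s\in\mathbb{R}$, $(\Lambda+s)(t)=\Lambda(t-s)$. The dual of $\Lambda$ is $\Lambda^{\#}(t)=\{v\in V: h(v,\Lambda(s))\subseteq\mathfrak{p}_D\text{ for all }s>-t\}$; $\mathrm{Latt}^1_h(V)$ is the set of self-dual ones. $G$ acts by $(g.\Lambda)(t)=g(\Lambda(t))$. The extended Bruhat–Tits building $\mathfrak{B}^1(G)=\mathfrak{B}^1(\mathbf{G},k_0)$ is identified, by the unique affine $G$-equivariant bijection, with $\mathrm{Latt}^1_h(V)$. The square lattice function of $\Lambda$ is $\tilde{\mathfrak{g}}_\Lambda(t)=\{a\in\mathrm{End}_D(V): a\Lambda(s)\subseteq\Lambda(s+t)\ \forall s\in\mathbb{R}\}$. **Apartments.** A Witt decomposition of $V$ (with respect to $h$) is a set $\{W_l: l\in L\}$ of one-dimensional isotropic $D$-subspaces whose sum is direct, such that for each $l$ there is exactly one $l'$ with $h(W_l,W_{l'})\neq0$, and such that the orthogonal complement $W_0$ of $\sum_lW_l$ is anisotropic. The apartments of $\mathrm{Latt}^1_h(V)$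 are the sets of self-dual lattice functions split by $\{W_l: l\in L\}\cup\{W_0\}$, for Witt decompositions $\{W_l\}$. The apartments of $\mathrm{Latt}^1_{o_{D}}(V)$ (the extended building of $\mathbf{GL}_D(V)$) are the sets of lattice functions split by a fixed decomposition of $V$ into lines. These are the apartments attached by Bruhat–Tits theory to maximal split tori. Apartments of a product of buildings are products of apartments. **Centralizer.** $\beta\in\mathfrak{g}$ is such that $E:=k[\beta]\subseteq\mathrm{End}_D(V)$ is a product of fields $E_i$ ($i\in I$) with identity elements $1_i$; $V_i=1_iV$. $\beta$ is called separable if each $E_i|1_ik$ is separable. $\sigma$ acts on $I$ by $\sigma(1_i)=1_{\sigma(i)}$; write $-i=\sigma(i)$; $I_0$ is the fixed point set, and $I\setminus I_0=I_+\sqcup I_-$ with $\sigma(I_+)=I_-$. For $i\in I_0$, $(E_i)_0$ is the set of $\sigma$-fixed points in $E_i$; for $i\in I_+$, $(E_i)_0=E_i$. $H$ and $\mathbf{H}$ are the centralizers of $\beta$ in $G$ and $\mathbf{G}$. For each $i$, fix an $E_i$-algebra isomorphism of $\mathrm{End}_{E_i\otimes_kD}(V_i)$ (the centralizer of $E_i$ in $\mathrm{End}_D(V_i)$) with $\mathrm{End}_{D'_i}(V'_i)$, where $D'_i$ is a division algebra of finite index central over $E_i$ and $V_i'$ a finite-dimensional right $D_i'$-vector space. Put $\mathbf{H}_i=\mathbf{U}(\sigma|_{\mathrm{End}_{D'_i}(V'_i)})$ for $i\in I_0$, $\mathbf{H}_i=\mathbf{GL}_{D'_i}(V'_i)$ for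 $i\in I_+$. Canonically $H\cong\prod_{i\in I_0\cup I_+}\mathbf{H}_i((E_i)_0)$, and $\mathfrak{B}^1(H):=\prod_{i\in I_0\cup I_+}\mathfrak{B}^1(\mathbf{H}_i,(E_i)_0)$. Here $\mathfrak{B}^1(\mathbf{H}_i,(E_i)_0)$ is identified with $\mathrm{Latt}^1_{o_{D'_i}}(V'_i)$ for $i\in I_+$ and with $\mathrm{Latt}^1_{h_i}(V'_i)$ for $i\in I_0$, where $h_i$ is a fixed signed hermitian form on $V'_i$ with adjoint involution $\sigma|_{\mathrm{End}_{D'_i}(V'_i)}$; lattice functions over $D'_i$ are normalized via the extension of $\nu$, i.e. $\Lambda(r)\pi=\Lambda(r+\nu(\pi))$ for a uniformizer $\pi$ of $D'_i$. If $\beta$ is separable, $\mathbf{H}$ is reductive and defined over $k_0$, $\mathbf{H}\cong\prod_{i\in I_0\cup I_+}\mathrm{Res}_{(E_i)_0|k_0}(\mathbf{H}_i)$ over $k_0$, and $\mathfrak{B}^1(\mathbf{H},k_0)$ is identified with $\mathfrak{B}^1(H)$. **Construction of $j$.** By results of Broussous–Lemaire, for each $i$ there is an affine, $\mathrm{Aut}_{D'_i}(V'_i)$-equivariant bijection $\tilde j^{E_i}$ from $\mathrm{Latt}^1_{o_{D'_i}}(V'_i)$ onto the set of $o_D$-lattice functions in $V_i$ that are also $o_{E_i}$-lattice functions (normalized by $\nu$), such that the square lattice function of $\tilde j^{E_i}(\Lambda)$ intersected with $\mathrm{End}_{E_i\otimes_k D}(V_i)$ is the square lattice function of $\Lambda$;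 it is unique up to a translation $\Lambda\mapsto\Lambda+s$. Fix such maps. For $i\in I_0$ and $\Lambda\in\mathrm{Latt}^1_{h_i}(V'_i)$ let $j_i(\Lambda)$ be the unique self-dual (with respect to $h|_{V_i\times V_i}$) lattice function of the form $\tilde j^{E_i}(\Lambda)+s$, $s\in\mathbb{R}$. For $i\in I_+$ let $j_i(\Lambda)=\Lambda_1\oplus\Lambda_1^{\#_{-i}}$ with $\Lambda_1=\tilde j^{E_i}(\Lambda)$ and $\Lambda_1^{\#_{-i}}(t)=\{v\in V_{-i}: h(v,\Lambda_1(s))\subseteq\mathfrak{p}_D\ \forall s>-t\}$. Then $j((x_i)_i)=\bigoplus_{i\in I_0\cup I_+}j_i(x_i)$. **Toral.** A map $f:\mathfrak{B}^1(\mathbf{G}_1,k_0)\to\mathfrak{B}^1(\mathbf{G}_2,k_0)$ between extended buildings of reductive $k_0$-groups (here $\mathbf{G}_1=\mathbf{H}\subseteq\mathbf{G}_2=\mathbf{G}$) is toral if for each maximal $k_0$-split torus $S$ of $\mathbf{G}_1$ there is a maximal $k_0$-split torus $T$ of $\mathbf{G}_2$ containing $S$ such that $f$ maps the apartment corresponding to $S$ into the apartment corresponding to $T$. *)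

(* Defs.v *)
(* Right modules over a (non-commutative) ring A are left modules over the
   converse ring A^c.  Endomorphisms of a right D-vector space V are the
   elements of 'End(V), whose product is \o%VF. *)
From HB Require Import structures.
From mathcomp Require Import all_boot all_order all_algebra all_field.
From mathcomp Require Import boolp classical_sets functions reals ereal.
Set Implicit Arguments.
Unset Strict Implicit.
Unset Printing Implicit Defensive.
Import Order.TTheory GRing.Theory Num.Theory.
Local Open Scope classical_set_scope.
Local Open Scope ring_scope.

Definition rscale (A : nzRingType) (V : lmodType A^c) (a : A) (v : V) : V :=
  (a : A^c) *: v.

Record valuation (R : realType) (A : nzRingType) (nu : A -> \bar R) : Prop := {
  val_zero : nu 0 = +oo%E;
  val_fin : forall x, x != 0 -> nu x \is a fin_num;
  valM : forall x y, nu (x * y)%R = (nu x + nu y)%E;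
  valD : forall x y, (Order.min (nu x) (nu y) <= nu (x + y)%R)%E }.

Definition integers (R : realType) (A : nzRingType) (nu : A -> \bar R) : set A :=
  [set x | (0%E <= nu x)%E].

Definition max_ideal (R : realType) (A : nzRingType) (nu : A -> \bar R) : set A :=
  [set x | (0%E < nu x)%E].

(* nu is discrete, so this infimum is nu of a uniformizer *)
Definition unif_value (R : realType) (A : nzRingType) (nu : A -> \bar R) : R :=
  fine (ereal_inf (nu @` (max_ideal nu))).

Record odd_local_field (R : realType) (k : fieldType) (nu : k -> \bar R) : Prop := {
  lf_val : valuation nu;
  lf_normalized :
    nu @` [set x | x != 0] = range (fun n : int => (n%:~R : R)%:E);
  lf_complete : forall u : nat -> k,
    (forall M : R, exists N : nat, forall p q : nat, (N <= p)%N -> (N <= q)%N ->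
       (M%:E <= nu (u p - u q)%R)%E) ->
    exists l : k, forall M : R, exists N : nat, forall p : nat, (N <= p)%N ->
       (M%:E <= nu (u p - l)%R)%E;
  lf_finite_residue : exists s : seq k,
    forall x, integers nu x -> exists2 y, y \in s & max_ideal nu (x - y);
  lf_odd_residue_char : exists p : nat,
    [/\ prime p, odd p & max_ideal nu (p%:R)] }.

Record central_division_algebra (K : fieldType) (A : falgType K) : Prop := {
  cda_division : forall x : A, x != 0 -> x \is a GRing.unit;
  cda_central : forall x : A,
    (forall y : A, x * y = y * x) -> exists a : K, x = a%:A }.

Record ring_involution (A : nzRingType) (rho : A -> A) : Prop := {
  invol_add : forall x y, rho (x + y) = rho x + rho y;
  invol_mul : forall x y, rho (x * y) = rho y * rho x;
  invol_one : rho 1 = 1;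
  invol_invol : forall x, rho (rho x) = x }.

Definition fixed_field (k : fieldType) (D : falgType k) (rho : D -> D) : set k :=
  [set a | rho (a%:A) = a%:A].

Section LatticeFunctions.
(* A acts on V from the right: [act a v] is v.a; X is an A-subspace of V *)
Variables (R : realType) (A : nzRingType) (nu : A -> \bar R).
Variables (V : zmodType) (act : A -> V -> V) (X : set V).

(* full o_A-lattice in X: the o_A-span of finitely many vectors spanning X *)
Definition is_lattice (M : set V) : Prop :=
  exists n (b : 'I_n -> V),
    M = [set \sum_i act (a i) (b i) | a in [set a | forall i, integers nu (a i)]]
    /\ X = range (fun a : 'I_n -> A => \sum_i act (a i) (b i)).

Definition mul_max_ideal (M : set V) : set V :=
  [set v | exists n (a : 'I_n -> A) (w : 'I_n -> V),
     (forall i, max_ideal nu (a i) /\ M (w i)) /\ v = \sum_i act (a i) (w i)].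

(* lattice functions in X of period c, i.e. L(r) p_A = L(r + c) *)
Record lattice_function (c : R) (L : R -> set V) : Prop := {
  latf_lattice : forall r, is_lattice (L r);
  latf_decr : forall r s, r < s -> L s `<=` L r;
  latf_left_cont : forall r, L r = \bigcap_(t in [set t | t < r]) L t;
  latf_period : forall r, mul_max_ideal (L r) = L (r + c) }.

End LatticeFunctions.

Section Operations.
Variables (R : realType) (V : zmodType).
Implicit Types (L : R -> set V).

Definition shift_lf L (s : R) : R -> set V := fun t => L (t - s).

Definition image_lf (f : V -> V) L : R -> set V := fun t => f @` L t.

Definition sum_lf (J : finType) (F : J -> R -> set V) : R -> set V :=
  fun t => [set \sum_j w j | w in [set w : J -> V | forall j, F j t (w j)]].

(* meaningful for v <> 0 only *)
Definition norm_lf L (v : V) : R := sup [set t | L t v].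

Definition independent (J : finType) (W : J -> set V) : Prop :=
  forall w : J -> V, (forall j, W j (w j)) -> \sum_j w j = 0 ->
    forall j, w j = 0.

Definition direct_decomposition (X : set V) (J : finType) (W : J -> set V) : Prop :=
  X = [set \sum_j w j | w in [set w : J -> V | forall j, W j (w j)]]
  /\ independent W.

Definition split_by (J : finType) (W : J -> set V) L : Prop :=
  forall t, direct_decomposition (L t) (fun j => L t `&` W j).

End Operations.

Definition line (A : nzRingType) (V : lmodType A^c) (v : V) : set V :=
  range (fun a : A => rscale a v).

Definition is_line (A : nzRingType) (V : lmodType A^c) (W : set V) : Prop :=
  exists v, v != 0 /\ W = line v.

Definition line_decomposition (A : nzRingType) (V : lmodType A^c) (X : set V)
    (J : finType) (W : J -> set V) : Prop :=
  (forall j, is_line (W j)) /\ direct_decomposition X W.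

(* L3 = (1 - t) L1 + t L2 *)
Definition convex_combination (R : realType) (A : nzRingType) (V : lmodType A^c)
    (X : set V) (t : R) (L1 L2 L3 : R -> set V) : Prop :=
  exists n (v : 'I_n -> V),
    [/\ line_decomposition X (fun i => line (v i)),
        split_by (fun i => line (v i)) L1,
        split_by (fun i => line (v i)) L2,
        split_by (fun i => line (v i)) L3
      & forall i, norm_lf L3 (v i) =
          (1 - t) * norm_lf L1 (v i) + t * norm_lf L2 (v i)].

Definition square_lf (R : realType) (A : nzRingType) (V : vectType A^c)
    (L : R -> set V) (t : R) : set 'End(V) :=
  [set a | forall s v, L s v -> L (s + t) (a v)].

Definition automorphism (A : nzRingType) (V : vectType A^c) : set 'End(V) :=
  [set f | exists g : 'End(V), (f \o g = \1)%VF /\ (g \o f = \1)%VF].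

Section Hermitian.
Variables (R : realType) (A : nzRingType) (nu : A -> \bar R) (V : vectType A^c).
Variables (h : V -> V -> A).

Record hermitian_form (rho : A -> A) (eps : A) : Prop := {
  herm_sign : eps = 1 \/ eps = -1;
  herm_addl : forall u v w, h (u + v) w = h u w + h v w;
  herm_addr : forall u v w, h u (v + w) = h u v + h u w;
  herm_sesqui : forall v1 v2 (a1 a2 : A),
    h (rscale a1 v1) (rscale a2 v2) = eps * rho a1 * rho (h v2 v1) * a2;
  herm_nondeg : forall v, (forall w, h v w = 0) -> v = 0 }.

Definition adjoint_pair (f g : 'End(V)) : Prop :=
  forall v w, h (f v) w = h v (g w).

(* The pairing restricted to Y on the left: Y is V, V_i (i in I_0) or V_{-i}. *)
Definition dual_lf (Y : set V) (L : R -> set V) : R -> set V := fun t =>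
  [set v | Y v /\ forall s w, - t < s -> L s w -> max_ideal nu (h v w)].

Definition selfdual_lattice_function (c : R) : set (R -> set V) :=
  [set L | lattice_function nu (@rscale A V) setT c L /\ dual_lf setT L = L].

Definition witt_kernel (J : finType) (W : J -> set V) : set V :=
  [set v | forall j w, W j w -> h w v = 0].

Record witt_decomposition (J : finType) (W : J -> set V) : Prop := {
  witt_line : forall j, is_line (W j);
  witt_isotropic : forall j v w, W j v -> W j w -> h v w = 0;
  witt_direct : independent W;
  witt_pairing : forall j, exists! j', exists v w,
    [/\ W j v, W j' w & h v w != 0];
  witt_anisotropic : forall v, witt_kernel W v -> h v v = 0 -> v = 0 }.

(* the family {W_j} together with W_0, placed at index None *)
Definition witt_family (J : finType) (W : J -> set V) (o : option J) : set V :=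
  if o is Some j then W j else witt_kernel W.

Definition witt_apartment (c : R) (J : finType) (W : J -> set V) :
    set (R -> set V) :=
  [set L | selfdual_lattice_function c L /\ split_by (witt_family W) L].

Definition is_unitary_apartment (c : R) (S : set (R -> set V)) : Prop :=
  exists (J : finType) (W : J -> set V),
    witt_decomposition W /\ S = witt_apartment c W.

(* The rational points of the maximal split torus attached to {W_j} in the
   unitary group U: scalars from F on each W_j and the identity on W_0. *)
Definition witt_torus (F : set A) (U : set 'End(V)) (J : finType)
    (W : J -> set V) : set 'End(V) :=
  [set g | [/\ U g,
     forall j, exists2 a, F a & forall v, W j v -> g v = rscale a v
   & forall v, witt_kernel W v -> g v = v]].

Definition unitary_torus_apartment (c : R) (F : set A) (U T : set 'End(V))
    (S : set (R -> set V)) : Prop :=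
  exists (J : finType) (W : J -> set V),
    [/\ witt_decomposition W, T = witt_torus F U W & S = witt_apartment c W].

End Hermitian.

Section GeneralLinear.
Variables (R : realType) (A : nzRingType) (nu : A -> \bar R) (V : vectType A^c).

Definition line_apartment (c : R) (J : finType) (W : J -> set V) :
    set (R -> set V) :=
  [set L | lattice_function nu (@rscale A V) setT c L /\ split_by W L].

Definition is_linear_apartment (c : R) (S : set (R -> set V)) : Prop :=
  exists (J : finType) (W : J -> set V),
    line_decomposition setT W /\ S = line_apartment c W.

Definition line_torus (F : set A) (J : finType) (W : J -> set V) :
    set 'End(V) :=
  [set g | automorphism g /\
     forall j, exists2 a, F a & forall v, W j v -> g v = rscale a v].

Definition linear_torus_apartment (c : R) (F : set A) (T : set 'End(V))
    (S : set (R -> set V)) : Prop :=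
  exists (J : finType) (W : J -> set V),
    [/\ line_decomposition setT W, T = line_torus F W & S = line_apartment c W].

End GeneralLinear.

Section Tori.
Variables (k : fieldType) (D : falgType k) (V : vectType D^c) (k0 : set k).

Definition torus_points (n : nat) : set ('I_n -> k) :=
  [set t | forall i, t i != 0 /\ k0 (t i)].

(* the Laurent polynomial  sum_p t^(w p) e_p  with coefficients in End_D(V) *)
Definition laurent (n r : nat) (w : 'I_r -> 'I_n -> int) (e : 'I_r -> 'End(V))
    (t : 'I_n -> k) (v : V) : V :=
  \sum_p rscale ((\prod_i t i ^ w p i)%:A : D) (e p v).

(* S is the group of k_0-points of a k_0-split torus contained in the algebraic
   group with k_0-points G: the image of a closed immersion G_m^n -> G over k_0.
   Such a homomorphism is a Laurent polynomial with values in End_D(V); as k_0 is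
   infinite, being a homomorphism into G can be tested on k_0-points.  It is a
   closed immersion iff the weights occurring in it generate Z^n.  Again because
   k_0 is infinite, S determines the torus, and an inclusion of tori is an
   inclusion of their k_0-points. *)
Definition split_torus (G S : set 'End(V)) : Prop :=
  exists n r (w : 'I_r -> 'I_n -> int) (e : 'I_r -> 'End(V)),
    [/\ injective w /\ (forall p, e p != 0),
        forall a : 'I_n -> int, exists c : 'I_r -> int,
          forall i, a i = \sum_p c p * w p i,
        (forall v, laurent w e (fun=> 1) v = v) /\
        (forall s t v, torus_points s -> torus_points t ->
           laurent w e (fun i => s i * t i) v = laurent w e s (laurent w e t v)),
        S = [set g | exists2 t, torus_points t & forall v, g v = laurent w e t v]
      & S `<=` G].

Definition maximal_split_torus (G S : set 'End(V)) : Prop :=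
  split_torus G S /\
  forall S', split_torus G S' -> S `<=` S' -> S' = S.

End Tori.

(* k[f]; k acts on V through the centre of D *)
Definition generated_algebra (k : fieldType) (D : falgType k) (V : vectType D^c)
    (f : 'End(V)) : set 'End(V) :=
  [set g | exists p : {poly k}, forall v,
     g v = \sum_(n < size p) rscale ((p`_n)%:A : D) (iter n f v)].

(* The E i are the factors of k[beta]: the iota i induce an isomorphism of
   k-algebras from the product of the E i onto k[beta]; iota i 1 is 1_i. *)
Record product_of_fields (k : fieldType) (D : falgType k) (V : vectType D^c)
    (beta : 'End(V)) (I : finType) (E : I -> fieldExtType k)
    (iota : forall i, E i -> 'End(V)) : Prop := {
  pf_add : forall i (x y : E i), iota i (x + y) = iota i x + iota i y;
  pf_mul : forall i (x y : E i), iota i (x * y) = (iota i x \o iota i y)%VF;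
  pf_scale : forall i (a : k) v,
    iota i (a%:A) v = rscale (a%:A : D) (iota i 1 v);
  pf_nonzero : forall i, iota i 1 != 0;
  pf_orth : forall i j (x : E i) (y : E j), i != j ->
    (iota i x \o iota j y = 0)%VF;
  pf_one : \sum_i iota i 1 = \1%VF;
  pf_image : generated_algebra beta =
    range (fun x : forall i, E i => \sum_i iota i (x i)) }.

Definition extends_val (R : realType) (k : fieldType) (nu : k -> \bar R)
    (A : nzRingType) (emb : k -> A) (nuA : A -> \bar R) : Prop :=
  valuation nuA /\ forall a, nuA (emb a) = nu a.

Definition tower_scalar (k : fieldType) (E : fieldExtType k) (D' : falgType E)
    (a : k) : D' := (a%:A : E)%:A.

(* psi is an isomorphism of E-algebras from End_{D'}(V') onto the centralizer of
   E in End_D(1_E V), the latter identified with 1_E End_D(V) 1_E. *)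
Record centralizer_iso (k : fieldType) (D : falgType k) (V : vectType D^c)
    (E : fieldExtType k) (iota : E -> 'End(V)) (D' : falgType E)
    (V' : vectType D'^c) (psi : 'End(V') -> 'End(V)) : Prop := {
  ci_add : forall f g, psi (f + g) = psi f + psi g;
  ci_mul : forall f g, psi (f \o g)%VF = (psi f \o psi g)%VF;
  ci_scalar : forall (x : E) (f : 'End(V')),
    (forall v, f v = rscale (x%:A : D') v) -> psi f = iota x;
  ci_inj : injective psi;
  ci_image : range psi =
    [set a | (iota 1 \o a \o iota 1 = a)%VF
           /\ forall x, (a \o iota x = iota x \o a)%VF] }.

Definition component (k : fieldType) (D : falgType k) (V : vectType D^c)
    (E : fieldExtType k) (iota : E -> 'End(V)) : set V := range (iota 1).

(* nu' is the valuation on D', and the valuation on E is its restriction. *)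
Section BroussousLemaire.
Variables (R : realType) (k : fieldType) (D : falgType k) (d : nat).
Variables (nuD : D -> \bar R) (V : vectType D^c).
Variables (E : fieldExtType k) (iota : E -> 'End(V)) (D' : falgType E).
Variables (nu' : D' -> \bar R) (V' : vectType D'^c) (psi : 'End(V') -> 'End(V)).

Definition building_linear : set (R -> set V') :=
  lattice_function nu' (@rscale D' V') setT (unif_value nu').

Definition valE (x : E) : \bar R := nu' (x%:A).

Definition lattice_functions_DE : set (R -> set V) :=
  [set L | lattice_function nuD (@rscale D V) (component iota) (d%:R^-1) L
         /\ lattice_function valE (fun x => iota x) (component iota)
              (unif_value valE) L].

Record broussous_lemaire (jt : (R -> set V') -> (R -> set V)) : Prop := {
  bl_bij : set_bij building_linear lattice_functions_DE jt;
  bl_affine : forall (t : R) L1 L2 L3, 0 <= t <= 1 ->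
    building_linear L1 -> building_linear L2 -> building_linear L3 ->
    convex_combination setT t L1 L2 L3 ->
    convex_combination (component iota) t (jt L1) (jt L2) (jt L3);
  bl_equivariant : forall (g : 'End(V')) L, automorphism g -> building_linear L ->
    jt (image_lf g L) = image_lf (psi g) (jt L);
  bl_square : forall (L : R -> set V') t, building_linear L ->
    [set a | square_lf (jt L) t (psi a)] = square_lf L t }.

End BroussousLemaire.

Section MapJ.
Variables (R : realType) (k : fieldType) (D : falgType k) (d : nat).
Variables (nuD : D -> \bar R) (rho : D -> D) (V : vectType D^c).
Variables (h : V -> V -> D) (sigma : 'End(V) -> 'End(V)) (beta : 'End(V)).
Variables (I : finType) (E : I -> fieldExtType k).
Variables (iota : forall i, E i -> 'End(V)) (sI : I -> I) (Ip : {set I}).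
Variables (D' : forall i, falgType (E i)) (nu' : forall i, D' i -> \bar R).
Variables (V' : forall i, vectType (D' i)^c).
Variables (psi : forall i, 'End(V' i) -> 'End(V)).
Variables (h' : forall i, V' i -> V' i -> D' i).
Variables (jt : forall i, (R -> set (V' i)) -> (R -> set V)).
Arguments iota : clear implicits.
Arguments nu' : clear implicits.
Arguments h' : clear implicits.
Arguments psi : clear implicits.
Arguments jt : clear implicits.

(* sI is the action of sigma on I (so -i = sI i), and Ip is I_+ *)
Record sigma_indices : Prop := {
  si_action : forall i, sigma (iota i 1) = iota (sI i) 1;
  si_plus_moved : forall i, i \in Ip -> sI i != i;
  si_plus_minus : forall i, sI i != i -> (sI i \in Ip) = (i \notin Ip) }.

Definition index := {i : I | (sI i == i) || (i \in Ip)}.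

Definition family_lf := forall i : index, R -> set (V' (val i)).

Definition Vc (i : I) : set V := component (iota i).

(* jt i L + s for the unique s that makes it self-dual in V_i *)
Definition j_zero (i : I) (L : R -> set (V' i)) : R -> set V :=
  shift_lf (jt i L)
    (xget 0 [set s : R | dual_lf nuD h (Vc i) (shift_lf (jt i L) s)
                         = shift_lf (jt i L) s]).

Definition j_plus (i : I) (L : R -> set (V' i)) : R -> set V := fun t =>
  [set u + v | u in jt i L t & v in dual_lf nuD h (Vc (sI i)) (jt i L) t].

Definition j_factor (i : I) (L : R -> set (V' i)) : R -> set V :=
  if sI i == i then j_zero L else j_plus L.

Definition map_j (x : family_lf) : R -> set V :=
  sum_lf (fun i : index => j_factor (x i)).

Definition unitary_group : set 'End(V) := [set g | (sigma g \o g = \1)%VF].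

Definition centralizer_group : set 'End(V) :=
  [set g | unitary_group g /\ (g \o beta = beta \o g)%VF].

(* meaningful for i in I_0 only *)
Definition factor_unitary_group (i : I) : set 'End(V' i) :=
  [set f | (sigma (psi i f) \o psi i f = iota i 1)%VF].

Definition is_apartment_G (S : set (R -> set V)) : Prop :=
  is_unitary_apartment nuD h (d%:R^-1) S.

Definition is_factor_apartment (i : I) (S : set (R -> set (V' i))) : Prop :=
  if sI i == i
  then is_unitary_apartment (nu' i) (h' i) (unif_value (nu' i)) S
  else is_linear_apartment (nu' i) (unif_value (nu' i)) S.

Definition is_apartment_H (S : set family_lf) : Prop :=
  exists Si : forall i : index, set (R -> set (V' (val i))),
    (forall i, is_factor_apartment (Si i)) /\
    S = [set x | forall i, Si i (x i)].

Definition maps_apartments_into_apartments : Prop :=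
  forall S, is_apartment_H S ->
    exists S', is_apartment_G S' /\ map_j @` S `<=` S'.

(* Tori are given by their k_0-points, k_0 being the fixed field of rho in k. *)

Definition torus_apartment_G (T : set 'End(V)) (S : set (R -> set V)) : Prop :=
  unitary_torus_apartment nuD h (d%:R^-1)
    ((fun a : k => a%:A : D) @` fixed_field rho) unitary_group T S.

(* In a factor, T is the maximal k_0-split subtorus of the restriction of
   scalars to k_0 of a maximal (E_i)_0-split torus of H_i: on the lines of the
   decomposition it acts through scalars from k_0 rather than from (E_i)_0. *)
Definition torus_factor_apartment (i : I) (T : set 'End(V' i))
    (S : set (R -> set (V' i))) : Prop :=
  let F := @tower_scalar k (E i) (D' i) @` fixed_field rho in
  let c := unif_value (nu' i) in
  if sI i == i
  then unitary_torus_apartment (nu' i) (h' i) c F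
         (@factor_unitary_group i) T S
  else linear_torus_apartment (nu' i) c F T S.

Definition torus_apartment_H (T : set 'End(V)) (S : set family_lf) : Prop :=
  exists (Ti : forall i : index, set 'End(V' (val i)))
         (Si : forall i : index, set (R -> set (V' (val i)))),
    [/\ forall i, torus_factor_apartment (Ti i) (Si i),
        T = [set g | centralizer_group g /\
               forall i : index, exists2 f, Ti i f &
                 psi (val i) f = (g \o iota (val i) 1)%VF]
      & S = [set x | forall i, Si i (x i)]].

Definition toral : Prop :=
  forall T, maximal_split_torus (fixed_field rho) centralizer_group T ->
    exists T' S S',
      [/\ maximal_split_torus (fixed_field rho) unitary_group T', T `<=` T',
          torus_apartment_H T S, torus_apartment_G T' S'
        & map_j @` S `<=` S'].

End MapJ.

(* Main.v *)
(* A lattice function is the family of balls of a norm, so apartments can be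
   handled through norms that are split by a decomposition.  Fix an apartment of
   the building of H.  In each factor the projections onto its lines, and onto the
   anisotropic kernel, correspond under psi to projections of V commuting with E.
   Equivariance of jt under an element acting as a power of a uniformizer of k on
   the image of one projection and trivially on the others, extended to real
   parameters by affinity, shows that moving inside the apartment changes j only by
   shifts on the images of these projections; on the kernels self-duality forbids
   any shift.  It therefore suffices to find a Witt decomposition of V that refines
   this grading and splits j(x0) for a single point x0.  It is obtained by splitting
   off homogeneous hyperbolic planes adapted to j(x0), which is possible since 2 is
   a unit; on the anisotropic remainder the self-dual norm is forced to be
   v |-> nu(h(v,v))/2, and Cauchy-Schwarz splits it off orthogonally.

   For torality, independence of characters decomposes V under a maximal split torus
   T of the centralizer into weight spaces stable under k[beta].  The same Witt
   decomposition theorem, for the grading of each V'_i by weights, shows that T lies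
   in, hence equals, the torus attached to an apartment of H.  The Witt decomposition
   of V found above refines the weight spaces of T, so T lies in its torus, which is
   maximal because a split torus acts on a line through one character and trivially
   on an anisotropic space. *)
Require Import Defs.
From HB Require Import structures.
From mathcomp Require Import all_boot all_order all_algebra all_field.
From mathcomp Require Import boolp classical_sets functions reals ereal.
From mathcomp Require Import lra ring.
Set Implicit Arguments.
Unset Strict Implicit.
Unset Printing Implicit Defensive.
Import Order.TTheory GRing.Theory Num.Theory.
Local Open Scope classical_set_scope.
Local Open Scope ring_scope.

(** Duals of lattice functions behave well only if [rho] preserves values, which is no part of the
    definition of an involution; it is derived from the existence of $2^n$-th roots of principal
    units, available in odd residue characteristic.

    The anisotropic kernels of all factors are put into one common degree of the grading. A kernel
    that is anisotropic for $h'_i$ may be isotropic for $h$, and isotropic vectors of $V$ may mix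
    several kernels, so a finer grading need not admit enough homogeneous hyperbolic planes. With
    one common degree there is exactly one self-dual degree, whence the remainder left by the planes
    is anisotropic; and since no kernel is shifted inside an apartment, that degree moves as a
    whole.

    The valuation of $D$ is rescaled so that its least positive value is the period $1/d$ of lattice
    functions; the value [kappa] of a uniformizer of $k$ is then the factor by which [jt] multiplies
    shifts.

    A convex combination in $V$ refers to a basis that is merely known to exist and is unrelated to
    the projections at hand; affinity is therefore used through two inclusions of balls that mention
    no basis. *)

Section RealLemmas.
Variable R : realType.
Implicit Types (T : set R).

(** The sum of the floors of $(t - b_i)/g$ is bounded on [T] and grows strictly along [T], because a
    non-maximal element sits on one of the progressions and makes its floor jump. Only elements with
    a larger one in [T] are required to lie on the progressions: for distances to a subspace nothing
    is known beforehand about the largest value. *)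
Lemma discrete_max (n : nat) (b : 'I_n -> R) (g : R) T :
  0 < g -> T !=set0 -> (exists B, forall t, T t -> t <= B) ->
  (forall t s, T t -> T s -> t < s ->
     exists i (m : int), t = b i + m%:~R * g) ->
  exists2 t, T t & forall s, T s -> s <= t.
Proof.
move=> g0 [t0 Tt0] [B TB] Tb; apply: contrapT => nomax.
have step t : T t -> exists2 s, T s & t < s.
  move=> Tt; apply: contrapT => H; apply: nomax; exists t => // s Ts.
  by rewrite leNgt; apply/negP => ts; apply: H; exists s.
pose m t := \sum_i Num.floor ((t - b i) / g).
have fl s t i : s <= t -> Num.floor ((s - b i) / g) <= Num.floor ((t - b i) / g).
  by move=> st; apply: le_floor; rewrite ler_pM2r ?invr_gt0 // lerD2r.
have mS t s : T t -> T s -> t < s -> m t < m s.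
  move=> Tt Ts ts; have [u Tu su] := step s Ts.
  have [i [k sE]] := Tb s u Ts Tu su.
  rewrite /m (bigD1 i) //= [ltRHS](bigD1 i) //=.
  apply: ltr_leD; last by apply: ler_sum => j _; apply: fl; exact: ltW.
  have -> : (s - b i) / g = k%:~R by rewrite sE addrC addKr mulfK ?gt_eqF.
  by rewrite intrKfloor floor_lt_int ltr_pdivrMr // ltrBlDl -sE.
have mB t : T t -> m t <= m B.
  by move=> Tt; apply: ler_sum => i _; apply: fl; exact: TB.
have grow (p : nat) : exists2 t, T t & (m t0 + p%:Z <= m t)%R.
  elim: p => [|p [t Tt H]]; first by exists t0; rewrite ?addr0.
  have [s Ts ts] := step t Tt; exists s => //.
  have := mS t s Tt Ts ts; rewrite -addn1 PoszD addrA => lt.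
  by rewrite -lezD1 in lt; apply: le_trans lt; rewrite lerD2r.
have [t Tt H] := grow (`|m B - m t0|.+1)%N.
have := le_trans H (mB t Tt); rewrite -addn1 PoszD addrA.
rewrite leNgt => /negP; apply; rewrite -lezD1 lerD2r -lerBlDl.
by rewrite abszE; exact: ler_norm.
Qed.

End RealLemmas.

(** * Norms over complete valued division rings *)

Section ValuedDivisionRing.
Variables (R : realType) (A : unitRingType) (w : A -> R).
Implicit Types (x y : A) (t s : R).

(* The value of 0 is +oo: this is "t <= w x" in the extended sense. *)
Definition vge t x : Prop := x = 0 \/ t <= w x.

(* complete discretely valued division rings *)
Record cdv : Prop := {
  cdv_unit : forall x, x != 0 -> x \is a GRing.unit;
  cdv_mul : forall x y, x != 0 -> y != 0 -> w (x * y) = w x + w y;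
  cdv_add : forall t x y, vge t x -> vge t y -> vge t (x + y);
  cdv_pi : exists2 p, p != 0 & 0 < w p /\
    forall x, x != 0 -> exists n : int, w x = n%:~R * w p;
  cdv_complete : forall u : nat -> A,
    (forall M : R, exists N : nat, forall p q : nat, (N <= p)%N -> (N <= q)%N ->
       vge M (u p - u q)) ->
    exists l : A, forall M : R, exists N : nat, forall p : nat, (N <= p)%N ->
       vge M (u p - l) }.

Hypothesis cA : cdv.

Lemma cdv_mulf_neq0 x y : x != 0 -> y != 0 -> x * y != 0.
Proof.
move=> /(cdv_unit cA) ux /(cdv_unit cA) uy.
have: x * y \is a GRing.unit by rewrite unitrMl.
by apply: contraTneq => ->; rewrite unitr0.
Qed.

Lemma cdv_invr_neq0 x : x != 0 -> x^-1 != 0.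
Proof. by rewrite invr_eq0. Qed.

Lemma cdv_1 : w 1 = 0.
Proof.
have := cdv_mul cA (oner_neq0 A) (oner_neq0 A); rewrite mulr1 => H; lra.
Qed.

Lemma cdv_N1 : w (-1) = 0.
Proof.
have N1 : (-1 : A) != 0 by rewrite oppr_eq0 oner_neq0.
have := cdv_mul cA N1 N1; rewrite mulrNN mulr1 cdv_1 => H; lra.
Qed.

Lemma cdv_V x : x != 0 -> w x^-1 = - w x.
Proof.
move=> x0; have := cdv_mul cA x0 (cdv_invr_neq0 x0).
rewrite divrr ?(cdv_unit cA) // cdv_1 => H; lra.
Qed.

Lemma cdv_N x : w (- x) = w x.
Proof.
have [->|x0] := eqVneq x 0; first by rewrite oppr0.
by rewrite -mulN1r (cdv_mul cA) ?oppr_eq0 ?oner_neq0// cdv_N1 add0r.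
Qed.

Lemma cdv_X x n : x != 0 -> x ^+ n != 0 /\ w (x ^+ n) = n%:R * w x.
Proof.
move=> x0; elim: n => [|n [xn0 IH]].
  by rewrite expr0 oner_neq0 cdv_1 mul0r.
by rewrite exprS cdv_mulf_neq0 // (cdv_mul cA) // IH -[n.+1]add1n natrD mulrDl mul1r.
Qed.

Lemma vge0 t : vge t 0. Proof. by left. Qed.

Lemma vgeN t x : vge t x -> vge t (- x).
Proof. by move=> [->|tx]; [rewrite oppr0; left | right; rewrite cdv_N]. Qed.

Lemma vgeB t x y : vge t x -> vge t y -> vge t (x - y).
Proof. by move=> tx ty; apply: (cdv_add cA) => //; exact: vgeN. Qed.

Lemma vge_sum (J : finType) t (F : J -> A) :
  (forall j, vge t (F j)) -> vge t (\sum_j F j).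
Proof.
move=> H; elim/big_ind: _ => // [|x y]; [exact: vge0 | exact: (cdv_add cA)].
Qed.

Lemma vgeM t s x y : vge t x -> vge s y -> vge (t + s) (x * y).
Proof.
move=> [->|tx]; first by rewrite mul0r; left.
move=> [->|sy]; first by rewrite mulr0; left.
have [->|x0] := eqVneq x 0; first by rewrite mul0r; left.
have [->|y0] := eqVneq y 0; first by rewrite mulr0; left.
by right; rewrite (cdv_mul cA) // lerD.
Qed.

Lemma vge_le t s x : s <= t -> vge t x -> vge s x.
Proof. by move=> st [->|tx]; [left | right; exact: le_trans tx]. Qed.

Lemma vge_neq0 t x : x != 0 -> vge t x -> t <= w x.
Proof. by move=> /eqP x0 []. Qed.

Lemma vge_self x : vge (w x) x. Proof. by right. Qed.

Lemma vge_all0 x : (forall t, vge t x) -> x = 0.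
Proof.
move=> H; apply/eqP; apply: contraT => x0.
have := vge_neq0 x0 (H (w x + 1)); lra.
Qed.

Lemma cdv_expz x (n : int) : x != 0 ->
  x ^ n != 0 /\ w (x ^ n) = n%:~R * w x.
Proof.
move=> x0; case: n => n /=; first by rewrite -exprnP; exact: cdv_X.
have [H1 H2] := cdv_X n.+1 x0.
by rewrite NegzE -exprnN cdv_invr_neq0 // cdv_V // H2 mulrNz mulNr.
Qed.

Lemma cdv_1D x : x != 0 -> 0 < w x -> 1 + x != 0 /\ w (1 + x) = 0.
Proof.
move=> x0 wx.
have N : 1 + x != 0.
  apply/negP => /eqP /(canRL (addKr _)); rewrite addr0 => xE.
  by move: wx; rewrite xE cdv_N1 ltxx.
split=> //; apply/eqP; rewrite eq_le; apply/andP; split.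
  rewrite leNgt; apply/negP => lt; have [lt'|lt'] := lerP (w x) (w (1 + x)).
    have : vge (w x) (1 + x - x) by apply: vgeB; right.
    rewrite addrK => /(vge_neq0 (oner_neq0 _)); rewrite cdv_1 => ?; lra.
  have : vge (w (1 + x)) (1 + x - x) by apply: vgeB; right => //; exact: ltW.
  rewrite addrK => /(vge_neq0 (oner_neq0 _)); rewrite cdv_1 => ?; lra.
apply: (vge_neq0 N); apply: (cdv_add cA); right; first by rewrite cdv_1.
exact: ltW.
Qed.

End ValuedDivisionRing.

(** * Norms on modules, given by their balls *)

Section ModuleNorms.
Variables (R : realType) (A : unitRingType) (w : A -> R).
Variables (V : zmodType) (act : A -> V -> V).
Implicit Types (X : set V) (L : R -> set V) (a : A).

Record rmod X : Prop := {
  rmod0 : X 0;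
  rmodD : forall u v, X u -> X v -> X (u + v);
  rmod_act : forall a v, X v -> X (act a v);
  rmod_actDr : forall a u v, act a (u + v) = act a u + act a v;
  rmod_actDl : forall a b v, act (a + b) v = act a v + act b v;
  rmod_actM : forall a b v, act (a * b) v = act b (act a v);
  rmod_act1 : forall v, X v -> act 1 v = v }.

Definition fgen X : Prop :=
  exists n (b : 'I_n -> V), X = range (fun a : 'I_n -> A => \sum_i act (a i) (b i)).

(* L t is the set of v in X of norm at least t, for a norm compatible with w *)
Record nlf X L : Prop := {
  nlf_sub : forall t v, L t v -> X v;
  nlf0 : forall t, L t 0;
  nlfD : forall t u v, L t u -> L t v -> L t (u + v);
  nlf_act : forall t a v, a != 0 -> L t v -> L (t + w a) (act a v);
  nlf_le : forall s t v, s <= t -> L t v -> L s v;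
  nlf_left : forall t v, X v -> (forall s, s < t -> L s v) -> L t v;
  nlf_ex : forall v, X v -> exists t, L t v;
  nlf_sep : forall v, X v -> (forall t, L t v) -> v = 0 }.

(** Linear independence follows from the last clause when [L] is a norm: a vanishing combination
    lies in every ball, hence so does each of its terms. *)
Definition orth_basis X L n (v : 'I_n -> V) : Prop :=
  [/\ forall i, X (v i) /\ v i != 0,
      forall x, X x -> exists a : 'I_n -> A, x = \sum_i act (a i) (v i)
    & forall t (a : 'I_n -> A), L t (\sum_i act (a i) (v i)) ->
        forall i, L t (act (a i) (v i))].

Section Rmod.
Variable X : set V.
Hypothesis mX : rmod X.

Lemma rmod_act_r0 a : act a 0 = 0.
Proof.
apply: (addrI (act a 0)); by rewrite -(rmod_actDr mX) !addr0.
Qed.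

Lemma rmod_act_rN a v : act a (- v) = - act a v.
Proof. by apply/eqP; rewrite -addr_eq0 -(rmod_actDr mX) addNr rmod_act_r0. Qed.

Lemma rmod_act_0l v : act 0 v = 0.
Proof.
by apply: (addrI (act 0 v)); rewrite -(rmod_actDl mX) !addr0.
Qed.

Lemma rmod_act_Nl a v : act (- a) v = - act a v.
Proof.
by apply/eqP; rewrite -addr_eq0 -(rmod_actDl mX) addNr rmod_act_0l.
Qed.

Lemma rmodN v : X v -> X (- v).
Proof.
move=> Xv; rewrite -(rmod_act1 mX Xv) -rmod_act_Nl; exact: (rmod_act mX).
Qed.

Lemma rmodB u v : X u -> X v -> X (u - v).
Proof. by move=> Xu Xv; apply: (rmodD mX) => //; exact: rmodN. Qed.

Lemma rmod_sum (J : finType) (F : J -> V) : (forall j, X (F j)) -> X (\sum_j F j).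
Proof.
move=> H; elim/big_ind: _ => // [|x y]; [exact: (rmod0 mX) | exact: (rmodD mX)].
Qed.

Lemma rmod_act_sum (J : finType) a (F : J -> V) :
  act a (\sum_j F j) = \sum_j act a (F j).
Proof.
by apply: (big_morph (act a)); [exact: (rmod_actDr mX) | exact: rmod_act_r0].
Qed.

Lemma rmod_actK a v : a \is a GRing.unit -> X v -> act a^-1 (act a v) = v.
Proof. by move=> ua Xv; rewrite -(rmod_actM mX) mulrV // (rmod_act1 mX). Qed.

Lemma rmod_actVK a v : a \is a GRing.unit -> X v -> act a (act a^-1 v) = v.
Proof. by move=> ua Xv; rewrite -(rmod_actM mX) mulVr // (rmod_act1 mX). Qed.

Lemma rmod_act_eq0 a v : a \is a GRing.unit -> X v -> act a v = 0 -> v = 0.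
Proof. by move=> ua Xv av0; rewrite -(rmod_actK ua Xv) av0 rmod_act_r0. Qed.

Hypothesis cA : cdv w.
Variable L : R -> set V.
Hypothesis nL : nlf X L.

Lemma nlfN t v : L t v -> L t (- v).
Proof.
move=> Lv; have Xv := nlf_sub nL Lv.
rewrite -(rmod_act1 mX Xv) -rmod_act_Nl -[t]addr0 -(cdv_N1 cA).
by apply: (nlf_act nL); rewrite // oppr_eq0 oner_neq0.
Qed.

Lemma nlfB t u v : L t u -> L t v -> L t (u - v).
Proof. by move=> Lu Lv; apply: (nlfD nL) => //; exact: nlfN. Qed.

Lemma nlf_sum (J : finType) t (F : J -> V) :
  (forall j, L t (F j)) -> L t (\sum_j F j).
Proof.
move=> H; elim/big_ind: _ => // [|x y]; [exact: (nlf0 nL) | exact: (nlfD nL)].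
Qed.

Lemma nlf_actE t a v : a != 0 -> X v -> (L (t + w a) (act a v) <-> L t v).
Proof.
move=> a0 Xv; split; last exact: (nlf_act nL).
move=> /(nlf_act nL (cdv_invr_neq0 a0)).
by rewrite (rmod_actK (cdv_unit cA a0)) // (cdv_V cA) // addrK.
Qed.

Lemma nlf_act_vge t s a v : vge w s a -> L t v -> L (t + s) (act a v).
Proof.
move=> [->|sa] Lv; first by rewrite rmod_act_0l; exact: (nlf0 nL).
have [->|a0] := eqVneq a 0.
  by rewrite rmod_act_0l; exact: (nlf0 nL).
apply: (@nlf_le _ _ nL _ (t + w a)); first by rewrite lerD2l.
exact: (nlf_act nL).
Qed.

(** The supremum is finite because a nonzero vector leaves some ball ([nlf_sep]), and it is attained
    by left continuity. *)
Lemma nlf_norm v : X v -> v != 0 -> forall t, L t v <-> t <= norm_lf L v.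
Proof.
move=> Xv v0.
have [t0 Lt0] := nlf_ex nL Xv.
have [B BP] : exists B, ~ L B v.
  apply: contrapT => H; move/eqP: v0; apply; apply: (nlf_sep nL Xv) => t.
  by apply: contrapT => Lt; apply: H; exists t.
have ub : ubound [set t | L t v] B.
  move=> t /= Lt; rewrite leNgt; apply/negP => Bt; apply: BP.
  by apply: (nlf_le nL) Lt; exact: ltW.
have hs : has_sup [set t | L t v] by split; [exists t0 | exists B].
move=> t; split=> [Lt|le].
  by apply: sup_ubound => //; exists B.
apply: (nlf_left nL Xv) => s st.
have [t' Lt' st'] := sup_gt hs.1 (lt_le_trans st le).
by apply: (nlf_le nL) Lt'; exact: ltW.
Qed.

Lemma norm_lf_act a v : X v -> v != 0 -> a != 0 ->
  norm_lf L (act a v) = norm_lf L v + w a.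
Proof.
move=> Xv v0 a0.
have Xav := rmod_act mX a Xv.
have av0 : act a v != 0.
  by apply: contra_neq v0 => /(rmod_act_eq0 (cdv_unit cA a0) Xv).
apply/eqP; rewrite eq_le; apply/andP; split.
  rewrite -lerBlDr; apply/(nlf_norm Xv v0)/(nlf_actE _ a0 Xv); rewrite subrK.
  exact/(nlf_norm Xav av0).
by apply/(nlf_norm Xav av0)/(nlf_actE _ a0 Xv)/(nlf_norm Xv v0).
Qed.

End Rmod.
End ModuleNorms.

Lemma fin_pos_min (R : realType) n (e : 'I_n -> R) :
  (forall i, 0 < e i) -> exists2 e0, 0 < e0 & forall i, e0 <= e i.
Proof.
move=> e_gt0; exists (\big[Order.min/1]_i e i).
  by elim/big_ind: _ => [|x y x0 y0|i _]; rewrite ?ltr01 ?lt_min ?x0 ?y0.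
by move=> i; rewrite (bigD1 i) //= ge_min lexx.
Qed.

(** * Existence of orthogonal bases *)

Section OrthogonalBasis.
Variables (R : realType) (A : unitRingType) (w : A -> R).
Variables (V : zmodType) (act : A -> V -> V) (X : set V) (L : R -> set V).
Hypotheses (cA : cdv w) (mX : rmod act X) (nL : nlf w act X L).

Definition span n (b : 'I_n -> V) : set V :=
  range (fun a : 'I_n -> A => \sum_i act (a i) (b i)).

Lemma span_sub n (b : 'I_n -> V) : (forall i, X (b i)) -> span b `<=` X.
Proof.
by move=> Xb _ [a _ <-]; apply: (rmod_sum mX) => i; exact: (rmod_act mX).
Qed.

Lemma rmod_span n (b : 'I_n -> V) : (forall i, X (b i)) -> rmod act (span b).
Proof.
move=> Xb; have sX := span_sub Xb; split.
- exists (fun=> 0) => //; rewrite big1 // => i _; exact: (rmod_act_0l mX).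
- move=> _ _ [a _ <-] [c _ <-]; exists (fun i => a i + c i) => //.
  rewrite -big_split; apply: eq_bigr => i _; exact: (rmod_actDl mX).
- move=> c _ [a _ <-]; exists (fun i => a i * c) => //.
  rewrite (rmod_act_sum mX); apply: eq_bigr => i _; exact: (rmod_actM mX).
- exact: (rmod_actDr mX).
- exact: (rmod_actDl mX).
- exact: (rmod_actM mX).
- by move=> v /sX Xv; apply: (rmod_act1 mX).
Qed.

(** The norm of [x] is attained by one term of its expansion: otherwise each term would lie in a
    strictly smaller ball, and the least of these finitely many gaps would increase the norm of
    [x]. *)
Lemma orth_basis_values n (v : 'I_n -> V) (Y : set V) p :
  Y `<=` X -> orth_basis act Y L v ->
  (forall x, x != 0 -> exists m : int, w x = m%:~R * w p) ->
  forall x, Y x -> x != 0 -> exists i (m : int),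
    norm_lf L x = norm_lf L (v i) + m%:~R * w p.
Proof.
move=> YX [Yv Yspan Lv] pP x Yx x0.
have [a xE] := Yspan x Yx.
have Xv i : X (v i) by apply: YX; exact: (Yv i).1.
apply: contrapT => H.
have [|e e0] := @choice _ _ (fun i e => 0 < e /\
    L (norm_lf L x + e) (act (a i) (v i))).
  move=> i; have [ai0|ai0] := eqVneq (a i) 0.
    by exists 1; rewrite ai0 (rmod_act_0l mX) //; split=> //; exact: (nlf0 nL).
  have Lx : L (norm_lf L x) (act (a i) (v i)).
    by apply: Lv; rewrite -xE; apply/(nlf_norm nL (YX _ Yx) x0).
  have av0 : act (a i) (v i) != 0.
    apply: contra_neq (Yv i).2; exact: (rmod_act_eq0 mX (cdv_unit cA ai0)).
  have Xav := rmod_act mX (a i) (Xv i).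
  exists (norm_lf L (act (a i) (v i)) - norm_lf L x); split; last first.
    by apply/(nlf_norm nL Xav av0); rewrite addrC subrK.
  rewrite subr_gt0 lt_neqAle; apply/andP; split; last exact/(nlf_norm nL Xav av0).
  apply/negP => /eqP E; apply: H.
  have [m wm] := pP _ ai0; exists i, m.
  by rewrite E (norm_lf_act mX cA nL) ?wm // (Yv i).2.
have [e1 e1_gt0 e1P] := @fin_pos_min _ _ e (fun i => (e0 i).1).
have : L (norm_lf L x + e1) x.
  rewrite {2}xE; apply: (nlf_sum nL) => i.
  by apply: (nlf_le nL) (e0 i).2; rewrite lerD2l.
move/(nlf_norm nL (YX _ Yx) x0); lra.
Qed.

(** Orthogonality bounds each coordinate of a difference by the norm of the difference, so Cauchy
    sequences have Cauchy coordinates. *)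
Lemma orth_basis_complete n (v : 'I_n -> V) (Y : set V) (u : nat -> V) :
  Y `<=` X -> rmod act Y -> orth_basis act Y L v -> (forall p, Y (u p)) ->
  (forall M, exists N, forall p q, (N <= p)%N -> (N <= q)%N -> L M (u p - u q)) ->
  exists2 l, Y l & forall M, exists N, forall p, (N <= p)%N -> L M (u p - l).
Proof.
move=> YX mY [Yv Yspan Lv] Yu cu.
have Xv i : X (v i) by apply: YX; exact: (Yv i).1.
have nv i := nlf_norm nL (Xv i) (Yv i).2.
have actB c c' x : act (c - c') x = act c x - act c' x.
  by rewrite (rmod_actDl mX) (rmod_act_Nl mX).
have [|a aP] := @choice _ _ (fun p (a : 'I_n -> A) => u p = \sum_i act (a i) (v i)).
  by move=> p; exact: Yspan.
have [i|l lP] := @choice _ _ (fun i (l : A) => forall M : R, exists N : nat,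
    forall p, (N <= p)%N -> vge w M (a p i - l)).
  apply: (cdv_complete cA (u := fun p => a p i)) => M.
  have [N NP] := cu (M + norm_lf L (v i)).
  exists N => p q Np Nq; have := NP p q Np Nq.
  rewrite !aP -sumrB; under eq_bigr do rewrite -actB.
  move=> /Lv /(_ i) Li.
  have [->|d0] := eqVneq (a p i - a q i) 0; first by left.
  right; move: Li => /(nlf_norm nL).
  have d1 : act (a p i - a q i) (v i) != 0.
    apply: contra_neq (Yv i).2; exact: (rmod_act_eq0 mX (cdv_unit cA d0)).
  move=> /(_ (rmod_act mX _ (Xv i)) d1).
  by rewrite (norm_lf_act mX cA nL) ?(Yv i).2 // => ?; lra.
exists (\sum_i act (l i) (v i)).
  by apply: (rmod_sum mY) => i; apply: (rmod_act mY); exact: (Yv i).1.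
move=> t.
have [i|N NP] := @choice _ _ (fun i (N : nat) => forall p, (N <= p)%N ->
  vge w (t - norm_lf L (v i)) (a p i - l i)).
  exact: lP.
exists (\max_i N i) => p Np.
rewrite aP -sumrB; under eq_bigr do rewrite -actB.
apply: (nlf_sum nL) => i.
rewrite -[t](subrK (norm_lf L (v i))) addrC.
apply: (nlf_act_vge mX nL); last exact/nv.
by apply: NP; apply: leq_trans Np; exact: leq_bigmax.
Qed.

(** Otherwise elements [y] of [Y] with [b + y] in ever smaller balls would form a Cauchy sequence,
    whose limit in [Y] would be [- b]. *)
Lemma orth_basis_bounded n (v : 'I_n -> V) (Y : set V) b :
  Y `<=` X -> rmod act Y -> orth_basis act Y L v -> X b -> ~ Y b ->
  exists B, forall t y, Y y -> L t (b + y) -> t <= B.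
Proof.
move=> YX mY ob Xb Yb; apply: contrapT => H; apply: Yb.
have [N|y yP] := @choice _ _ (fun (N : nat) y => Y y /\ L N%:R (b + y)).
  apply: contrapT => HN; apply: H; exists N%:R => t y Yy Lt.
  rewrite leNgt; apply/negP => Nt; apply: HN.
  by exists y; split=> //; apply: (nlf_le nL) Lt; exact: ltW.
have nat_ge (t : R) : exists N : nat, t <= N%:R.
  by exists (Num.truncn t).+1; rewrite ltW // truncnS_gt.
have [p|M|l Yl lP] := orth_basis_complete (u := y) YX mY ob; first exact: (yP p).1.
  have [N NP] := nat_ge M; exists N => p q Np Nq.
  have -> : y p - y q = (b + y p) - (b + y q) by rewrite opprD addrACA subrr add0r.
  apply: (nlfB mX cA nL); apply: (nlf_le nL) (yP _).2;
    by apply: le_trans NP _; rewrite ler_nat.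
suff /eqP : b + l = 0 by rewrite addr_eq0 => /eqP ->; exact: (rmodN mY).
apply: (nlf_sep nL) => [|t]; first by apply: (rmodD mX) => //; exact: YX.
have [N NP] := lP t; have [N0 N0P] := nat_ge t.
have -> : b + l = (b + y (maxn N N0)) - (y (maxn N N0) - l).
  by rewrite opprB [in RHS](addrC l) addrA addrK.
apply: (nlfB mX cA nL); last by apply: NP; exact: leq_maxl.
by apply: (nlf_le nL) (yP _).2; rewrite (le_trans N0P) // ler_nat leq_maxr.
Qed.

Lemma span_recl n (b : 'I_n.+1 -> V) x : span b x <->
  exists (c : A) y, span (fun i => b (lift ord0 i)) y /\ x = act c (b ord0) + y.
Proof.
split.
  move=> [a _ <-]; rewrite big_ord_recl; exists (a ord0), (\sum_(i < n) act (a (lift ord0 i)) (b (lift ord0 i))).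
  by split=> //; exists (fun i => a (lift ord0 i)).
move=> [c [_ [[a _ <-] ->]]].
exists (fun i => if unlift ord0 i is Some j then a j else c) => //.
rewrite big_ord_recl unlift_none; congr (_ + _).
by apply: eq_bigr => i _; rewrite liftK.
Qed.

(** Gram-Schmidt for norms: an element [u] of largest norm in the coset of [b ord0] modulo [Y] is
    orthogonal to [Y], since dividing a combination of [u] and an element of [Y] by the coefficient
    of [u] gives an element of that coset again. The largest norm exists by [discrete_max], because
    a norm in the coset that is smaller than another one there is the norm of their difference, an
    element of [Y]. *)
Lemma orth_basis_span n (b : 'I_n -> V) : (forall i, X (b i)) ->
  exists m (v : 'I_m -> V), orth_basis act (span b) L v.
Proof.
elim: n b => [|n IH] b Xb.
  exists 0%N, b; split=> [[]//|x [a _ <-]|t a _ []//].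
  by exists a.
have Xb' i : X (b (lift ord0 i)) by [].
set Y := span (fun i => b (lift ord0 i)).
have mY : rmod act Y := rmod_span Xb'.
have YX : Y `<=` X := span_sub Xb'.
have [m [v ob]] := IH _ Xb'; have [Yv Yspan Lv] := ob.
have YS y : Y y -> span b y.
  move=> Yy; apply/span_recl; exists 0, y; split=> //.
  by rewrite (rmod_act_0l mX) // add0r.
have [Yb|Yb] := pselect (Y (b ord0)).
  exists m, v; split=> // [i|x /span_recl[c [y [Yy ->]]]].
    by split; [apply: YS; exact: (Yv i).1 | exact: (Yv i).2].
  by apply: Yspan; apply: (rmodD mY) => //; exact: (rmod_act mY).
have [p p0 [wp pP]] := cdv_pi cA.
have bY0 y : Y y -> b ord0 + y != 0.
  move=> Yy; apply: contra_notN Yb; rewrite addr_eq0 => /eqP ->.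
  exact: (rmodN mY).
have bYX y : Y y -> X (b ord0 + y) by move=> /YX Xy; apply: (rmodD mX).
have nb y : Y y -> forall t, L t (b ord0 + y) <-> t <= norm_lf L (b ord0 + y).
  by move=> Yy; apply: (nlf_norm nL); [exact: bYX | exact: bY0].
have [| | |t0 [y0 Yy0 y0E] t0P] := @discrete_max R m (fun i => norm_lf L (v i))
    (w p) [set norm_lf L (b ord0 + y) | y in Y] wp.
- by exists (norm_lf L (b ord0 + 0)), 0 => //; exact: (rmod0 mY).
- have [B BP] := orth_basis_bounded YX mY ob (Xb ord0) Yb.
  by exists B => _ [y Yy <-]; apply: (BP _ y) => //; apply/nb.
- move=> _ _ [y Yy <-] [z Yz <-] lt.
  have Yd : Y (y - z) by exact: (rmodB mY).
  have dE : b ord0 + y = (b ord0 + z) + (y - z) by rewrite addrACA addrN addr0.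
  have d0 : y - z != 0.
    by apply: contraTneq lt => d0; rewrite dE d0 addr0 ltxx.
  have [i [k E]] := orth_basis_values YX ob pP Yd d0.
  exists i, k; rewrite -E; apply/eqP; rewrite eq_le; apply/andP; split.
    apply/(nlf_norm nL (YX _ Yd) d0).
    rewrite -(addrK (b ord0 + z) (y - z)) [_ - _ + _]addrC -dE.
    apply: (nlfB mX cA nL); first exact/nb.
    by apply/nb => //; exact: ltW.
  rewrite leNgt; apply/negP => lt'.
  have : L (Order.min (norm_lf L (b ord0 + z)) (norm_lf L (y - z))) (b ord0 + y).
    rewrite dE; apply: (nlfD nL).
      by apply/nb => //; rewrite ge_min lexx.
    by apply/(nlf_norm nL (YX _ Yd) d0); rewrite ge_min lexx orbT.
  by move=> /nb -/(_ Yy); rewrite ge_min !leNgt lt lt'.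
pose u := b ord0 + y0.
have Su : span b u.
  by apply/span_recl; exists 1, y0; split=> //; rewrite (rmod_act1 mX).
exists m.+1, (fun i => if unlift ord0 i is Some j then v j else u); split.
- move=> i; case: unliftP => [j|] _.
    by split; [apply: YS; exact: (Yv j).1 | exact: (Yv j).2].
  by split=> //; exact: bY0.
- move=> x /span_recl[c [y [Yy ->]]].
  have [a aE] : exists a : 'I_m -> A, y - act c y0 = \sum_i act (a i) (v i).
    by apply: Yspan; apply: (rmodB mY) => //; exact: (rmod_act mY).
  exists (fun i => if unlift ord0 i is Some j then a j else c).
  rewrite big_ord_recl unlift_none; under eq_bigr do rewrite liftK.
  by rewrite -aE (rmod_actDr mX) addrACA addrN addr0.
- move=> t a; rewrite big_ord_recl unlift_none.
  under eq_bigr do rewrite liftK.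
  set y := \sum_i _; set c := a ord0 => Lt.
  have Yy : Y y.
    by apply: (rmod_sum mY) => j; apply: (rmod_act mY); exact: (Yv j).1.
  have Lcu : L t (act c u).
    have [c0|c0] := eqVneq c 0.
      by rewrite c0 (rmod_act_0l mX); exact: (nlf0 nL).
    have uc := cdv_unit cA c0.
    rewrite -[t](subrK (w c)); apply: (nlf_act nL c0); apply/nb => //.
    rewrite y0E.
    have Yz : Y (y0 + act c^-1 y).
      by apply: (rmodD mY) => //; exact: (rmod_act mY).
    apply: le_trans (t0P _ (ex_intro2 _ _ _ Yz erefl)).
    apply/nb => //; rewrite addrA -/u -(rmod_actK mX uc (bYX _ Yy0 : X u)) -(rmod_actDr mX).
    by rewrite -(cdv_V cA c0); apply: (nlf_act nL) => //; exact: cdv_invr_neq0.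
  have Ly : L t y.
    by rewrite -[y](addKr (act c u)) addrC; apply: (nlfB mX cA nL).
  move=> i; case: unliftP => [j ->|-> //].
  exact: (Lv t (fun j => a (lift ord0 j)) Ly j).
Qed.

Theorem orth_basis_exists : fgen act X -> exists n (v : 'I_n -> V), orth_basis act X L v.
Proof.
move=> [n [b XE]].
have Xb i : X (act 1 (b i)).
  rewrite XE; exists (fun j => if j == i then 1 else 0) => //.
  by rewrite (bigD1 i) //= eqxx big1 ?addr0 // => j /negPf ->; rewrite (rmod_act_0l mX).
have [m [v ob]] := orth_basis_span Xb; exists m, v.
suff -> : X = span (fun i => act 1 (b i)) by [].
rewrite XE; apply/seteqP; split=> x [a _ <-]; exists a => //;
  apply: eq_bigr => i _; by rewrite -(rmod_actM mX) mul1r.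
Qed.

End OrthogonalBasis.

(** * Finite extensions of complete discretely valued division rings *)

Section Extension.
Variables (R : realType) (A : unitRingType) (w : A -> R) (cA : cdv w).
Variables (B : unitRingType) (emb : A -> B) (wB : B -> R).
Hypotheses (embD : forall a b : A, emb (a + b) = emb a + emb b)
  (embM : forall a b : A, emb (a * b) = emb a * emb b) (emb1 : emb 1 = 1).
Hypothesis fgB : fgen (fun a x => x * emb a) [set: B].
Hypotheses (uB : forall x : B, x != 0 -> x \is a GRing.unit)
  (wBM : forall x y : B, x != 0 -> y != 0 -> wB (x * y) = wB x + wB y)
  (wBD : forall t (x y : B), vge wB t x -> vge wB t y -> vge wB t (x + y))
  (wBE : forall a : A, a != 0 -> wB (emb a) = w a).

Let act (a : A) (x : B) := x * emb a.
Let L (t : R) : set B := [set x | vge wB t x].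

Let rB : rmod act [set: B].
Proof.
by split=> // *; rewrite /act ?embD ?embM ?emb1 ?mulrDr ?mulrDl ?mulrA ?mulr1.
Qed.

Let embN0 (a : A) : a != 0 -> emb a != 0.
Proof.
move=> a0; apply/eqP => ea; have := embM a a^-1.
by rewrite divrr ?(cdv_unit cA) // emb1 ea mul0r => /eqP; rewrite oner_eq0.
Qed.

Let nB : nlf w act [set: B] L.
Proof.
split=> //.
- by move=> t; left.
- move=> t a v a0 [->|tv]; first by left; rewrite /act mul0r.
  have [->|v0] := eqVneq v 0; first by left; rewrite /act mul0r.
  by right; rewrite wBM ?embN0 // wBE // lerD2r.
- by move=> s t v st [->|tv]; [left | right; exact: le_trans tv].
- move=> t v _ H; have [v0|v0] := pselect (v = 0); first by left.
  right; rewrite leNgt; apply/negP => lt.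
  have [|//|] := H ((wB v + t) / 2); lra.
- by move=> v _; exists (wB v); right.
- move=> v _ H; apply: contrapT => v0.
  by have [//|] := H (wB v + 1); lra.
Qed.

Let normE (x : B) : x != 0 -> norm_lf L x = wB x.
Proof.
move=> x0; have nx := nlf_norm nB (I : [set: B] x) x0.
apply/eqP; rewrite eq_le; apply/andP; split.
  by have /nx[/eqP|//] := lexx (norm_lf L x); rewrite (negPf x0).
by apply/nx; right.
Qed.

(** [B] is a normed module over [A]. An orthogonal basis makes it complete and confines its values
    to finitely many cosets of the value group of [A]; hence there is a least positive value, and
    Euclidean division shows that it generates all values. *)
Lemma cdv_ext : cdv wB.
Proof.
have [n [v ob]] := orth_basis_exists cA rB nB fgB.
have [p p0 [wp pP]] := cdv_pi cA.
have w1 : wB 1 = 0.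
  have := wBM (oner_neq0 B) (oner_neq0 B); rewrite mulr1 => ?; lra.
have wV (x : B) : x != 0 -> wB x^-1 = - wB x.
  move=> x0; have := wBM x0 (_ : x^-1 != 0); rewrite invr_eq0 => /(_ x0).
  rewrite divrr ?uB // w1 => ?; lra.
have mN0 (x y : B) : x != 0 -> y != 0 -> x * y != 0.
  move=> /uB ux /uB uy; have: x * y \is a GRing.unit by rewrite unitrMl.
  by apply: contraTneq => ->; rewrite unitr0.
have wN (x : B) : wB (- x) = wB x.
  have [->|x0] := eqVneq x 0; first by rewrite oppr0.
  have N1 : (-1 : B) != 0 by rewrite oppr_eq0 oner_neq0.
  have := wBM N1 N1; rewrite mulrNN mulr1 w1 => H.
  by rewrite -mulN1r wBM //; lra.
have wX (x : B) (m : nat) : x != 0 -> x ^+ m != 0 /\ wB (x ^+ m) = m%:R * wB x.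
  move=> x0; elim: m => [|m [xm IH]]; first by rewrite expr0 oner_neq0 w1 mul0r.
  by rewrite exprS mN0 // wBM // IH -[m.+1]add1n natrD mulrDl mul1r.
have wZ (x : B) (m : int) : x != 0 -> x ^ m != 0 /\ wB (x ^ m) = m%:~R * wB x.
  move=> x0; case: m => m; first by rewrite -exprnP; exact: wX.
  have [H1 H2] := wX _ m.+1 x0.
  by rewrite NegzE -exprnN invr_eq0 H1 wV // H2 mulrNz mulNr.
split=> //; last first.
  move=> u cu.
  have [//|M|l _ lP] := @orth_basis_complete _ _ _ _ _ _ _ cA rB nB _ _ _ u
    (@subset_refl _ _) rB ob; first exact: cu.
  by exists l.
have vals (x : B) : x != 0 -> exists i (m : int), wB x = wB (v i) + m%:~R * w p.
  move=> x0; have [i [m E]] := orth_basis_values cA rB nB (@subset_refl _ _) ob pP I x0.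
  by case: ob => vN0 _ _; exists i, m; rewrite -!normE ?(vN0 i).2.
(* Values are negated because [discrete_max] yields a maximum and the least positive value is
   wanted. *)
have [| | |_ [q [q0 wq] <-] qmin] := @discrete_max R n (fun i => - wB (v i)) (w p)
  [set - wB x | x in [set x : B | x != 0 /\ 0 < wB x]] wp.
- by exists (- wB (emb p)), (emb p); split=> //=; [exact: embN0 | rewrite wBE].
- by exists 0 => _ [x [_ wx] <-]; rewrite oppr_le0 ltW.
- move=> _ _ [x [x0 _] <-] _ _; have [i [m E]] := vals x x0.
  by exists i, (- m); rewrite E mulrNz; lra.
exists q => //; split=> // x x0; exists (Num.floor (wB x / wB q)).
set m := Num.floor _.
have [qm0 qmE] := wZ q (- m) q0.
have E := wBM x0 qm0; rewrite qmE mulrNz in E.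
have /andP[le1 lt1] := floor_itv (wB x / wB q).
rewrite -/m ler_pdivlMr // in le1.
rewrite -/m ltr_pdivrMr // intrD mulrDl mul1r in lt1.
apply/eqP; rewrite eq_le le1 andbT leNgt; apply/negP => lt2.
have /qmin : [set - wB x | x in [set x : B | x != 0 /\ 0 < wB x]] (- wB (x * q ^ (- m))).
  by exists (x * q ^ (- m)) => //; split; [exact: mN0 | rewrite E; lra].
by rewrite lerN2 E; lra.
Qed.

End Extension.

(** * Lattice functions are the ball families of norms *)

Section LatticeFunctionsAsNorms.
Variables (R : realType) (A : unitRingType) (nu : A -> \bar R) (w : A -> R) (c : R).

(* [w] is the multiple of [nu] whose smallest positive value is [c]. *)
Record normalized : Prop := {
  nz_cdv : cdv w;
  nz_gt0 : 0 < c;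
  nz_unif : exists2 p, p != 0 & w p = c;
  nz_vals : forall x, x != 0 -> exists m : int, w x = m%:~R * c;
  nz_int : forall x, integers nu x <-> vge w 0 x;
  nz_max : forall x, max_ideal nu x <-> vge w c x }.

Hypothesis nw : normalized.
Let cA := nz_cdv nw.

Variables (V : zmodType) (act : A -> V -> V) (X : set V) (mX : rmod act X).

(** The vectors generating a lattice may be dependent, so separation cannot be read off coordinates.
    Two different expressions of [x] give a linear relation; dividing it by its coefficient of least
    value expresses one [b j] through the others with integral coefficients, and eliminating this
    [b j] keeps the coefficients small. *)
Lemma small_coefs_eq0 n (b : 'I_n -> V) x : (forall i, X (b i)) ->
  (forall t, exists2 a : 'I_n -> A,
    (forall i, vge w t (a i)) & x = \sum_i act (a i) (b i)) -> x = 0.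
Proof.
elim: n b => [|n IH] b Xb H; first by have [a _ ->] := H 0; rewrite big_ord0.
have [a _ xE] := H 0.
have [/forallP a0|] := boolP [forall i, a i == 0].
  rewrite xE big1 // => i _; rewrite (eqP (a0 i)); exact: (rmod_act_0l mX).
rewrite negb_forall => /existsP[i0 ai0].
have [a' a'P xE'] := H (w (a i0) + 1).
pose r i := a i - a' i.
have ri0 : r i0 != 0.
  rewrite subr_eq0; apply/eqP => E; have := a'P i0.
  by rewrite -E => /(vge_neq0 ai0); lra.
have rel : \sum_i act (r i) (b i) = 0.
  under eq_bigr do rewrite /r (rmod_actDl mX) (rmod_act_Nl mX).
  by rewrite sumrB -xE -xE' subrr.
have [j rj0 jmin] : exists2 j, r j != 0 & forall i, vge w (w (r j)) (r i).
  case: (@arg_minP _ _ _ i0 (fun i => r i != 0) (fun i => w (r i)) ri0) => j rj0 jmin.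
  exists j => // i; have [->|ri] := eqVneq (r i) 0; first by left.
  by right; apply: jmin.
have uj := cdv_unit cA rj0.
pose e i := - (r (lift j i) / r j).
have eP i : vge w 0 (e i).
  apply: (vgeN cA); rewrite -[0](subrr (w (r j))); apply: (vgeM cA) => //.
  by rewrite -(cdv_V cA) //; exact: vge_self.
have bj : b j = \sum_(i < n) act (e i) (b (lift j i)).
  move: rel; rewrite (bigD1_ord j) //= => /eqP; rewrite addr_eq0 => /eqP E.
  rewrite -{1}(rmod_actK mX uj (Xb j)) E (rmod_act_rN mX) (rmod_act_sum mX) -sumrN.
  by apply: eq_bigr => i _; rewrite -(rmod_actM mX) -(rmod_act_Nl mX).
apply: (IH (fun i => b (lift j i))) => // t.
have [f fP ->] := H t; exists (fun i => f (lift j i) + e i * f j).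
  by move=> i; apply: (cdv_add cA) => //; rewrite -[t]add0r; apply: (vgeM cA).
rewrite (bigD1_ord j) //= bj (rmod_act_sum mX) -big_split; apply: eq_bigr => i _.
by rewrite (rmod_actDl mX) (rmod_actM mX) addrC.
Qed.

Lemma lattice_act_vge M a v : is_lattice nu act X M -> vge w 0 a -> M v -> M (act a v).
Proof.
move=> [n [b [-> _]]] a0 [f fP <-]; exists (fun i => f i * a).
  move=> i; apply/(nz_int nw); rewrite -[0]addr0; apply: (vgeM cA) => //.
  exact/(nz_int nw)/fP.
by rewrite (rmod_act_sum mX); apply: eq_bigr => i _; rewrite (rmod_actM mX).
Qed.

Lemma latticeD M u v : is_lattice nu act X M -> M u -> M v -> M (u + v).
Proof.
move=> [n [b [-> _]]] [f fP <-] [g gP <-]; exists (fun i => f i + g i).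
  move=> i; apply/(nz_int nw); apply: (cdv_add cA); apply/(nz_int nw).
    exact: fP.
  exact: gP.
by rewrite -big_split; apply: eq_bigr => i _; rewrite (rmod_actDl mX).
Qed.

Lemma lattice_sub M : is_lattice nu act X M -> M `<=` X.
Proof. by move=> [n [b [-> ->]]] _ [f _ <-]; exists f. Qed.

(** The period axiom speaks of the span of products with the maximal ideal; [per1] and [per2]
    extract from it that a uniformizer and its inverse shift levels by exactly [c]. Any other scalar
    is a power of the uniformizer times a unit. *)
Lemma lattice_nlf L : lattice_function nu act X c L -> nlf w act X L.
Proof.
move=> lL; have lat r := latf_lattice lL r.
have [p p0 wp] := nz_unif nw; have up := cdv_unit cA p0.
have c0 := nz_gt0 nw.
have per1 r v : L r v -> L (r + c) (act p v).
  move=> Lv; rewrite -(latf_period lL); exists 1%N, (fun=> p), (fun=> v).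
  split; last by rewrite big_ord1.
  by move=> _; split=> //; apply/(nz_max nw); right; rewrite wp.
have per2 r v : L (r + c) v -> L r (act p^-1 v).
  rewrite -(latf_period lL) => -[n [a [u [auP ->]]]].
  rewrite (rmod_act_sum mX); elim/big_ind: _ => [|x y|i _].
  - have [n' [b [-> _]]] := lat r; exists (fun=> 0).
      by move=> i; apply/(nz_int nw); left.
    by rewrite big1 // => i _; exact: (rmod_act_0l mX).
  - exact: latticeD.
  rewrite -(rmod_actM mX); apply: lattice_act_vge => //; last exact: (auP i).2.
  rewrite -[0](subrr c) -{2}wp -(cdv_V cA p0); apply: (vgeM cA); last exact: vge_self.
  by apply/(nz_max nw); exact: (auP i).1.
have pern (m : nat) r v : L r v ->
    L (r + m%:R * c) (act (p ^+ m) v) /\ L (r - m%:R * c) (act (p ^- m) v).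
  move=> Lv; have Xv := lattice_sub (lat r) Lv.
  elim: m => [|m [IH1 IH2]].
    by rewrite expr0 mul0r addr0 subr0 invr1 (rmod_act1 mX).
  have -> : p ^- m.+1 = p ^- m / p by rewrite exprS invrM ?unitrX.
  rewrite exprSr !(rmod_actM mX) -[m.+1]addn1 natrD mulrDl mul1r; split.
    by rewrite addrA; exact: per1.
  by apply: per2; rewrite opprD addrA subrK.
have perz (m : int) r v : L r v -> L (r + m%:~R * c) (act (p ^ m) v).
  case: m => m Lv; first by rewrite -exprnP; exact: (pern m r v Lv).1.
  rewrite NegzE -exprnN mulrNz mulNr; exact: (pern m.+1 r v Lv).2.
have Lle s t v : s <= t -> L t v -> L s v.
  rewrite le_eqVlt => /predU1P[-> //|st]; exact: (latf_decr lL st).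
split=> //.
- by move=> t v; exact: lattice_sub.
- move=> t; have [n [b [-> _]]] := lat t; exists (fun=> 0).
    by move=> i; apply/(nz_int nw); left.
  by rewrite big1 // => i _; exact: (rmod_act_0l mX).
- by move=> t u v; exact: latticeD.
- move=> t a v a0 Lv; have [m wa] := nz_vals nw a0.
  have [pm0 pmE] := cdv_expz cA m p0.
  have [pm0' pmE'] := cdv_expz cA (- m) p0.
  rewrite wa; have -> : a = p ^ m * (p ^ (- m) * a).
    by rewrite mulrA -exprzDr // subrr mul1r.
  rewrite (rmod_actM mX); apply: lattice_act_vge => //.
    have pa0 := cdv_mulf_neq0 cA pm0' a0.
    by right; rewrite (cdv_mul cA) // pmE' wa wp mulrNz mulNr addNr.
  exact: perz.
- by move=> t v _ H; rewrite (latf_left_cont lL) => s /= st; exact: H.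
- move=> v Xv; have [n [b [L0E XE]]] := lat 0.
  move: Xv; rewrite XE => -[a _ <-].
  have [i|N NP] := @choice _ _ (fun i (N : nat) => vge w (- (N%:R * c)) (a i)).
    have [->|a0] := eqVneq (a i) 0; first by exists 0%N; left.
    have [m wa] := nz_vals nw a0; exists `|m|%N; right; rewrite wa -mulNr.
    rewrite ler_pM2r // -mulrz_nat -mulrNz ler_int natz abszE.
    by rewrite lerNl -normrN ler_norm.
  pose K := \max_i N i.
  exists (0 + (- K%:Z)%:~R * c).
  have [pK0 pKE] := cdv_expz cA K p0.
  have -> : \sum_i act (a i) (b i) = act (p ^ (- K%:Z)) (\sum_i act (a i * p ^ K) (b i)).
    rewrite (rmod_act_sum mX); apply: eq_bigr => i _.
    by rewrite -(rmod_actM mX) -mulrA -exprzDr // subrr mulr1.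
  apply: perz; rewrite L0E; exists (fun i => a i * p ^ K) => // i.
  apply/(nz_int nw).
  have : vge w (- (K%:R * c)) (a i).
    apply: (vge_le _ (NP i)).
    by rewrite lerN2 ler_pM2r // ler_nat; exact: leq_bigmax.
  move=> H; rewrite -[0](addNr (K%:R * c)); apply: (vgeM cA H).
  by right; rewrite pKE wp.
- move=> v Xv Lv; have [n [b [L0E XE]]] := lat 0.
  have v1 : v = act 1 v by rewrite (rmod_act1 mX).
  have Xb i : X (act 1 (b i)).
    rewrite XE; exists (fun j => if j == i then 1 else 0) => //.
    by rewrite (bigD1 i) //= eqxx big1 ?addr0 // => j /negPf ->; rewrite (rmod_act_0l mX).
  apply: (small_coefs_eq0 Xb) => t.
  have [m tm] : exists m : nat, t <= m%:R * c.
    exists (Num.truncn (t / c)).+1; rewrite -ler_pdivrMr //.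
    by rewrite ltW // truncnS_gt.
  have [pm0 pmE] := cdv_expz cA m p0.
  have := perz (- m%:Z) _ _ (Lv (m%:R * c)); rewrite mulrNz mulNr subrr L0E.
  move=> [a aP aE]; exists (fun i => a i * p ^ m) => [i|].
    apply: (vge_le tm); rewrite -[_ * c]add0r; apply: (vgeM cA).
      exact/(nz_int nw)/aP.
    by right; rewrite pmE wp.
  transitivity (act (p ^ (- m%:Z) * p ^ m) v).
    by rewrite -exprzDr // addNr (rmod_act1 mX).
  rewrite (rmod_actM mX) -aE (rmod_act_sum mX); apply: eq_bigr => i _.
  by rewrite -!(rmod_actM mX) mul1r.
Qed.

Lemma nlf_lattice L : fgen act X -> nlf w act X L -> lattice_function nu act X c L.
Proof.
move=> fX nL; have [n [v [vX vS vL]]] := orth_basis_exists cA mX nL fX.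
have [p p0 wp] := nz_unif nw; have up := cdv_unit cA p0.
have c0 := nz_gt0 nw.
have nv i := nlf_norm nL (vX i).1 (vX i).2.
split.
(* [m i] is the least exponent for which the multiple of [v i] by that power of [p] has norm at
   least [r]; these multiples generate [L r]. *)
- move=> r; pose m i := Num.ceil ((r - norm_lf L (v i)) / c).
  exists n, (fun i => act (p ^ m i) (v i)); split; apply/seteqP; split=> x.
  + move=> Lx; have [a xE] := vS x (nlf_sub nL Lx).
    have La : forall i, L r (act (a i) (v i)) by apply: vL; rewrite -xE.
    exists (fun i => p ^ (- m i) * a i).
      move=> i; apply/(nz_int nw).
      have [pm0 pmE] := cdv_expz cA (- m i) p0.
      have [->|a0] := eqVneq (a i) 0; first by left; rewrite mulr0.
      right; rewrite (cdv_mul cA) // pmE wp.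
      have [k wa] := nz_vals nw a0; rewrite wa -mulrDl pmulr_lge0 // -intrD ler0z.
      rewrite addrC subr_ge0 ceil_le_int ler_pdivrMr //.
      have av0 : act (a i) (v i) != 0.
        by apply: contra_neq (vX i).2; exact: (rmod_act_eq0 mX (cdv_unit cA a0) (vX i).1).
      have /(nlf_norm nL (rmod_act mX _ (vX i).1) av0) := La i.
      by rewrite (norm_lf_act mX cA nL (vX i).1 (vX i).2 a0) wa => ?; lra.
    rewrite xE; apply: eq_bigr => i _.
    by rewrite -(rmod_actM mX) mulrA -exprzDr // subrr mul1r.
  + move=> [a aP <-]; apply: (nlf_sum nL) => i.
    have [pm0 pmE] := cdv_expz cA (m i) p0.
    rewrite -[r]addr0; apply: (nlf_act_vge mX nL); first exact/(nz_int nw)/aP.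
    apply: (@nlf_le _ _ _ _ _ _ _ nL _ (norm_lf L (v i) + w (p ^ m i))).
      by rewrite pmE wp -lerBlDl -ler_pdivrMr // ceil_ge.
    by apply: (nlf_act nL pm0); apply/nv.
  + move=> /vS[a ->]; exists (fun i => p ^ (- m i) * a i) => //.
    apply: eq_bigr => i _.
    by rewrite -(rmod_actM mX) mulrA -exprzDr // subrr mul1r.
  + move=> [a _ <-]; apply: (rmod_sum mX) => i.
    by do 2!apply: (rmod_act mX); exact: (vX i).1.
- by move=> r s rs v'; apply: (nlf_le nL); exact: ltW.
- move=> r; apply/seteqP; split=> x.
    by move=> Lx s /= sr; apply: (nlf_le nL) Lx; exact: ltW.
  move=> H; apply: (nlf_left nL) => [|s sr]; last exact: H.
  by apply: (nlf_sub nL (t := r - 1)); apply: H => /=; rewrite ltrBlDr ltrDl.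
- move=> r; apply/seteqP; split=> x.
    move=> [m [a [u [auP ->]]]]; apply: (nlf_sum nL) => i.
    by apply: (nlf_act_vge mX nL); [exact/(nz_max nw)/(auP i).1 | exact: (auP i).2].
  move=> Lx; exists 1%N, (fun=> p), (fun=> act p^-1 x); split; last first.
    by rewrite big_ord1 (rmod_actVK mX up) //; exact: (nlf_sub nL Lx).
  move=> _; split; first by apply/(nz_max nw); right; rewrite wp.
  rewrite -[r](addrK c) -{2}wp -(cdv_V cA p0); apply: (nlf_act nL) => //.
  exact: cdv_invr_neq0.
Qed.

End LatticeFunctionsAsNorms.

(** * From extended-real valuations to real-valued ones *)

Section Valuations.
Variables (R : realType) (A : unitRingType) (nu : A -> \bar R).
Hypothesis vnu : valuation nu.
Let w x := fine (nu x).

Lemma vge_nu t x : vge w t x <-> (t%:E <= nu x)%E.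
Proof.
have [->|x0] := eqVneq x 0.
  by rewrite (val_zero vnu) leey; split=> // _; left.
have nx : nu x = (w x)%:E by rewrite fineK // (val_fin vnu).
rewrite nx lee_fin; split=> [/(vge_neq0 x0)//|]; by right.
Qed.

Lemma fine_valM x y : x != 0 -> y != 0 -> w (x * y) = w x + w y.
Proof.
by move=> x0 y0; rewrite /w (Defs.valM vnu) fineD ?(val_fin vnu).
Qed.

Lemma vge_valD t x y : vge w t x -> vge w t y -> vge w t (x + y).
Proof.
move=> /vge_nu tx /vge_nu ty; apply/vge_nu; apply: le_trans (Defs.valD vnu x y).
by rewrite le_min tx.
Qed.

Lemma normalized_val : cdv w -> normalized nu w (unif_value nu).
Proof.
move=> cA; have [q q0 [wq qP]] := cdv_pi cA.
have uE : unif_value nu = w q.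
  rewrite /unif_value; suff -> : ereal_inf (nu @` max_ideal nu) = (w q)%:E by [].
  have nx x : x != 0 -> nu x = (w x)%:E.
    by move=> x0; rewrite fineK // (val_fin vnu).
  apply/eqP; rewrite eq_le; apply/andP; split.
    apply: ge_ereal_inf; exists (nu q); last by rewrite nx.
    exists q => //.
    by rewrite /max_ideal /= nx // lte_fin.
  apply/ereal_infP => y [x]; rewrite /max_ideal /= => xpos <- {y}.
  have [->|x0] := eqVneq x 0; first by rewrite (val_zero vnu) leey.
  move: xpos; rewrite nx // lte_fin lee_fin => wx.
  have [n nE] := qP x x0; move: wx; rewrite nE pmulr_lgt0 // ltr0z => n0.
  by rewrite ler_peMl ?(ltW wq) // ler1z -gtz0_ge1.
rewrite uE; split=> //.
- by exists q.
- by move=> x; rewrite vge_nu.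
- move=> x; rewrite /max_ideal /=.
  have [->|x0] := eqVneq x 0.
    by rewrite (val_zero vnu); split=> // _; left.
  have nx : nu x = (w x)%:E by rewrite fineK // (val_fin vnu).
  rewrite nx lte_fin; split=> [wx|/(vge_neq0 x0)]; last exact: lt_le_trans.
  right; have [n nE] := qP x x0; move: wx; rewrite nE pmulr_lgt0 // ltr0z => n0.
  by rewrite ler_peMl ?(ltW wq) // ler1z -gtz0_ge1.
Qed.

End Valuations.

Lemma vge_scale (R : realType) (A : unitRingType) (w : A -> R) (r : R) t x :
  0 < r -> vge (fun x => w x * r) t x <-> vge w (t / r) x.
Proof. by move=> r0; rewrite /vge ler_pdivrMr. Qed.

Lemma cdv_scale (R : realType) (A : unitRingType) (w : A -> R) (r : R) :
  0 < r -> cdv w -> cdv (fun x => w x * r).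
Proof.
move=> r0 cA; split.
- exact: (cdv_unit cA).
- by move=> x y x0 y0; rewrite (cdv_mul cA) // mulrDl.
- by move=> t x y /(vge_scale _ _ _ r0) tx /(vge_scale _ _ _ r0) ty;
    apply/(vge_scale _ _ _ r0); exact: (cdv_add cA).
- have [p p0 [wp pP]] := cdv_pi cA; exists p => //; split; first exact: mulr_gt0.
  by move=> x x0; have [n ->] := pP x x0; exists n; rewrite mulrA.
- move=> u cu; have [M|l lP] := cdv_complete cA (u := u).
    have [N NP] := cu (M * r); exists N => p q Np Nq.
    by have /(vge_scale _ _ _ r0) := NP p q Np Nq; rewrite mulfK // gt_eqF.
  exists l => M; have [N NP] := lP (M / r); exists N => p Np.
  exact/(vge_scale _ _ _ r0)/NP.
Qed.

(** Lattice functions over $D$ have period $1/d$ by definition; with this rescaling the least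
    positive value becomes that period, whatever [unif_value] is. *)
Lemma normalized_scale (R : realType) (A : unitRingType) (nu : A -> \bar R)
    (w : A -> R) (c c' : R) : 0 < c' -> normalized nu w c ->
  normalized nu (fun x => w x * (c' / c)) c'.
Proof.
move=> c'0 nw; have c0 := nz_gt0 nw.
have r0 : 0 < c' / c by rewrite divr_gt0.
have cN0 : c != 0 by rewrite gt_eqF.
split=> //.
- by apply: cdv_scale => //; exact: (nz_cdv nw).
- by have [p p0 pE] := nz_unif nw; exists p => //; rewrite pE mulrC divfK.
- move=> x x0; have [m ->] := nz_vals nw x0; exists m.
  by rewrite -mulrA [c * _]mulrC divfK.
- by move=> x; rewrite (nz_int nw) vge_scale // mul0r.
- by move=> x; rewrite (nz_max nw) vge_scale // invf_div mulrC divfK // gt_eqF.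
Qed.

Lemma cdv_extends (R : realType) (A B : unitRingType) (nu : A -> \bar R)
    (nuB : B -> \bar R) (emb : A -> B) :
  valuation nu -> cdv (fun x => fine (nu x)) -> valuation nuB -> (forall a, nuB (emb a) = nu a) ->
  (forall a b, emb (a + b) = emb a + emb b) ->
  (forall a b, emb (a * b) = emb a * emb b) -> emb 1 = 1 ->
  fgen (fun a x => x * emb a) [set: B] ->
  (forall x : B, x != 0 -> x \is a GRing.unit) ->
  cdv (fun x => fine (nuB x)).
Proof.
move=> vnu cA vB embE embD embM emb1 fgB uB.
apply: (cdv_ext cA embD embM emb1 fgB uB).
- exact: fine_valM.
- exact: vge_valD.
- by move=> a _; rewrite embE.
Qed.

Lemma fgen_falg (F : fieldType) (B : falgType F) :
  fgen (fun (a : F) (x : B) => x * a%:A) [set: B].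
Proof.
exists (\dim {:B}), (fun i => (vbasis {:B})`_i); apply/esym/seteqP; split=> // x _.
exists (fun i => coord (vbasis {:B}) i x) => //.
rewrite [RHS](coord_vbasis (memvf x)); apply: eq_bigr => i _.
by rewrite -scalerAr mulr1.
Qed.

(** * Roots of principal units, and invariance of the valuation under involutions *)

Section Contraction.
Variables (R : realType) (A : unitRingType) (w : A -> R) (cA : cdv w).

(** Banach's principle, with [d] as the gain in value per step. The last hypothesis keeps limits
    inside [S]; in applications [S] may be cut out by an identity, such as symmetry under the
    involution. *)
Lemma contraction_fixpoint (F : A -> A) (S : set A) (d s : R) a0 : 0 < d ->
  S a0 -> (forall a, S a -> S (F a)) -> (forall a, S a -> vge w s a) ->
  (forall a b t, S a -> S b -> vge w t (a - b) -> vge w (t + d) (F a - F b)) ->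
  (forall l, (forall M, exists2 a, S a & vge w M (l - a)) -> S l) ->
  exists2 l, S l & F l = l.
Proof.
move=> d0 S0 SF Ss Fc Scl.
pose u n := iter n F a0.
have Su n : S (u n) by elim: n => //= n; exact: SF.
have uc n m : vge w (s + n%:R * d) (u (n + m)%N - u n).
  elim: n => [|n IH]; first by rewrite mul0r addr0; apply: (vgeB cA); exact: Ss.
  by rewrite -[n.+1]addn1 natrD mulrDl mul1r addrA addn1 addSn; exact: Fc.
have ge M : exists N : nat, M <= s + N%:R * d.
  exists (Num.truncn ((M - s) / d)).+1; rewrite -lerBlDl -ler_pdivrMr //.
  by rewrite ltW // truncnS_gt.
have [M|l lP] := cdv_complete cA (u := u).
  have [N NP] := ge M; exists N => p q /subnKC <- /subnKC <-.
  have -> : u (N + (p - N))%N - u (N + (q - N))%N =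
      (u (N + (p - N))%N - u N) - (u (N + (q - N))%N - u N).
    by rewrite opprB addrA subrK.
  by apply: (vgeB cA); apply: vge_le NP _; exact: uc.
have Sl : S l.
  apply: Scl => M; have [N NP] := lP M; exists (u N) => //.
  by rewrite -opprB; apply: (vgeN cA); exact: NP.
exists l => //; apply/eqP; rewrite -subr_eq0; apply/eqP; apply: (vge_all0 (w := w)) => M.
have [N NP] := lP M.
have -> : F l - l = (u N.+1 - l) - (F (u N) - F l).
  by rewrite opprB [RHS]addrC -[u N.+1]/(F (u N)) subrKA.
apply: (vgeB cA); first by apply: NP.
apply: (@vge_le _ _ w (M + d)); first by rewrite lerDl ltW.
by apply: Fc => //; exact: NP.
Qed.

Hypotheses (two_neq0 : (2%:R : A) != 0) (w2 : w 2%:R = 0).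

(** The equation is rewritten as $y = (x - y^2)/2$, a contraction since 2 is a unit; the
    noncommutative substitute for the difference of squares is $a^2 - b^2 = (a-b)a + b(a-b)$. *)
Lemma cdv_sqrt x : (exists2 s, 0 < s & vge w s x) ->
  exists y, (exists2 s, 0 < s & vge w s y) /\ (1 + y) ^+ 2 = 1 + x.
Proof.
move=> [s s0 sx].
have u2 : (2%:R : A) \is a GRing.unit := cdv_unit cA two_neq0.
have half t z : vge w t z -> vge w t (z / 2%:R).
  move=> tz; rewrite -[t]addr0; apply: (vgeM cA) => //.
  by right; rewrite (cdv_V cA) // w2 oppr0.
have [| | | | |y sy yE] := @contraction_fixpoint (fun y => (x - y * y) / 2%:R)
    [set y | vge w s y] s s 0 s0.
- by left.
- move=> y sy; apply: half; apply: (vgeB cA) => //.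
  by apply: (@vge_le _ _ w (s + s)); [rewrite lerDl ltW | exact: (vgeM cA)].
- by [].
- move=> a b t sa sb ab; rewrite -mulrBl; apply: half.
  have -> : x - a * a - (x - b * b) = - ((a - b) * a + b * (a - b)).
    by rewrite opprB [LHS]addrC subrKA mulrBl mulrBr subrKA opprB.
  apply: (vgeN cA); apply: (cdv_add cA); first exact: (vgeM cA).
  by rewrite addrC; apply: (vgeM cA).
- move=> l H; have [a sa la] := H s.
  by rewrite /= -[l](subrK a); apply: (cdv_add cA).
exists y; split; first by exists s.
have E : y * 2%:R = x - y * y by rewrite -{1}yE divrK.
rewrite expr2 mulrDr mulr1 mulrDl mul1r -!addrA; congr (1 + _).
by rewrite addrA -mulr2n -mulr_natr E subrK.
Qed.

Lemma cdv_root x n : (exists2 s, 0 < s & vge w s x) ->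
  exists y, (1 + y) ^+ (2 ^ n) = 1 + x.
Proof.
elim: n x => [|n IH] x sx; first by exists x.
have [y [sy yE]] := cdv_sqrt sx; have [z zE] := IH y sy.
by exists z; rewrite expnSr exprM zE.
Qed.

(** A principal unit is a $2^n$-th power for every $n$, so the value of its image is divisible by
    all powers of 2 and vanishes. It follows that positive values become nonnegative ([unit1]), even
    positive ([pos1]), and that units go to units ([unit0]). So [rho] multiplies values by a
    positive integer $n$, and $n^2 = 1$ because [rho] is an involution. *)
Lemma involution_val (rho : A -> A) : ring_involution rho ->
  forall x, x != 0 -> w (rho x) = w x.
Proof.
move=> irho; have rD := invol_add irho; have rM := invol_mul irho.
have r1 := invol_one irho; have rK := invol_invol irho.
have r0 : rho 0 = 0 by apply: (addrI (rho 0)); rewrite -rD !addr0.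
have rN0 x : x != 0 -> rho x != 0.
  by apply: contra_neq => rx; rewrite -(rK x) rx r0.
have rX x n : rho (x ^+ n) = rho x ^+ n.
  by elim: n => [|n IH]; rewrite ?expr0 // exprS rM IH -exprSr.
have [p p0 [wp pP]] := cdv_pi cA.
have unit1 x : x != 0 -> 0 < w x -> 0 <= w (rho x).
  move=> x0 wx; have [x10 _] := cdv_1D cA x0 wx.
  have [m mE] := pP _ (rN0 _ x10).
  have m0 : m = 0.
    (* One root suffices, chosen in terms of [m] itself: $2^{|m|}$ exceeds $|m|$, so it divides $m$
       only if $m = 0$. *)
    have [|y yE] := @cdv_root x `|m|%N; first by exists (w x) => //; right.
    have y10 : 1 + y != 0.
      apply: contra_eq_neq yE => ->; rewrite eq_sym expr0n; move: x10.
      by rewrite expn_eq0 /=.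
    have [k kE] := pP _ (rN0 _ y10).
    have [_ wX] := cdv_X cA (2 ^ `|m|)%N (rN0 _ y10).
    move: wX; rewrite -rX yE mE kE mulrA => /(mulIf (lt0r_neq0 wp)) /eqP.
    rewrite -mulrz_nat natz -intrM eqr_int => /eqP mk.
    apply/eqP; rewrite -absz_eq0; apply: contraT => mN0.
    have k0 : (0 < `|k|)%N.
      by rewrite absz_gt0; apply: contraNneq mN0 => k0; rewrite mk k0 mulr0.
    have mE' : (`|m| = 2 ^ `|m| * `|k|)%N by rewrite {1}mk abszM.
    have := leq_trans (ltn_expl `|m| (ltnSn 1)) (leq_pmulr _ k0).
    by rewrite -mE' ltnn.
  have : vge w 0 (rho (1 + x) - 1).
    by apply: (vgeB cA); right; rewrite ?(cdv_1 cA) // mE m0 mul0r.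
  by rewrite rD r1 addrC addKr => /(vge_neq0 (rN0 _ x0)).
have pos1 x : x != 0 -> 0 < w x -> 0 < w (rho x).
  move=> x0 wx; rewrite lt_neqAle unit1 // andbT; apply/eqP => E.
  (* If [rho x] had value 0, multiplying [y] by a high power of [x] would make its value positive
     without changing the value of its image. Then all images would have nonnegative value, which
     fails for [rho x^-1], whose image is [x^-1]. *)
  have H y : y != 0 -> 0 <= w (rho y).
    move=> y0.
    have [n nP] : exists n : nat, 0 < n%:R * w x + w y.
      exists (Num.truncn (- w y / w x)).+1.
      by rewrite -ltrBlDr sub0r -ltr_pdivrMr // truncnS_gt.
    have [xn0 xnE] := cdv_X cA n x0.
    have := unit1 _ (cdv_mulf_neq0 cA xn0 y0).
    rewrite (cdv_mul cA) // xnE => /(_ nP).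
    have [rxn0 rxnE] := cdv_X cA n (rN0 _ x0).
    by rewrite rM (cdv_mul cA) ?rN0 // rX rxnE -E mulr0 addr0.
  have := H (rho x^-1); rewrite rK (cdv_V cA) // oppr_ge0 leNgt wx.
  by move=> H'; have := H' (rN0 _ (cdv_invr_neq0 x0)).
have unit0 x : x != 0 -> w x = 0 -> w (rho x) = 0.
  have le y : y != 0 -> w y = 0 -> w (rho y) <= 0.
    move=> y0 wy; rewrite leNgt; apply/negP => /(pos1 _ (rN0 _ y0)).
    by rewrite rK wy ltxx.
  move=> x0 wx; apply/eqP; rewrite eq_le le //= -oppr_le0.
  have rV : rho x^-1 = (rho x)^-1.
    have ux := cdv_unit cA x0; have urx := cdv_unit cA (rN0 _ x0).
    by apply: (mulrI urx); rewrite -rM mulVr // r1 divrr.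
  by rewrite -(cdv_V cA) ?rN0 // -rV le ?cdv_invr_neq0 // (cdv_V cA) // wx oppr0.
have rz x (n : int) : x != 0 -> w x = n%:~R * w p -> w (rho x) = n%:~R * w (rho p).
  move=> x0 xE.
  have [pn0 pnE] := cdv_expz cA n p0; have [pn0' pnE'] := cdv_expz cA (- n) p0.
  have rpz (m : int) : w (rho (p ^ m)) = m%:~R * w (rho p).
    have nat1 (k : nat) : w (rho (p ^+ k)) = k%:R * w (rho p).
      by rewrite rX; exact: (cdv_X cA k (rN0 _ p0)).2.
    case: m => m; first by rewrite -exprnP; exact: nat1.
    rewrite NegzE -exprnN mulrNz mulNr.
    have pm0 := (cdv_X cA m.+1 p0).1; have um := cdv_unit cA pm0.
    have : w (rho (p ^+ m.+1 * p ^- m.+1)) = 0 by rewrite divrr // r1 (cdv_1 cA).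
    rewrite rM (cdv_mul cA) ?rN0 ?cdv_invr_neq0 // nat1 => H; lra.
  have : w (rho (x * p ^ (- n))) = 0.
    apply: unit0; first exact: (cdv_mulf_neq0 cA).
    by rewrite (cdv_mul cA) // xE pnE' mulrNz mulNr subrr.
  by rewrite rM (cdv_mul cA) ?rN0 // rpz mulrNz => H; lra.
have [n nE] := pP _ (rN0 _ p0).
have n0 : 0 < n.
  by have := pos1 p p0 wp; rewrite nE pmulr_lgt0 // ltr0z.
have := rz _ n (rN0 _ p0) nE; rewrite rK nE mulrA -{1}[w p]mul1r.
move=> /(mulIf (lt0r_neq0 wp)) /eqP; rewrite -intrM -[1]/(1%:~R) eqr_int => /eqP nn.
have n1 : n = 1.
  apply/eqP; rewrite eq_le -gtz0_ge1 n0 andbT nn.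
  by rewrite ler_peMr ?(ltW n0) // -gtz0_ge1.
by move=> x x0; have [m mE] := pP x x0; rewrite (rz x m x0 mE) nE n1 mul1r.
Qed.

End Contraction.

(** * Vector spaces and hermitian forms *)

Section VectorSpaces.
Import VectorInternalTheory.
Variables (A : unitRingType) (V : vectType A^c).

Lemma rscaleDr (a : A) (u v : V) : rscale a (u + v) = rscale a u + rscale a v.
Proof. exact: scalerDr. Qed.

Lemma rscaleDl (a b : A) (v : V) : rscale (a + b) v = rscale a v + rscale b v.
Proof. exact: scalerDl. Qed.

Lemma rscaleM (a b : A) (v : V) : rscale (a * b) v = rscale b (rscale a v).
Proof. by rewrite /rscale scalerA. Qed.

Lemma rscale1 (v : V) : rscale (1 : A) v = v.
Proof. exact: scale1r. Qed.

Lemma rscale0 (v : V) : rscale (0 : A) v = 0.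
Proof. exact: scale0r. Qed.

Lemma rscaler0 (a : A) : rscale a (0 : V) = 0.
Proof. exact: scaler0. Qed.

Lemma rscaleN (a : A) (v : V) : rscale (- a) v = - rscale a v.
Proof. exact: scaleNr. Qed.

Lemma rscalerN (a : A) (v : V) : rscale a (- v) = - rscale a v.
Proof. exact: scalerN. Qed.

Lemma rscale_sumr (J : finType) (a : A) (F : J -> V) :
  rscale a (\sum_j F j) = \sum_j rscale a (F j).
Proof. exact: scaler_sumr. Qed.

Lemma rscale_suml (J : finType) (F : J -> A) (v : V) :
  rscale (\sum_j F j) v = \sum_j rscale (F j) v.
Proof. exact: scaler_suml. Qed.

Lemma lfun_rscale (W : vectType A^c) (f : 'Hom(V, W)) (a : A) v :
  f (rscale a v) = rscale a (f v).
Proof. exact: linearZ. Qed.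

Lemma linear_lfun (W : vectType A^c) (f : V -> W) :
  (forall u v, f (u + v) = f u + f v) ->
  (forall a v, f (rscale a v) = rscale a (f v)) ->
  exists F : 'Hom(V, W), forall v, F v = f v.
Proof.
move=> fD fZ.
have fL : linear f by move=> a u v; rewrite fD; congr (_ + _); exact: fZ.
pose F : {linear V -> W} := HB.pack f (GRing.isLinear.Build _ _ _ _ f fL).
by exists (linfun F) => v; rewrite lfunE.
Qed.

Lemma rmod_rscale (X : set V) : X 0 -> (forall u v, X u -> X v -> X (u + v)) ->
  (forall a v, X v -> X (rscale a v)) -> rmod (@rscale A V) X.
Proof.
move=> X0 XD XZ; split=> //.
- exact: rscaleDr.
- exact: rscaleDl.
- exact: rscaleM.
- by move=> v _; exact: rscale1.
Qed.

Lemma rmod_setT : rmod (@rscale A V) [set: V].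
Proof. exact: rmod_rscale. Qed.

Lemma fgen_vect : fgen (@rscale A V) [set: V].
Proof.
exists (dim V), (fun i => r2v (delta_mx 0 i)).
apply/esym/seteqP; split=> // x _.
exists (fun i => v2r x 0 i) => //.
rewrite -[RHS]v2rK [X in _ = r2v X]row_sum_delta linear_sum.
by apply: eq_bigr => i _; rewrite linearZ.
Qed.

Definition im (e : 'End(V)) : set V := [set v | e v = v].

Lemma rmod_im e : rmod (@rscale A V) (im e).
Proof.
apply: rmod_rscale => [|u v|a v]; rewrite /im /=.
- by rewrite linear0.
- by move=> eu ev; rewrite linearD /= eu ev.
- by rewrite lfun_rscale => ->.
Qed.

Lemma fgen_im (e : 'End(V)) : (forall v, e (e v) = e v) -> fgen (@rscale A V) (im e).
Proof.
move=> ee; have [n [b bE]] := fgen_vect; exists n, (fun i => e (b i)).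
have eS (a : 'I_n -> A) : \sum_i rscale (a i) (e (b i)) = e (\sum_i rscale (a i) (b i)).
  by rewrite linear_sum; apply: eq_bigr => i _; rewrite -lfun_rscale.
apply/seteqP; split=> v.
  move=> ev; have : [set: V] v by [].
  by rewrite bE => -[a _ aE]; exists a; rewrite // eS aE.
by move=> [a _ <-]; rewrite eS /im /= ee.
Qed.

Variables (R : realType) (w : A -> R).

(** The minimum of the values of the coordinates is a norm. It provides bases of submodules, as
    orthogonal bases, where no lattice function is at hand. *)
Lemma nlf_vect : cdv w -> exists L, nlf w (@rscale A V) [set: V] L.
Proof.
move=> cA; pose co (v : V) i : A := v2r v 0 i.
have co0 v : (forall i, co v i = 0) -> v = 0.
  move=> H; rewrite -[v]v2rK.
  suff -> : v2r v = 0 by rewrite linear0.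
  by apply/rowP => i; rewrite mxE; exact: H.
exists (fun t => [set v | forall i, vge w t (co v i)]); split=> //.
- by move=> t i; rewrite /co linear0 mxE; left.
- move=> t u v Lu Lv i; rewrite /co linearD mxE; apply: (cdv_add cA); [exact: Lu | exact: Lv].
- move=> t a v a0 Lv i; rewrite /co linearZ mxE.
  apply: (@vgeM _ _ _ cA _ _ (co v i) a) => //; exact: vge_self.
- by move=> s t v st Lv i; exact: vge_le (Lv i).
- move=> t v _ H i; have [->|v0] := eqVneq (co v i) 0; first by left.
  right; rewrite leNgt; apply/negP => lt.
  have lt' : (w (co v i) + t) / 2 < t by lra.
  have := vge_neq0 v0 (H _ lt' i); lra.
- move=> v _.
  exists (\big[Order.min/0]_i w (co v i)) => i; right.
  by rewrite (bigD1 i) //= ge_min lexx.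
- by move=> v _ H; apply: co0 => i; apply: (vge_all0 (w := w)) => t; exact: H.
Qed.

End VectorSpaces.

(** * Hermitian forms and duals of norms *)

Section HermitianForms.
Variables (R : realType) (A : unitRingType) (V : vectType A^c).
Variables (h : V -> V -> A) (rho : A -> A) (eps : A).
Hypotheses (hh : hermitian_form h rho eps) (irho : ring_involution rho).

Lemma eps_sign : eps = 1 \/ eps = -1. Proof. exact: (herm_sign hh). Qed.

Lemma hermDl u v x : h (u + v) x = h u x + h v x. Proof. exact: (herm_addl hh). Qed.
Lemma hermDr u v x : h x (u + v) = h x u + h x v. Proof. exact: (herm_addr hh). Qed.
Lemma herm0l x : h 0 x = 0.
Proof. by apply: (addrI (h 0 x)); rewrite -hermDl !addr0. Qed.
Lemma herm0r x : h x 0 = 0.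
Proof. by apply: (addrI (h x 0)); rewrite -hermDr !addr0. Qed.
Lemma hermNl u x : h (- u) x = - h u x.
Proof. by apply/eqP; rewrite -addr_eq0 -hermDl addNr herm0l. Qed.
Lemma hermNr u x : h x (- u) = - h x u.
Proof. by apply/eqP; rewrite -addr_eq0 -hermDr addNr herm0r. Qed.
Lemma herm_suml (J : finType) (F : J -> V) x : h (\sum_j F j) x = \sum_j h (F j) x.
Proof. by apply: (big_morph (h ^~ x)) => [u v|]; [exact: hermDl | exact: herm0l]. Qed.
Lemma herm_sumr (J : finType) (F : J -> V) x : h x (\sum_j F j) = \sum_j h x (F j).
Proof. by apply: (big_morph (h x)) => [u v|]; [exact: hermDr | exact: herm0r]. Qed.

Lemma hermC u v : h u v = eps * rho (h v u).
Proof.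
have := herm_sesqui hh u v 1 1.
by rewrite !rscale1 (invol_one irho) !mulr1.
Qed.

Lemma hermZr u v a : h u (rscale a v) = h u v * a.
Proof.
have := herm_sesqui hh u v 1 a.
by rewrite rscale1 (invol_one irho) mulr1 -hermC.
Qed.

Lemma eps_comm (x : A) : eps * x = x * eps.
Proof. by case: eps_sign => ->; rewrite ?mul1r ?mulr1 // mulN1r mulrN1. Qed.

Lemma hermZl u v a : h (rscale a u) v = rho a * h u v.
Proof.
have := herm_sesqui hh u v a 1.
by rewrite rscale1 mulr1 => ->; rewrite eps_comm -mulrA -hermC.
Qed.

Lemma rho0 : rho 0 = 0.
Proof. by apply: (addrI (rho 0)); rewrite -(invol_add irho) !addr0. Qed.

Lemma rho_neq0 x : x != 0 -> rho x != 0.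
Proof. by apply: contra_neq => rx; rewrite -(invol_invol irho x) rx rho0. Qed.

Lemma rhoN x : rho (- x) = - rho x.
Proof. by apply/eqP; rewrite -addr_eq0 -(invol_add irho) addNr rho0. Qed.

Lemma herm_eq0C u v : h u v = 0 -> h v u = 0.
Proof. by move=> E; rewrite hermC E rho0 mulr0. Qed.

Lemma herm_nondegr v : (forall u, h u v = 0) -> v = 0.
Proof. by move=> H; apply: (herm_nondeg hh) => u; apply: herm_eq0C. Qed.

Variables (w : A -> R) (cA : cdv w).
Hypothesis wrho : forall x, x != 0 -> w (rho x) = w x.

Lemma vge_herm t u v : vge w t (h u v) -> vge w t (h v u).
Proof.
have we x : w (eps * x) = w x.
  by case: eps_sign => ->; rewrite ?mul1r // mulN1r (cdv_N cA).
have [E _|E] := eqVneq (h v u) 0; first by left.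
case => [E'|]; first by rewrite (herm_eq0C E') eqxx in E.
by right; rewrite (hermC v u) we wrho //; apply: contra_neq E; exact: herm_eq0C.
Qed.

Variables (nu : A -> \bar R) (c : R).
Hypothesis nw : normalized nu w c.

(** The definition only asks for membership in the maximal ideal on the open range $s > -t$. If
    $h(v,u)$ had value below $t + s$, scaling [u] by a power of the uniformizer would bring this
    value to 0 within that range. Conversely, a positive value is at least [c] by discreteness. *)
Lemma dual_lfP X L Y t v : nlf w (@rscale A V) X L ->
  dual_lf nu h Y L t v <-> Y v /\ forall s u, L s u -> vge w (t + s) (h v u).
Proof.
move=> nL; have c0 := nz_gt0 nw; split=> -[Yv H]; split=> //; last first.
  move=> s u ts Lu; apply/(nz_max nw).
  case: (H s u Lu) => [|ge]; first by left.
  have [->|hN0] := eqVneq (h v u) 0; first by left.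
  right; have [m mE] := nz_vals nw hN0.
  have : 0 < w (h v u) by apply: lt_le_trans ge; lra.
  rewrite mE pmulr_lgt0 // ltr0z => m0.
  by rewrite ler_peMl ?(ltW c0) // ler1z -gtz0_ge1.
move=> s u Lu; have [->|hN0] := eqVneq (h v u) 0; first by left.
right; rewrite leNgt; apply/negP => lt.
have [m mE] := nz_vals nw hN0; have [p p0 wp] := nz_unif nw.
have [pm0 pmE] := cdv_expz cA (- m) p0.
have := H (s - w (h v u)) (rscale (p ^ (- m)) u).
have Lp : L (s - w (h v u)) (rscale (p ^ (- m)) u).
  by rewrite mE -mulNr -mulrNz -wp -pmE; apply: (nlf_act nL).
have lt' : - t < s - w (h v u) by lra.
rewrite hermZr => /(_ lt' Lp) /(nz_max nw).
move=> /(vge_neq0 (cdv_mulf_neq0 cA hN0 pm0)).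
rewrite (cdv_mul cA) // pmE wp mE mulrNz mulNr; lra.
Qed.

Lemma vge_left s x : (forall t, t < s -> vge w t x) -> vge w s x.
Proof.
move=> H; have [->|x0] := eqVneq x 0; first by left.
right; rewrite leNgt; apply/negP => lt.
have lt' : (w x + s) / 2 < s by lra.
have := vge_neq0 x0 (H _ lt'); lra.
Qed.

Section Dual.
Variables (X Y : set V) (L : R -> set V).
Hypotheses (mX : rmod (@rscale A V) X) (mY : rmod (@rscale A V) Y).
Hypotheses (fX : fgen (@rscale A V) X) (nL : nlf w (@rscale A V) X L).

Lemma dual_bound n (b : 'I_n -> V) t v :
  orth_basis (@rscale A V) X L b -> Y v ->
  (forall i, vge w (t + norm_lf L (b i)) (h v (b i))) -> dual_lf nu h Y L t v.
Proof.
move=> [bX bS bL] Yv H; apply/(dual_lfP _ _ _ nL); split=> // s u Lu.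
have [a uE] := bS u (nlf_sub nL Lu).
rewrite uE herm_sumr; apply: (vge_sum cA) => i; rewrite hermZr.
have [->|ai] := eqVneq (a i) 0; first by left; rewrite mulr0.
have -> : t + s = (t + norm_lf L (b i)) + (s - norm_lf L (b i)) by lra.
apply: (vgeM cA) => //; right; rewrite lerBlDl -(norm_lf_act mX cA nL (bX i).1 (bX i).2 ai).
apply/(nlf_norm nL); first exact: (rmod_act mX _ (bX i).1).
  apply: contra_neq (bX i).2; exact: (rmod_act_eq0 mX (cdv_unit cA ai) (bX i).1).
by apply: bL; rewrite -uE.
Qed.

(** [X] and [Y] may differ because a component $V_i$ with $i$ in $I_+$ is dual to $V_{-i}$. That
    each vector lies in some ball is a minimum over a finite orthogonal basis. *)
Lemma nlf_dual : (forall v, Y v -> (forall u, X u -> h v u = 0) -> v = 0) ->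
  nlf w (@rscale A V) Y (dual_lf nu h Y L).
Proof.
move=> nd; have P t v := dual_lfP Y t v nL.
split.
- by move=> t v [].
- move=> t; apply/P; split; first exact: (rmod0 mY).
  by move=> s u _; rewrite herm0l; left.
- move=> t u v /P[Yu Hu] /P[Yv Hv]; apply/P; split; first exact: (rmodD mY).
  by move=> s x Lx; rewrite hermDl; apply: (cdv_add cA); [exact: Hu | exact: Hv].
- move=> t a v a0 /P[Yv Hv]; apply/P; split; first exact: (rmod_act mY).
  move=> s x Lx; rewrite hermZl -addrA addrCA; apply: (vgeM cA); last exact: Hv.
  by right; rewrite wrho.
- move=> s t v st /P[Yv Hv]; apply/P; split=> // r x Lx.
  by apply: vge_le (Hv r x Lx); rewrite lerD2r.
- move=> t v Yv H; apply/P; split=> // r x Lx; apply: vge_left => s st.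
  have /H/P[_ /(_ r x Lx)] : s - r < t by lra.
  by rewrite subrK.
- move=> v Yv; have [n [b ob]] := orth_basis_exists cA mX nL fX.
  exists (\big[Order.min/0]_i (w (h v (b i)) - norm_lf L (b i))).
  apply: dual_bound ob Yv _ => i; right.
  by rewrite -lerBrDr (bigD1 i) //= ge_min lexx.
- move=> v Yv H; apply: nd => // u Xu; apply: (vge_all0 (w := w)) => t.
  have [s Lu] := nlf_ex nL Xu; have /P[_ /(_ s u Lu)] := H (t - s).
  by rewrite subrK.
Qed.

End Dual.

(** Self-duality makes the lower bound for the value of a pairing sharp. Let [t] be the least value
    of [w (h x (b i)) - norm_lf L (b i)] over the basis vectors not orthogonal to [x]. Then [x] lies
    in the dual ball at [t], so [t] is at most its norm, and the minimizing basis vector, scaled to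
    pair to 1 with [x], is deep enough. *)
Lemma selfdual_pairing L x : nlf w (@rscale A V) [set: V] L ->
  dual_lf nu h [set: V] L = L -> x != 0 ->
  exists y, h x y = 1 /\ L (- norm_lf L x) y.
Proof.
move=> nL Ld x0.
have [n [b ob]] := orth_basis_exists cA (rmod_setT V) nL (fgen_vect V).
have [bX bS bL] := ob.
have [i0 hi0] : exists i, h x (b i) != 0.
  apply: contrapT => H; move/eqP: x0; apply; apply: (herm_nondeg hh) => u.
  have [a ->] := bS u I; rewrite herm_sumr big1 // => i _; rewrite hermZr.
  have [->|hi] := eqVneq (h x (b i)) 0; first by rewrite mul0r.
  by case: H; exists i.
case: (@arg_minP _ _ _ i0 (fun i => h x (b i) != 0)
  (fun i => w (h x (b i)) - norm_lf L (b i)) hi0) => j hj jmin.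
set t := w (h x (b j)) - norm_lf L (b j) in jmin.
have Lx : L t x.
  rewrite -Ld; apply: (dual_bound (rmod_setT V) nL ob) => // i.
  have [->|hi] := eqVneq (h x (b i)) 0; first by left.
  by right; have := jmin i hi; lra.
exists (rscale (h x (b j))^-1 (b j)); rewrite hermZr divrr ?(cdv_unit cA) //.
split=> //; have le := (nlf_norm nL (I : [set: V] x) x0 t).1 Lx.
apply: (nlf_le nL (t := - t)); first by rewrite lerN2.
rewrite /t opprB -(cdv_V cA hj); apply: (nlf_act nL); first exact: cdv_invr_neq0.
exact/(nlf_norm nL (bX j).1 (bX j).2).
Qed.

Lemma selfdual_vge L t s u v : nlf w (@rscale A V) [set: V] L ->
  dual_lf nu h [set: V] L = L -> L t u -> L s v -> vge w (t + s) (h u v).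
Proof. by move=> nL Ld; rewrite -{1}Ld => /(dual_lfP _ _ _ nL)[_ H]; exact: H. Qed.

End HermitianForms.

(** * A Cauchy-Schwarz inequality for anisotropic forms *)

Section Anisotropic.
Variables (R : realType) (A : unitRingType) (w : A -> R) (cA : cdv w).
Variables (V : vectType A^c) (h : V -> V -> A) (rho : A -> A) (eps : A).
Hypotheses (hh : hermitian_form h rho eps) (irho : ring_involution rho).
Hypotheses (two_neq0 : (2%:R : A) != 0) (w2 : w 2%:R = 0).
Let wrho := involution_val cA two_neq0 w2 irho.

Lemma rho_half : rho 2%:R^-1 = 2%:R^-1.
Proof.
have u2 := cdv_unit cA two_neq0.
have r2 : rho 2%:R = 2%:R.
  by rewrite -[2%:R]/(1 + 1) (invol_add irho) !(invol_one irho).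
by apply: (mulIr u2); rewrite -{2}r2 -(invol_mul irho) divrr // mulVr // (invol_one irho).
Qed.

Lemma half_comm (x : A) : 2%:R^-1 * x = x / 2%:R.
Proof.
have u2 := cdv_unit cA two_neq0.
by apply: (mulrI u2); rewrite !mulrA divrr // mul1r mulr_natl -mulr_natr mulrK.
Qed.

Lemma half_double (x : A) : x / 2%:R + x / 2%:R = x.
Proof. by rewrite -mulr2n -mulrnAl -mulr_natr mulrK // (cdv_unit cA). Qed.

Lemma vge_half t x : vge w t x -> vge w t (x / 2%:R).
Proof.
move=> tx; rewrite -[t]addr0; apply: (vgeM cA) => //.
by right; rewrite (cdv_V cA) // w2 oppr0.
Qed.

Lemma vge_rho t x : vge w t x -> vge w t (rho x).
Proof.
have [->|x0] := eqVneq x 0; first by rewrite (rho0 irho); left.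
by move=> /(vge_neq0 x0) tx; right; rewrite wrho.
Qed.

Lemma vge_eps t x : vge w t x -> vge w t (eps * x).
Proof. by case: (eps_sign hh) => ->; rewrite ?mul1r // mulN1r; exact: vgeN. Qed.

(* [z = - (a + eps z c z) / 2] is a contraction on the eps-symmetric elements
   of value at least [w a]. *)
Lemma herm_quadratic_solution a c : a != 0 -> c != 0 -> rho a = eps * a ->
  rho c = eps * c -> 0 < w a + w c ->
  exists z, [/\ rho z = eps * z, vge w (w a) z & a + z + z + eps * (z * c * z) = 0].
Proof.
move=> a0 c0 ra rc ac.
pose F z := - (a + eps * (z * c * z)) / 2%:R.
have [|z [za zr]|z [za _]|x y t [xa _] [ya _] xy|l H|z [za zr] Fz] :=
  @contraction_fixpoint _ _ w cA F [set z | vge w (w a) z /\ rho z = eps * z]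
    (w a + w c) (w a) 0 ac.
- by split; [left | rewrite (rho0 irho) mulr0].
- split.
    apply: vge_half; apply: (vgeN cA); apply: (cdv_add cA); first exact: vge_self.
    apply: vge_eps; apply: (@vge_le _ _ w (w a + w c + w a)); first lra.
    by do 2?apply: (vgeM cA) => //; exact: vge_self.
  have re x : rho (eps * x) = eps * rho x.
    by case: (eps_sign hh) => ->; rewrite ?mul1r // !mulN1r (rhoN irho).
  have rzcz : rho (z * c * z) = eps * (z * c * z).
    rewrite !(invol_mul irho) rc zr. 

    by case: (eps_sign hh) => ->; rewrite !(mul1r, mulN1r) mulrA ?(mulrN, mulNr, opprK) // ?(mulrN, mulNr, opprK).
  rewrite /F (invol_mul irho) rho_half half_comm (rhoN irho) (invol_add irho).
  by rewrite re rzcz ra -mulrDr -mulrN; exact/esym/mulrA.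
- by [].
- rewrite /F -mulrBl; apply: vge_half.
  have -> : - (a + eps * (x * c * x)) - - (a + eps * (y * c * y)) =
     - (eps * ((x - y) * c * x + y * c * (x - y))).
    have -> : (x - y) * c * x + y * c * (x - y) = x * c * x - y * c * y.
      by rewrite !(mulrBl, mulrBr) subrKA.
    by rewrite mulrBr opprK opprB opprD addrC addrACA subrr add0r.
  apply: (vgeN cA); apply: vge_eps; apply: (cdv_add cA).
    have -> : t + (w a + w c) = (t + w c) + w a by lra.
    by do 2?apply: (vgeM cA) => //; exact: vge_self.
  have -> : t + (w a + w c) = (w a + w c) + t by lra.
  by do 2?apply: (vgeM cA) => //; exact: vge_self.
- split.
    have [z [za _] lz] := H (w a).
    by rewrite -[l](subrK z); apply: (cdv_add cA).
  apply/eqP; rewrite -subr_eq0; apply/eqP; apply: (vge_all0 (w := w)) => M.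
  have [z [_ zr] lz] := H M.
  have -> : rho l - eps * l = rho (l - z) - eps * (l - z).
    by rewrite mulrBr (invol_add irho) (rhoN irho) zr opprB addrA subrK.
  by apply: (vgeB cA); [exact: vge_rho | exact: vge_eps].
exists z; split=> //.
have E : a + eps * (z * c * z) = - (z + z).
  by rewrite -{3 4}Fz /F half_double opprK.
by rewrite addrAC (addrAC a) E -addrA addNr.
Qed.

(** If it failed, scaling [y] to [y'] with [h x y' = 1] would make the values of [h x x] and
    [h y' y'] add up to something positive, and [herm_quadratic_solution] would produce an isotropic
    vector $x + y'z$, which is therefore 0. Pairing it with [y'] gives $1 + \epsilon z h(y',y') =
    0$, impossible since the second term has positive value. *)
Lemma anisotropic_cauchy_schwarz (K : set V) x y :
  (forall u v, K u -> K v -> K (u + v)) -> (forall a v, K v -> K (rscale a v)) ->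
  (forall v, K v -> h v v = 0 -> v = 0) -> K x -> K y -> x != 0 -> y != 0 ->
  vge w ((w (h x x) + w (h y y)) / 2) (h x y).
Proof.
move=> KD KZ Kan Kx Ky x0 y0.
have [b0|b0] := eqVneq (h x y) 0; first by left.
right; rewrite leNgt; apply/negP => lt.
have hN0 v : K v -> v != 0 -> h v v != 0 by move=> Kv; apply: contra_neq; exact: Kan.
set b := h x y in b0 lt.
have ub := cdv_unit cA b0.
pose y' := rscale b^-1 y.
have Ky' : K y' by exact: KZ.
have y'0 : y' != 0.
  apply: contra_neq y0 => E; have := congr1 (rscale b) E.
  by rewrite -rscaleM mulVr // rscale1 rscaler0.
have xy' : h x y' = 1 by rewrite (hermZr hh irho) divrr.
have y'x : h y' x = eps by rewrite (hermC hh irho) xy' (invol_one irho) mulr1.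
have ee : eps * eps = 1 by case: (eps_sign hh) => ->; rewrite ?mulr1 // mulrNN mulr1.
have sym v : rho (h v v) = eps * h v v.
  by rewrite [in RHS](hermC hh irho) mulrA ee mul1r.
have wc : w (h y' y') = w (h y y) - 2 * w b.
  rewrite (hermZr hh irho) (hermZl hh irho) !(cdv_mul cA) ?(cdv_mulf_neq0 cA)
     ?(rho_neq0 irho) ?cdv_invr_neq0 ?hN0 // wrho ?cdv_invr_neq0 // (cdv_V cA) //.
  lra.
clearbody y'.
have [|z [zr za zE]] := herm_quadratic_solution (hN0 _ Kx x0) (hN0 _ Ky' y'0)
  (sym _) (sym _); first by rewrite wc; lra.
have hyz : h (rscale z y') y' = eps * z * h y' y' by rewrite (hermZl hh irho) zr.
have /(Kan _ (KD _ _ Kx (KZ z _ Ky'))) : h (x + rscale z y') (x + rscale z y') = 0.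
  rewrite (hermDl hh) !(hermDr hh) !(hermZr hh irho) xy' mul1r hyz (hermZl hh irho) y'x zr.
  by rewrite -(eps_comm hh (eps * z)) mulrA ee mul1r addrA -[RHS]zE !mulrA.
move=> E; have E1 : 1 + eps * z * h y' y' = 0.
  by rewrite -xy' -hyz -(hermDl hh) E (herm0l hh).
have : vge w (w (h x x) + w (h y' y')) (1 : A).
  rewrite -[1](addrK (eps * z * h y' y')) E1 sub0r -mulrA.
  apply: (vgeN cA); apply: vge_eps; apply: (vgeM cA) => //; exact: vge_self.
by move/(vge_neq0 (oner_neq0 A)); rewrite (cdv_1 cA) wc; lra.
Qed.

End Anisotropic.

Lemma sum_option (M : zmodType) (J : finType) (F : option J -> M) :
  \sum_o F o = F None + \sum_j F (Some j).
Proof.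
rewrite (bigD1 None) //= (reindex_omap (op := +%R) Some id) /=; last by case.
by congr (_ + _); apply: eq_bigl => j; rewrite eqxx.
Qed.

(** * Decompositions as systems of orthogonal idempotents *)

Section Projections.
Variables (A : unitRingType) (V : vectType A^c).

Record idem_family (J : finType) (e : J -> 'End(V)) : Prop := {
  idem_orth : forall i j v, e i (e j v) = if i == j then e j v else 0;
  idem_sum : forall v, \sum_j e j v = v }.

Section Family.
Variables (J : finType) (e : J -> 'End(V)).
Hypothesis ie : idem_family e.

Lemma idem_id j v : e j (e j v) = e j v.
Proof. by rewrite (idem_orth ie) eqxx. Qed.

Lemma idem_neq i j v : i != j -> e i (e j v) = 0.
Proof. by move=> /negPf ij; rewrite (idem_orth ie) ij. Qed.

Lemma idem_im j v : im (e j) (e j v).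
Proof. exact: idem_id. Qed.

Lemma idem_im_neq i j v : i != j -> im (e j) v -> e i v = 0.
Proof. by move=> ij <-; exact: idem_neq. Qed.

Lemma idem_im_sum (u : J -> V) i : (forall j, im (e j) (u j)) -> e i (\sum_j u j) = u i.
Proof.
move=> eu; rewrite linear_sum (bigD1 i) //= big1 ?addr0; first exact: eu.
by move=> j ji; apply: idem_im_neq (eu j); rewrite eq_sym.
Qed.

Lemma idem_decomposition : direct_decomposition [set: V] (fun j => im (e j)).
Proof.
split.
  apply/esym/seteqP; split=> // v _; exists (e ^~ v); last exact: (idem_sum ie).
  by move=> j /=; exact: idem_im.
move=> u eu s0 j; rewrite -(idem_im_sum j eu) s0; exact: linear0.
Qed.

(** As stability under projections, splitting can be transported along [psi], which acts on
    endomorphisms and not on subspaces. *)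
Lemma idem_split (R : realType) (L : R -> set V) :
  (forall t u v, L t u -> L t v -> L t (u + v)) -> (forall t, L t 0) ->
  split_by (fun j => im (e j)) L <-> forall j t v, L t v -> L t (e j v).
Proof.
move=> LD L0; split=> [sL j t v Lv|H t].
  have [LE _] := sL t; move: Lv; rewrite {1}LE => -[u Lu <-].
  by rewrite idem_im_sum => [|i]; [exact: (Lu j).1 | exact: (Lu i).2].
split.
  apply/seteqP; split=> v.
    move=> Lv; exists (e ^~ v); last exact: (idem_sum ie).
    by move=> j /=; split; [exact: H | exact: idem_im].
  move=> [u Lu <-]; elim/big_ind: _ => [|x y|j _]; [exact: L0 | exact: LD | exact: (Lu j).1].
by move=> u Lu; apply: (idem_decomposition.2) => j; exact: (Lu j).2.
Qed.

Lemma idem_End : \sum_j e j = \1%VF.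
Proof. by apply/lfunP => v; rewrite sum_lfunE (idem_sum ie) id_lfunE. Qed.

End Family.

Lemma decomposition_idem (J : finType) (W : J -> set V) :
  (forall j, rmod (@rscale A V) (W j)) -> direct_decomposition [set: V] W ->
  exists2 e : J -> 'End(V), idem_family e & forall j, W j = im (e j).
Proof.
move=> mW [WT Wi].
have [v|c cP] := @choice _ _ (fun v (u : J -> V) =>
    (forall j, W j (u j)) /\ \sum_j u j = v).
  by have : [set: V] v by []; rewrite WT => -[u Wu uE]; exists u.
have uniq u u' : (forall j, W j (u j)) -> (forall j, W j (u' j)) ->
    \sum_j u j = \sum_j u' j -> u =1 u'.
  move=> Wu Wu' E j; apply/eqP; rewrite -subr_eq0; apply/eqP.
  apply: (Wi (fun j => u j - u' j)); last by rewrite sumrB E subrr.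
  by move=> i; apply: (rmodB (mW i)).
have cj j : exists F : 'End(V), forall v, F v = c v j.
  apply: linear_lfun.
  - move=> u v; have := @uniq (c (u + v)) (fun j => c u j + c v j).
    apply; first exact: (cP _).1.
      by move=> i; apply: (rmodD (mW i)); exact: (cP _).1.
    by rewrite big_split /= !(cP _).2.
  - move=> a v; have := @uniq (c (rscale a v)) (fun j => rscale a (c v j)).
    apply; first exact: (cP _).1.
      by move=> i; apply: (rmod_act (mW i)); exact: (cP _).1.
    by rewrite -rscale_sumr !(cP _).2.
have [e eE] := choice cj.
have cW j v i : W j v -> c v i = if i == j then v else 0.
  move=> Wv; have := @uniq (c v) (fun i => if i == j then v else 0).
  apply; first exact: (cP _).1.
    by move=> k; case: eqP => [-> //|_]; exact: (rmod0 (mW k)).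
  by rewrite (cP v).2 -big_mkcond big_pred1_eq.
exists e.
  split=> [i j v|v].
    by rewrite !eE (cW j) //; exact: (cP _).1.
  by under eq_bigr do rewrite eE; exact: (cP _).2.
move=> j; apply/seteqP; split=> v.
  by move=> Wv; rewrite /im /= eE (cW j) // eqxx.
by rewrite /im /= eE => <-; exact: (cP _).1.
Qed.

Lemma rmod_line (v : V) : rmod (@rscale A V) (line v).
Proof.
apply: rmod_rscale.
- by exists 0 => //; exact: rscale0.
- by move=> _ _ [a _ <-] [b _ <-]; exists (a + b) => //; exact: rscaleDl.
- by move=> b _ [a _ <-]; exists (a * b) => //; exact: rscaleM.
Qed.

Lemma line_id (v : V) : line v v.
Proof. by exists 1 => //; exact: rscale1. Qed.

End Projections.

(** * Linear dependence over division rings *)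

Section LinearDependence.
Variables (A : unitRingType).
Hypothesis uA : forall x : A, x != 0 -> x \is a GRing.unit.

Lemma underdetermined n m (C : 'I_n -> 'I_m -> A) : (n < m)%N ->
  exists a : 'I_m -> A, (exists i, a i != 0) /\ forall j, \sum_i C j i * a i = 0.
Proof.
elim: n m C => [|n IH] m C lt.
  exists (fun=> 1); split; first by exists (Ordinal lt); exact: oner_neq0.
  by case.
have [/forallP C0|] := boolP [forall i, C ord_max i == 0].
  have [a [a0 aP]] := IH m (fun j i => C (widen_ord (leqnSn n) j) i) (ltnW lt).
  exists a; split=> // j; have [->|jn] := eqVneq j ord_max.
    by rewrite big1 // => i _; rewrite (eqP (C0 i)) mul0r.
  have jn' : (j < n)%N.
    by rewrite ltn_neqAle -ltnS ltn_ord andbT; apply: contraNneq jn => jn; apply/eqP/val_inj.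
  have -> : j = widen_ord (leqnSn n) (Ordinal jn') by apply/val_inj.
  exact: aP.
rewrite negb_forall => /existsP[p p0]; have up := uA p0.
case: m C lt p p0 up => [//|m] C lt p p0 up.
pose d i := (C ord_max p)^-1 * C ord_max (lift p i).
pose C' (j : 'I_n) i := C (widen_ord (leqnSn n) j) (lift p i)
  - C (widen_ord (leqnSn n) j) p * d i.
have [a [[i0 a0] aP]] := IH m C' lt.
pose a' i := if unlift p i is Some k then a k else - \sum_k d k * a k.
have a'p : a' p = - \sum_k d k * a k by rewrite /a' unlift_none.
have a'l k : a' (lift p k) = a k by rewrite /a' liftK.
exists a'; split; first by exists (lift p i0); rewrite a'l.
move=> j; rewrite (bigD1_ord p) //= a'p; under eq_bigr do rewrite a'l.
rewrite mulrN mulr_sumr.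
have [->|jn] := eqVneq j ord_max.
  by apply/eqP; rewrite addrC subr_eq0; apply/eqP/eq_bigr => i _; rewrite !mulrA divrr ?mul1r.
have jn' : (j < n)%N.
  by rewrite ltn_neqAle -ltnS ltn_ord andbT; apply: contraNneq jn => jn; apply/eqP/val_inj.
have -> : j = widen_ord (leqnSn n) (Ordinal jn') by apply/val_inj.
rewrite -[RHS](aP (Ordinal jn')) addrC -sumrB; apply: eq_bigr => i _.
by rewrite /C' mulrBl mulrA.
Qed.

Lemma vect_dependent (V : vectType A^c) : exists N, forall (J : finType) (v : J -> V),
  (N < #|J|)%N -> exists2 a : J -> A, (exists j, a j != 0) & \sum_j rscale (a j) (v j) = 0.
Proof.
have [N [b VE]] := fgen_vect V; exists N => J v lt.
have [j|C CE] := @choice _ _ (fun j (c : 'I_N -> A) => \sum_i rscale (c i) (b i) = v j).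
  by have : [set: V] (v j) by []; rewrite VE => -[c _ cE]; exists c.
have [a [[i ai] aP]] := underdetermined (fun k i => C (enum_val i) k) lt.
exists (fun j => a (enum_rank j)); first by exists (enum_val i); rewrite enum_valK.
have -> : \sum_j rscale (a (enum_rank j)) (v j) =
    \sum_j \sum_i rscale (C j i * a (enum_rank j)) (b i).
  by apply: eq_bigr => j _; rewrite -CE rscale_sumr; apply: eq_bigr => k _; rewrite rscaleM.
rewrite exchange_big big1 // => k _; rewrite -rscale_suml.
rewrite (reindex (@enum_val J J)) /=; last by apply: onW_bij; exact: enum_val_bij.
under eq_bigr do rewrite enum_valK.
by rewrite aP rscale0.
Qed.

(** If $x = v - g(g'(v))$ were nonzero, all its iterates under [g] would be independent: [g'] kills
    [x] and undoes [g], so it shortens a relation by one term. This contradicts finite dimension. *)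
Lemma End_inverse_comm (V : vectType A^c) (g g' : 'End(V)) :
  (forall v, g' (g v) = v) -> forall v, g (g' v) = v.
Proof.
move=> g'g v; apply/eqP; rewrite eq_sym -subr_eq0; apply: contraT => x0.
set x := v - g (g' v) in x0.
have g'x : g' x = 0 by rewrite linearB /= g'g subrr.
have indep N (a : nat -> A) : \sum_(n < N) rscale (a n) (iter n g x) = 0 ->
    forall n, (n < N)%N -> a n = 0.
  elim: N a => // N IH a; rewrite big_ord_recl /= => s0.
  have sE : \sum_(n < N) rscale (a (bump 0 n)) (g (iter n g x)) =
      g (\sum_(n < N) rscale (a n.+1) (iter n g x)).
    by rewrite linear_sum; apply: eq_bigr => n _; rewrite -[RHS]/(g _) lfun_rscale.
  rewrite sE in s0.
  have s1 : \sum_(n < N) rscale (a n.+1) (iter n g x) = 0.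
    by have := congr1 g' s0; rewrite linearD /= g'g lfun_rscale g'x rscaler0 add0r linear0.
  have a00 : a 0%N = 0.
    apply/eqP; apply: contraT => /uA ua; move/eqP: x0; case.
    move: s0; rewrite s1 linear0 addr0 => /(congr1 (rscale (a 0%N)^-1)).
    by rewrite rscaler0 -rscaleM mulrV // rscale1.
  case=> [|n] //; rewrite ltnS; exact: (IH (fun n => a n.+1)).
have [N NP] := vect_dependent V.
have [|a [j aj] aE] := NP 'I_N.+1 (fun n : 'I_N.+1 => iter n g x); first by rewrite card_ord.
pose a' n := if insub n is Some j then a j else 0.
have a'E (n : 'I_N.+1) : a' n = a n by rewrite /a' valK.
case/eqP: aj; rewrite -a'E; apply: (indep N.+1) => //.
by rewrite -[RHS]aE; apply: eq_bigr => n _; rewrite a'E.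
Qed.

End LinearDependence.

(** * Witt decompositions *)

Section WittDecompositions.
Variables (R : realType) (A : unitRingType) (w : A -> R) (cA : cdv w).
Variables (V : vectType A^c) (h : V -> V -> A) (rho : A -> A) (eps : A).
Hypotheses (hh : hermitian_form h rho eps) (irho : ring_involution rho).

Record witt_basis (J : finType) (u : J -> V) (st : J -> J) : Prop := {
  wb_inv : forall p, st (st p) = p;
  wb_neq : forall p, st p != p;
  wb_orth : forall p q, q != st p -> h (u p) (u q) = 0;
  wb_pair : forall p, h (u p) (u (st p)) != 0 }.

Section Basis.
Variables (J : finType) (u : J -> V) (st : J -> J).
Hypothesis wu : witt_basis u st.

Lemma wb_neq0 p : u p != 0.
Proof. by apply: contra_neq (wb_pair wu p) => ->; exact: (herm0l hh). Qed.

Lemma wb_coef p : h (u (st p)) (u p) != 0.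
Proof. by have := wb_pair wu (st p); rewrite (wb_inv wu). Qed.

Lemma wb_hsum (a : J -> A) p : h (u (st p)) (\sum_j rscale (a j) (u j)) =
  h (u (st p)) (u p) * a p.
Proof.
rewrite (herm_sumr hh) (bigD1 p) //= (hermZr hh irho) big1 ?addr0 // => j jp.
by rewrite (hermZr hh irho) (wb_orth wu) ?mul0r // (wb_inv wu).
Qed.

Lemma wb_kernelP v : witt_kernel h (fun p => line (u p)) v <-> forall p, h (u p) v = 0.
Proof.
split=> [H p|H p _ [a _ <-]]; first by apply: (H p); exact: line_id.
by rewrite (hermZl hh irho) H mulr0.
Qed.

Lemma wb_witt_decomposition :
  (forall v, (forall p, h (u p) v = 0) -> h v v = 0 -> v = 0) ->
  witt_decomposition h (fun p => line (u p)).
Proof.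
move=> an; split.
- by move=> p; exists (u p); rewrite wb_neq0.
- move=> p _ _ [a _ <-] [b _ <-].
  by rewrite (hermZl hh irho) (hermZr hh irho) (wb_orth wu) ?mul0r ?mulr0 // eq_sym (wb_neq wu).
- move=> x xW s0 p.
  have [a aE] := choice (fun p => let: ex_intro2 a _ E := xW p in ex_intro _ a E : exists a, rscale a (u p) = x p).
  have : h (u (st p)) (\sum_j x j) = 0 by rewrite s0 (herm0r hh).
  under eq_bigr do rewrite -aE.
  rewrite wb_hsum => /(congr1 ( *%R (h (u (st p)) (u p))^-1)).
  rewrite mulr0 mulrA mulVr ?(cdv_unit cA) ?wb_coef // mul1r -aE => ->.
  exact: rscale0.
- move=> p; exists (st p); split.
    by exists (u p), (u (st p)); split; [exact: line_id | exact: line_id | exact: (wb_pair wu)].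
  move=> q [_ [_ [[a _ <-] [b _ <-]]]] H; apply/eqP; apply: contraNT H => qp.
  by rewrite (hermZl hh irho) (hermZr hh irho) (wb_orth wu) ?mul0r ?mulr0 // eq_sym.
- by move=> v /wb_kernelP; exact: an.
Qed.

Lemma wb_projections : exists e : option J -> 'End(V),
  [/\ idem_family e,
      forall p v, e (Some p) v =
        rscale ((h (u (st p)) (u p))^-1 * h (u (st p)) v) (u p),
      forall p, im (e (Some p)) = line (u p),
      im (e None) = witt_kernel h (fun p => line (u p))
    & forall o x y, h (e o x) y = h x (e (omap st o) y)].
Proof.
have [p|f fE] := @choice _ _ (fun p (F : 'End(V)) => forall v,
    F v = rscale ((h (u (st p)) (u p))^-1 * h (u (st p)) v) (u p)).
  apply: linear_lfun => [x y|a x].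
    by rewrite (hermDr hh) mulrDr rscaleDl.
  by rewrite (hermZr hh irho) mulrA rscaleM.
pose e o := if o is Some p then f p else (\1 - \sum_p f p)%VF.
have fu p q a : f p (rscale a (u q)) = if p == q then rscale a (u q) else 0.
  rewrite fE (hermZr hh irho); case: eqP => [->|/eqP pq].
    by rewrite mulKr // (cdv_unit cA) // wb_coef.
  have -> : h (u (st p)) (u q) = 0 by apply: (wb_orth wu); rewrite (wb_inv wu) eq_sym.
  by rewrite mul0r mulr0 rscale0.
have ff p q v : f p (f q v) = if p == q then f q v else 0 by rewrite [f q v]fE fu.
have eN v : e None v = v - \sum_p f p v.
  by rewrite /e add_lfunE opp_lfunE id_lfunE sum_lfunE.
have sf q v : \sum_p f p (f q v) = f q v.
  by rewrite (bigD1 q) //= ff eqxx big1 ?addr0 // => p /negPf pq; rewrite ff pq.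
have fs q v : f q (\sum_p f p v) = f q v.
  by rewrite linear_sum (bigD1 q) //= ff eqxx big1 ?addr0 // => p; rewrite ff eq_sym => /negPf ->.
have eo : \sum_o e o = (\1 : 'End(V))%VF.
  by rewrite sum_option subrK.
have adj p x y : h (f p x) y = h x (f (st p) y).
  rewrite !fE (hermZl hh irho) (hermZr hh irho) (wb_inv wu).
  set g := h (u (st p)) (u p); have g0 : g != 0 by exact: wb_coef.
  have g'0 : h (u p) (u (st p)) != 0 by exact: (wb_pair wu).
  rewrite (invol_mul irho) (hermC hh irho x (u (st p))) -mulrA.
  have gE : h (u p) (u (st p)) = eps * rho g by rewrite (hermC hh irho).
  have -> : (h (u p) (u (st p)))^-1 = rho g^-1 * eps.
    have ug := cdv_unit cA g0; have ug' := cdv_unit cA g'0.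
    apply: (mulrI ug'); rewrite divrr // gE -mulrA (mulrA (rho g)) -(invol_mul irho).
    rewrite mulVr // (invol_one irho) mul1r.
    by case: (eps_sign hh) => ->; rewrite ?mulr1 // mulrNN mulr1.
  have ee : eps * eps = 1 by case: (eps_sign hh) => ->; rewrite ?mulr1 // mulrNN mulr1.
  rewrite !mulrA; congr (_ * _); rewrite -(eps_comm hh) !mulrA ee mul1r //.
exists e; split.
- split=> [|v]; last by rewrite -sum_lfunE eo id_lfunE.
  move=> [i|] [j|] v.
  + by rewrite ff.
  + by rewrite eN /= linearB /= fs subrr.
  + by rewrite eN sf subrr.
  + by rewrite eN big1 ?subr0 //= => p _; rewrite -/(e None) eN linearB /= fs subrr.
- by move=> p v; rewrite fE.
- move=> p; apply/seteqP; split=> v; rewrite /im /=.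
    by rewrite fE => <-; exists ((h (u (st p)) (u p))^-1 * h (u (st p)) v).
  by move=> [a _ <-]; rewrite fu eqxx.
- apply/seteqP; split=> v.
    rewrite /im /= eN => E; apply/wb_kernelP => p.
    have : f (st p) v = 0 by rewrite -E linearB /= fs subrr.
    rewrite fE (wb_inv wu) => /(congr1 (h (u p))).
    rewrite (hermZr hh irho) (herm0r hh) mulrA divrr ?mul1r //.
    by rewrite (cdv_unit cA) // (wb_pair wu).
  move=> /wb_kernelP H; rewrite /im /= eN big1 ?subr0 // => p _.
  by rewrite fE H mulr0 rscale0.
- move=> [p|] x y; first exact: adj.
  rewrite !eN (hermDl hh) (hermDr hh) (hermNl hh) (hermNr hh); congr (_ - _).
  rewrite (herm_suml hh) (herm_sumr hh).
  rewrite (reindex_inj (h := st)) /=; last by apply: inv_inj; exact: (wb_inv wu).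
  by apply: eq_bigr => p _; rewrite adj (wb_inv wu).
Qed.

End Basis.

Lemma witt_basis_of (J : finType) (W : J -> set V) : witt_decomposition h W ->
  exists (u : J -> V) st, witt_basis u st /\ W = fun j => line (u j).
Proof.
move=> wW.
have [j|u uP] := @choice _ _ (fun j v => v != 0 /\ W j = line v).
  by have [v [v0 vE]] := witt_line wW j; exists v.
have [j|st stP] := @choice _ _ (fun j j' => h (u j) (u j') != 0 /\
    forall q, h (u j) (u q) != 0 -> q = j').
  have [q [[x [y [Wx Wy H]]] qu]] := witt_pairing wW j.
  move: Wx Wy H; rewrite (uP j).2 (uP q).2 => -[a _ <-] [b _ <-] H; exists q; split.
    apply: contra_neq H => E.
    by rewrite (hermZl hh irho) (hermZr hh irho) E mul0r mulr0.
  move=> r hr; apply/esym/qu; exists (u j), (u r).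
  by rewrite (uP j).2 (uP r).2; split=> //; exact: line_id.
exists u, st; split; last by apply/funext => j; exact: (uP j).2.
have hC p q : h (u p) (u q) != 0 -> h (u q) (u p) != 0.
  by apply: contra_neq; exact: (herm_eq0C hh irho).
split.
- by move=> p; apply/esym/(stP (st p)).2/hC; exact: (stP p).1.
- move=> p; apply: contraNneq (stP p).1 => ->.
  by apply/eqP; apply: (witt_isotropic wW (j := p)); rewrite (uP p).2; exact: line_id.
- by move=> p q; apply: contraNeq => /(stP p).2 ->.
- by move=> p; exact: (stP p).1.
Qed.

End WittDecompositions.

(** * Homogeneous Witt bases adapted to a self-dual norm *)

Section GradedWitt.
Variables (R : realType) (A : unitRingType) (w : A -> R) (cA : cdv w).
Variables (V : vectType A^c) (h : V -> V -> A) (rho : A -> A) (eps : A).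
Hypotheses (hh : hermitian_form h rho eps) (irho : ring_involution rho).
Hypotheses (two_neq0 : (2%:R : A) != 0) (w2 : w 2%:R = 0).
Variables (nu : A -> \bar R) (c : R) (nw : normalized nu w c).

Variables (O : finType) (f : O -> 'End(V)) (dl : O -> O).
Hypotheses (idf : idem_family f) (dlK : involutive dl).
Hypothesis fdl : forall o o' u v, o' != dl o -> h (f o u) (f o' v) = 0.
Hypothesis fix1 : forall o o', dl o = o -> dl o' = o' -> o = o'.

(* Without the lattice function: take [Q := False]. *)
Variables (Q : Prop) (L : R -> set V).
Hypothesis nL : Q -> nlf w (@rscale A V) [set: V] L.
Hypothesis Ld : Q -> dual_lf nu h [set: V] L = L.
Hypothesis Lf : Q -> forall o t v, L t v -> L t (f o v).

Let homog o u v : f o u = u -> h u (f (dl o) v) = h u v.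
Proof.
move=> fu; rewrite -[in RHS](idem_sum idf v) (herm_sumr hh) (bigD1 (dl o)) //=.
by rewrite big1 ?addr0 // => o' oo'; rewrite -fu fdl.
Qed.

Let homog0 o o' u v : f o u = u -> o' != dl o -> h u (f o' v) = 0.
Proof. by move=> <- ?; rewrite fdl. Qed.

Let selfdual_vge t s u v : Q -> L t u -> L s v -> vge w (t + s) (h u v).
Proof. by move=> q; exact: (selfdual_vge hh irho cA nw (nL q) (Ld q)). Qed.

(** By self-duality the norms of the two vectors of a pair add up to at most 0; [hs_L] asks for
    equality, which makes the projections onto their lines preserve the balls. *)
Record hyp_system (J : finType) (x y : J -> V) : Prop := {
  hs_grade : forall j, exists o, f o (x j) = x j /\ f (dl o) (y j) = y j;
  hs_x : forall i j, h (x i) (x j) = 0;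
  hs_y : forall i j, h (y i) (y j) = 0;
  hs_xy : forall i j, h (x i) (y j) = (i == j)%:R;
  hs_L : Q -> forall j, exists t, L t (x j) /\ L (- t) (y j) }.

(** The partner of [z] comes from [selfdual_pairing] and is corrected three times without leaving
    its ball: its components along the earlier planes are removed ([y1]), it is projected to the
    degree dual to that of [z] ([y2]), and half of its self-pairing is removed along [z] ([y3]). *)
Lemma hyp_extend (J : finType) (x y : J -> V) o z : hyp_system x y ->
  f o z = z -> z != 0 -> h z z = 0 ->
  (forall j, h (x j) z = 0 /\ h (y j) z = 0) ->
  exists z', hyp_system (fun j => oapp x z j) (fun j => oapp y z' j).
Proof.
move=> hs fz z0 hzz xyz.
have ee : eps * eps = 1 by case: (eps_sign hh) => ->; rewrite ?mulr1 // mulrNN mulr1.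
have hyx i j : h (y i) (x j) = eps * (i == j)%:R.
  rewrite (hermC hh irho) (hs_xy hs) eq_sym; case: (_ == _) => /=.
    by rewrite (invol_one irho).
  by rewrite (rho0 irho).
pose a := norm_lf L z.
have [y0 [zy0 Ly0]] : exists y0, h z y0 = 1 /\ (Q -> L (- a) y0).
  have [q|nq] := pselect Q.
    have [y0 [H1 H2]] := selfdual_pairing hh irho cA nw (nL q) (Ld q) z0.
    by exists y0; split.
  have [y0 hy0] : exists y0, h z y0 != 0.
    apply: contrapT => H; move/eqP: z0; apply; apply: (herm_nondeg hh) => u.
    by apply: contrapT => /eqP hu; apply: H; exists u.
  exists (rscale (h z y0)^-1 y0); split=> //.
  by rewrite (hermZr hh irho) divrr // (cdv_unit cA).
have Lz : Q -> L a z by move=> q; apply/(nlf_norm (nL q)).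
pose s := \sum_j (rscale (h (x j) y0) (y j) + rscale (eps * h (y j) y0) (x j)).
pose y1 := y0 - s.
have zs : h z s = 0.
  rewrite (herm_sumr hh) big1 // => j _; rewrite (hermDr hh) !(hermZr hh irho).
  have [/(herm_eq0C hh irho) -> /(herm_eq0C hh irho) ->] := xyz j.
  by rewrite !mul0r addr0.
have zy1 : h z y1 = 1 by rewrite (hermDr hh) (hermNr hh) zs subr0.
have xy1 i : h (x i) y1 = 0.
  rewrite (hermDr hh) (hermNr hh) (herm_sumr hh) (bigD1 i) //= big1.
    by rewrite (hermDr hh) !(hermZr hh irho) (hs_xy hs) (hs_x hs) eqxx mul1r mul0r !addr0 subrr.
  move=> j ji; rewrite (hermDr hh) !(hermZr hh irho) (hs_xy hs) (hs_x hs) eq_sym (negPf ji).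
  by rewrite !mul0r addr0.
have yy1 i : h (y i) y1 = 0.
  rewrite (hermDr hh) (hermNr hh) (herm_sumr hh) (bigD1 i) //= big1.
    rewrite (hermDr hh) !(hermZr hh irho) hyx (hs_y hs) eqxx mul0r add0r addr0 mulr1.
    by rewrite mulrA ee mul1r subrr.
  move=> j ji; rewrite (hermDr hh) !(hermZr hh irho) hyx (hs_y hs) eq_sym (negPf ji).
  by rewrite mulr0 !mul0r addr0.
have Ly1 : Q -> L (- a) y1.
  move=> q; apply: (nlfB (rmod_setT V) cA (nL q)); first exact: Ly0.
  apply: (nlf_sum (nL q)) => j; have [t [Lx Ly]] := hs_L hs q j.
  apply: (nlfD (nL q)).
    have -> : - a = - t + (t - a) by lra.
    apply: (nlf_act_vge (rmod_setT V) (nL q)) => //.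
    by apply: selfdual_vge => //; exact: Ly0.
  have -> : - a = t + (- t - a) by lra.
  apply: (nlf_act_vge (rmod_setT V) (nL q)) => //.
  apply: (vge_eps cA hh); apply: selfdual_vge => //; exact: Ly0.
pose y2 := f (dl o) y1.
have fy2 : f (dl o) y2 = y2 by exact: (idem_id idf).
have Ly2 : Q -> L (- a) y2 by move=> q; apply: Lf => //; exact: Ly1.
have zy2 : h z y2 = 1 by rewrite homog.
have u2 u o' : f o' u = u -> h u y1 = 0 -> h u y2 = 0.
  move=> fu hu; have [E|no] := eqVneq (dl o) (dl o'); first by rewrite /y2 E homog.
  exact: homog0 no.
have xy2 i : h (x i) y2 = 0 by have [o' [fx _]] := hs_grade hs i; apply: (u2 _ o').
have yy2 i : h (y i) y2 = 0 by have [o' [_ fy]] := hs_grade hs i; apply: (u2 _ (dl o')).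
pose b := - (eps * h y2 y2) / 2%:R.
pose y3 := y2 + rscale b z.
(* The correction along [z] has degree [o], but it is nonzero only if [h y2 y2] is, and this forces
   [dl o = o]. *)
have fy3 : f (dl o) y3 = y3.
  rewrite /y3; have [q0|q0] := eqVneq (h y2 y2) 0.
    by rewrite /b q0 mulr0 oppr0 mul0r rscale0 addr0.
  have E : dl o = o.
    apply/eqP; apply: contraT => no; case/eqP: q0.
    by rewrite -[X in h X _]fy2 -[X in h _ X]fy2; apply: fdl; rewrite dlK.
  by rewrite linearD /= fy2 lfun_rscale E fz.
have y2z : h y2 z = eps by rewrite (hermC hh irho) zy2 (invol_one irho) mulr1.
have y33 : h y3 y3 = 0.
  rewrite /y3 (hermDl hh) !(hermDr hh) !(hermZl hh irho) !(hermZr hh irho) hzz y2z zy2.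
  rewrite mul0r mulr0 addr0 mulr1.
  set q := h y2 y2.
  have qE : rho q = eps * q by rewrite [in RHS]/q (hermC hh irho) mulrA ee mul1r.
  have -> : rho b = - q / 2%:R.
    rewrite /b (invol_mul irho) (rho_half cA irho two_neq0) (half_comm cA two_neq0) (rhoN irho).
    rewrite (invol_mul irho) qE; have -> : rho eps = eps.
      by case: (eps_sign hh) => ->; rewrite ?(rhoN irho) (invol_one irho).
    by rewrite -mulrA -(eps_comm hh) mulrA ee mul1r.
  have -> : eps * b = - q / 2%:R by rewrite /b mulrA mulrN mulrA ee mul1r.
  by rewrite -addrA (half_double cA two_neq0) subrr.
have Ly3 : Q -> L (- a) y3.
  move=> q; apply: (nlfD (nL q)); first exact: Ly2.
  have -> : - a = a + (- a - a) by lra.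
  apply: (nlf_act_vge (rmod_setT V) (nL q)); last exact: Lz.
  apply: (vge_half cA two_neq0 w2); apply: (vgeN cA); apply: (vge_eps cA hh).
  by apply: selfdual_vge => //; exact: Ly2.
have xy3 i : h (x i) y3 = 0 by rewrite (hermDr hh) xy2 (hermZr hh irho) (xyz i).1 mul0r addr0.
have yy3 i : h (y i) y3 = 0 by rewrite (hermDr hh) yy2 (hermZr hh irho) (xyz i).2 mul0r addr0.
have zy3 : h z y3 = 1 by rewrite (hermDr hh) zy2 (hermZr hh irho) hzz mul0r addr0.
exists y3; split.
- by move=> [j|] /=; [exact: (hs_grade hs) | exists o].
- move=> [i|] [j|] //=; rewrite ?(hs_x hs) ?(xyz _).1 //.
  by apply: (herm_eq0C hh irho); exact: (xyz _).1.
- move=> [i|] [j|] //=; rewrite ?(hs_y hs) //.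
  by apply: (herm_eq0C hh irho).
- move=> [i|] [j|] //=; rewrite ?(hs_xy hs) //.
  by apply: (herm_eq0C hh irho); exact: (xyz _).2.
- by move=> q [j|] /=; [exact: (hs_L hs) | exists a; split; [exact: Lz | exact: Ly3]].
Qed.

(** The [y j] are independent, a coefficient being read off by pairing with [x j]; hence the number
    of pairs is bounded. *)
Lemma hyp_maximal : exists (J : finType) (x y : J -> V), hyp_system x y /\
  forall o z, f o z = z -> h z z = 0 ->
    (forall j, h (x j) z = 0 /\ h (y j) z = 0) -> z = 0.
Proof.
apply: contrapT => H.
have grow n : exists (J : finType) (x y : J -> V), #|J| = n /\ hyp_system x y.
  elim: n => [|n [J [x [y [Jn hs]]]]].
    by exists 'I_0, (fun=> 0), (fun=> 0); rewrite card_ord; split=> //; split; by [case | move=> _ []].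
  apply: contrapT => H'; apply: H; exists J, x, y; split=> // o z fz hz xyz.
  apply/eqP; apply: contraT => z0; exfalso; apply: H'.
  have [z' hs'] := hyp_extend hs fz z0 hz xyz.
  by exists (option J : finType), (fun j => oapp x z j), (fun j => oapp y z' j);
    rewrite card_option Jn.
have [N NP] := vect_dependent (cdv_unit cA) V.
have [J [x [y [Jn hs]]]] := grow N.+1.
have [|a [j aj] aE] := NP J y; first by rewrite Jn.
have := congr1 (h (x j)) aE; rewrite (herm0r hh) (herm_sumr hh) (bigD1 j) //=.
rewrite (hermZr hh irho) (hs_xy hs) eqxx mul1r big1 ?addr0 => [/eqP|i ij].
  by rewrite (negPf aj).
by rewrite (hermZr hh irho) (hs_xy hs) eq_sym (negPf ij) mul0r.
Qed.

(** For a maximal system, the component of a kernel vector in a degree that is not self-dual is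
    isotropic and orthogonal to the system, hence 0. The kernel thus lies in the self-dual degree,
    if there is one, so its vectors are homogeneous and maximality makes it anisotropic. *)
Theorem graded_witt : exists (J : finType) (u : J -> V) (st : J -> J),
  [/\ witt_basis h u st, witt_decomposition h (fun p => line (u p)),
      forall p, exists o, f o (u p) = u p,
      forall v, (forall p, h (u p) v = 0) -> forall o, dl o != o -> f o v = 0
    & Q -> split_by (witt_family h (fun p => line (u p))) L].
Proof.
have [J [x [y [hs hmax]]]] := hyp_maximal.
have hyx i j : h (y i) (x j) = eps * (i == j)%:R.
  rewrite (hermC hh irho) (hs_xy hs) eq_sym; case: (_ == _) => /=.
    by rewrite (invol_one irho).
  by rewrite (rho0 irho).
pose u (p : J * bool) := if p.2 then y p.1 else x p.1.
pose st (p : J * bool) := (p.1, ~~ p.2).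
have eps0 : eps != 0.
  by case: (eps_sign hh) => ->; rewrite ?oppr_eq0 oner_neq0.
have weps : w eps = 0.
  by case: (eps_sign hh) => ->; rewrite ?(cdv_N1 cA) ?(cdv_1 cA).
have huu p : h (u p) (u (st p)) = if p.2 then eps else 1.
  by case: p => j [] /=; rewrite /u /= ?(hs_xy hs) ?hyx eqxx ?mulr1.
have wu : witt_basis h u st.
  split.
  - by case=> j b; rewrite /st /= negbK.
  - by case=> j b; rewrite /st xpair_eqE eqxx /=; case: b.
  - case=> i [] [j []]; rewrite /st /u xpair_eqE /= ?andbT ?andbF ?(hs_x hs) ?(hs_y hs) //.
      by rewrite hyx eq_sym => /negPf ->; rewrite mulr0.
    by rewrite (hs_xy hs) eq_sym => /negPf ->.
  - by move=> p; rewrite huu; case: ifP => _ //; exact: oner_neq0.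
have ker v : (forall p, h (u p) v = 0) -> forall o j, h (x j) (f o v) = 0 /\ h (y j) (f o v) = 0.
  move=> kv o j; have [o' [fx fy]] := hs_grade hs j.
  have xv : h (x j) v = 0 := kv (j, false).
  have yv : h (y j) v = 0 := kv (j, true).
  split.
    have [->|no] := eqVneq o (dl o'); first by rewrite homog.
    exact: (homog0 _ fx no).
  have [->|no] := eqVneq o o'; last by apply: (homog0 _ fy); rewrite dlK.
  by rewrite -{1}(dlK o') homog.
have ker0 v : (forall p, h (u p) v = 0) -> forall o, dl o != o -> f o v = 0.
  move=> kv o no; apply: (hmax o); first exact: (idem_id idf).
    by apply: fdl; rewrite eq_sym.
  exact: ker.
have wd : witt_decomposition h (fun p => line (u p)).
  apply: (wb_witt_decomposition cA hh irho wu) => v kv hv.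
  have [[o0 fo0]|no0] := pselect (exists o0, dl o0 = o0).
    have vE : v = f o0 v.
      rewrite -[LHS](idem_sum idf) (bigD1 o0) //= big1 ?addr0 // => o oo0.
      by apply: ker0 => //; apply: contra_neq oo0 => oo; exact: fix1.
    apply: (hmax o0); rewrite -?vE // => j; rewrite vE; exact: ker.
  rewrite -[LHS](idem_sum idf) big1 // => o _; apply: ker0 => //.
  by apply/eqP => oo; apply: no0; exists o.
exists (J * bool)%type, u, st; split=> //.
  case=> j []; have [o [fx fy]] := hs_grade hs j; first by exists (dl o).
  by exists o.
move=> q; have [e [ie eE el ek _]] := wb_projections cA hh irho wu.
have -> : witt_family h (fun p => line (u p)) = fun o => im (e o).
  by apply/funext => -[p|] /=; rewrite ?el ?ek.
apply/(idem_split ie); [exact: (nlfD (nL q)) | exact: (nlf0 (nL q)) |].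
(* The coefficient on the line of [u p] is a pairing with [u (st p)] up to a unit, and self-duality
   bounds its value by $t - s$, where [u (st p)] lies in the ball at $-s$. *)
have eS p t v : L t v -> L t (e (Some p) v).
  move=> Lv; rewrite eE.
  have [s [Ls Ls']] : exists s, L s (u p) /\ L (- s) (u (st p)).
    case: p => j []; have [s [Lx Ly]] := hs_L hs q j.
      by exists (- s); rewrite opprK.
    by exists s.
  have -> : t = s + (0 + (- s + t)) by lra.
  apply: (nlf_act_vge (rmod_setT V) (nL q)) => //; apply: (vgeM cA).
    have g0 := wb_coef wu p.
    right; rewrite (cdv_V cA) // -{2}[p](wb_inv wu) huu.
    by case: ifP => _; rewrite ?weps ?(cdv_1 cA) oppr0.
  exact: selfdual_vge.
case=> [p|] t v Lv; first exact: eS.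
have -> : e None v = v - \sum_p e (Some p) v.
  by apply/eqP; rewrite eq_sym subr_eq eq_sym -[eqbRHS](idem_sum ie) sum_option.
apply: (nlfB (rmod_setT V) cA (nL q)) => //; apply: (nlf_sum (nL q)) => p; exact: eS.
Qed.

End GradedWitt.

(** * Self-dual norms on anisotropic summands, and biduality *)

Section SelfDuality.
Variables (R : realType) (A : unitRingType) (w : A -> R) (cA : cdv w).
Variables (V : vectType A^c) (h : V -> V -> A) (rho : A -> A) (eps : A).
Hypotheses (hh : hermitian_form h rho eps) (irho : ring_involution rho).
Hypotheses (two_neq0 : (2%:R : A) != 0) (w2 : w 2%:R = 0).
Variables (nu : A -> \bar R) (c : R) (nw : normalized nu w c).
Let wrho := involution_val cA two_neq0 w2 irho.

(* On an anisotropic summand a self-dual norm is [v |-> w (h v v) / 2]. *)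
Lemma selfdual_anisotropic L (e : 'End(V)) t v :
  nlf w (@rscale A V) [set: V] L -> dual_lf nu h [set: V] L = L ->
  (forall v, e (e v) = e v) -> (forall x y, h (e x) y = h x (e y)) ->
  (forall t v, L t v -> L t (e v)) ->
  (forall v, im e v -> h v v = 0 -> v = 0) ->
  im e v -> L t v <-> vge w (t + t) (h v v).
Proof.
move=> nL Ld ee eadj Le an ev; split=> [Lv|].
  exact: (selfdual_vge hh irho cA nw nL Ld).
have [->|v0 hv] := eqVneq v 0; first by move=> _; exact: (nlf0 nL).
have hvN0 : h v v != 0 by apply: contra_neq v0; exact: an.
rewrite -Ld; apply/(dual_lfP hh irho cA nw _ _ _ nL); split=> // s x Lx.
have -> : h v x = h v (e x) by rewrite -eadj ev.
have eex : im e (e x) by exact: ee.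
have [->|x0] := eqVneq (e x) 0; first by left; exact: (herm0r hh).
have hxN0 : h (e x) (e x) != 0 by apply: contra_neq x0; exact: an.
have mI := rmod_im e.
have CS := anisotropic_cauchy_schwarz cA hh irho two_neq0 w2 (rmodD mI)
  (rmod_act mI) an ev eex v0 x0.
apply: vge_le CS.
have := vge_neq0 hvN0 hv.
have := vge_neq0 hxN0 (selfdual_vge hh irho cA nw nL Ld (Le _ _ Lx) (Le _ _ Lx)).
lra.
Qed.

Lemma orth_coef (e : 'End(V)) L n (b : 'I_n -> V) :
  (forall v, e (e v) = e v) -> nlf w (@rscale A V) (im e) L ->
  orth_basis (@rscale A V) (im e) L b ->
  exists co : V -> 'I_n -> A, [/\ forall v, e v = \sum_i rscale (co v i) (b i),
    forall u v i, co (u + v) i = co u i + co v i,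
    forall a v i, co (rscale a v) i = co v i * a
    & forall i j, co (b i) j = if j == i then 1 else 0].
Proof.
move=> ee nL [bX bS bL].
have indep (a a' : 'I_n -> A) : \sum_i rscale (a i) (b i) = \sum_i rscale (a' i) (b i) -> a =1 a'.
  move=> E i; apply/eqP; rewrite -subr_eq0; apply: contraT => d0.
  have: b i = 0.
    apply: (rmod_act_eq0 (rmod_im e) (cdv_unit cA d0) (bX i).1).
    apply: (nlf_sep nL) => [|t]; first exact: (rmod_act (rmod_im e) _ (bX i).1).
    apply: (bL t (fun i => a i - a' i)).
    under eq_bigr do rewrite rscaleDl rscaleN.
    by rewrite sumrB E subrr; exact: (nlf0 nL).
  by move/eqP; rewrite (negPf (bX i).2).
have [v|co coE] := @choice _ _ (fun v (a : 'I_n -> A) => e v = \sum_i rscale (a i) (b i)).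
  exact: bS.
exists co; split=> //.
- move=> u v; apply: (indep (co (u + v)) (fun j => co u j + co v j)).
  under [RHS]eq_bigr do rewrite rscaleDl.
  by rewrite -coE linearD /= !coE big_split.
- move=> a v; apply: (indep (co (rscale a v)) (fun j => co v j * a)).
  under [RHS]eq_bigr do rewrite rscaleM.
  by rewrite -coE lfun_rscale coE rscale_sumr.
- move=> i; apply: (indep (co (b i)) (fun k => if k == i then 1 else 0)).
  rewrite -coE (bigD1 i) //= eqxx rscale1 big1 ?addr0; first exact: (bX i).1.
  by move=> k /negPf ->; rewrite rscale0.
Qed.

Lemma orth_coord (e : 'End(V)) L n (b : 'I_n -> V) :
  (forall v, e (e v) = e v) -> nlf w (@rscale A V) (im e) L ->
  orth_basis (@rscale A V) (im e) L b ->
  exists2 p : 'I_n -> 'End(V), (forall v, e v = \sum_j p j v) &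
    forall j, (forall v, exists a, p j v = rscale a (b j)) /\
              forall i, p j (b i) = if i == j then b j else 0.
Proof.
move=> ee nL ob; have [co [coE coD coZ coB]] := orth_coef ee nL ob.
have [j|p pE] := @choice _ _ (fun j (F : 'End(V)) => forall v, F v = rscale (co v j) (b j)).
  apply: linear_lfun => [u v|a v]; first by rewrite coD rscaleDl.
  by rewrite coZ rscaleM.
exists p; first by move=> v; rewrite coE; apply: eq_bigr => j _; rewrite pE.
move=> j; split=> [v|i]; first by exists (co v j).
by rewrite pE coB eq_sym; case: eqP => _; rewrite ?rscale1 ?rscale0.
Qed.

(** The inclusion to be proved is tested on an orthogonal basis: the adjoint of the [j]-th
    coordinate projection provides a vector in the dual ball at minus the norm of [b j], and pairing
    with it reads off the [j]-th coordinate up to [rho]. *)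
Lemma dual_dual (e e' : 'End(V)) L :
  (forall f : 'End(V), exists g, adjoint_pair h f g) ->
  (forall v, e (e v) = e v) -> adjoint_pair h e e' ->
  nlf w (@rscale A V) (im e) L ->
  dual_lf nu h (im e) (dual_lf nu h (im e') L) = L.
Proof.
move=> adj ee eadj nL; have fe := fgen_im ee.
have e'adj u v : h (e' u) v = h u (e v).
  by rewrite (hermC hh irho) -eadj -(hermC hh irho).
have e'e' v : e' (e' v) = e' v.
  by apply/eqP; rewrite -subr_eq0; apply/eqP; apply: (herm_nondeg hh) => u;
    rewrite (hermDl hh) (hermNl hh) !e'adj ee subrr.
have nd v : im e' v -> (forall u, im e u -> h v u = 0) -> v = 0.
  move=> ev H; apply: (herm_nondeg hh) => u; rewrite -ev e'adj; apply: H; exact: ee.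
have nL' := nlf_dual hh irho cA wrho nw (rmod_im e) (rmod_im e') fe nL nd.
have P t v := dual_lfP hh irho cA nw (im e') t v nL.
have P' t v := dual_lfP hh irho cA nw (im e) t v nL'.
apply/funext => t; apply/seteqP; split=> v; last first.
  move=> Lv; apply/P'; split; first exact: (nlf_sub nL Lv).
  move=> s u /P[_ H]; rewrite addrC; apply: (vge_herm hh irho cA wrho).
  exact: H.
move=> /P'[ev H].
have [n [b ob]] := orth_basis_exists cA (rmod_im e) nL fe.
have [p pS pE] := orth_coord ee nL ob; have [bX bS bL] := ob.
rewrite -ev pS; apply: (nlf_sum nL) => j.
have [g gE] := adj (p j).
have [y hy] : exists y, h (b j) y = 1.
  have [y hy] : exists y, h (b j) y != 0.
    apply: contrapT => K; move/eqP: (bX j).2; apply; apply: (herm_nondeg hh) => u.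
    by apply: contrapT => /eqP hu; apply: K; exists u.
  exists (rscale (h (b j) y)^-1 y); by rewrite (hermZr hh irho) divrr // (cdv_unit cA).
pose u := e' (g y).
have hu x : im e x -> h x u = h (p j x) y by move=> ex; rewrite /u -eadj ex -gE.
have [a aE] := (pE j).1 v.
have nb i := nlf_norm nL (bX i).1 (bX i).2.
have Lu : dual_lf nu h (im e') L (- norm_lf L (b j)) u.
  apply: (dual_bound hh irho cA nw (rmod_im e) nL ob); first exact: e'e'.
  move=> i; apply: (vge_herm hh irho cA wrho); rewrite hu ?(pE j).2; last exact: (bX i).1.
  case: eqP => [->|_]; last by rewrite (herm0l hh); left.
  by rewrite hy addNr; right; rewrite (cdv_1 cA).
have := H _ _ Lu; rewrite hu // aE (hermZl hh irho) hy mulr1 => av.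
have [a0|a0] := eqVneq a 0; first by rewrite a0 rscale0; exact: (nlf0 nL).
have -> : t = norm_lf L (b j) + (t - norm_lf L (b j)) by lra.
apply: (nlf_act_vge (rmod_im e) nL); last exact/nb.
by right; rewrite -(wrho a0); apply: vge_neq0 av; exact: (rho_neq0 irho).
Qed.

End SelfDuality.

(** * Square lattice functions and duality *)

Section NormComparison.
Variables (R : realType) (A : unitRingType) (w : A -> R) (cA : cdv w).
Variables (V : vectType A^c).
Implicit Types (L M : R -> set V) (X : set V).

Lemma orth_basis_split X L n (b : 'I_n -> V) :
  rmod (@rscale A V) X -> nlf w (@rscale A V) X L ->
  orth_basis (@rscale A V) X L b ->
  line_decomposition X (fun i => line (b i)) /\ split_by (fun i => line (b i)) L.
Proof.
move=> mX nL [bX bS bL].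
have indep : independent (fun i => line (b i)).
  move=> x xl s0 i; have [a aE] := choice (fun i => let: ex_intro2 a _ E := xl i in
    ex_intro _ a E : exists a, rscale a (b i) = x i).
  have Xx j : X (x j) by rewrite -aE; apply: (rmod_act mX); exact: (bX j).1.
  apply: (nlf_sep nL) => // t; rewrite -aE; apply: bL.
  under eq_bigr do rewrite aE; rewrite s0; exact: (nlf0 nL).
split; first split.
- by move=> i; exists (b i); split=> //; exact: (bX i).2.
- split=> //; apply/seteqP; split=> x.
    move=> /bS[a ->]; exists (fun i => rscale (a i) (b i)) => // i; by exists (a i).
  move=> [y yl <-]; apply: (rmod_sum mX) => i; have [a _ <-] := yl i.
  by apply: (rmod_act mX); exact: (bX i).1.
- move=> t; split.
    apply/seteqP; split=> x.
      move=> Lx; have [a xE] := bS x (nlf_sub nL Lx).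
      exists (fun i => rscale (a i) (b i)); last by rewrite xE.
      by move=> i; split; [apply: bL; rewrite -xE | exists (a i)].
    by move=> [y yl <-]; apply: (nlf_sum nL) => i; exact: (yl i).1.
  by move=> x xl; apply: indep => i; exact: (xl i).2.
Qed.

(** The decomposition behind [convex_combination] is only known to exist. The two conclusions retain
    what it says about balls, and they can be combined with projections unrelated to it. *)
Lemma convex_combinationP X (th : R) L1 L2 L3 :
  rmod (@rscale A V) X -> nlf w (@rscale A V) X L1 ->
  nlf w (@rscale A V) X L2 -> nlf w (@rscale A V) X L3 ->
  0 <= th <= 1 -> convex_combination X th L1 L2 L3 ->
  (forall r s x, L1 r x -> L2 s x -> L3 ((1 - th) * r + th * s) x) /\
  (forall t x, L3 t x -> exists n (y : 'I_n -> V), x = \sum_i y i /\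
     forall i, exists r s, [/\ L1 r (y i), L2 s (y i) & t <= (1 - th) * r + th * s]).
Proof.
move=> mX n1 n2 n3 /andP[th0 th1] [n [v [[vl [vX vi]] s1 s2 s3 vN]]].
have v0 i : v i != 0.
  have [u [u0 uE]] := vl i; apply: contra_neq u0 => vi0.
  have := line_id u; rewrite -uE => -[a _ <-]; by rewrite vi0 rscaler0.
have Xv i : X (v i).
  rewrite vX; exists (fun j => if j == i then v i else 0).
    by move=> j /=; case: eqP => [->|_]; [exact: line_id | exact: (rmod0 (rmod_line _))].
  by rewrite -big_mkcond big_pred1_eq.
have N1 i := nlf_norm n1 (Xv i) (v0 i).
have N2 i := nlf_norm n2 (Xv i) (v0 i).
have N3 i := nlf_norm n3 (Xv i) (v0 i).
have vav i a : a != 0 -> rscale a (v i) != 0.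
  move=> a0; apply: contra_neq (v0 i).
  exact: (rmod_act_eq0 mX (cdv_unit cA a0) (Xv i)).
have Xav i a : X (rscale a (v i)) := rmod_act mX a (Xv i).
have le L (nL : nlf w (@rscale A V) X L) i a t : a != 0 ->
    L t (rscale a (v i)) <-> t <= norm_lf L (v i) + w a.
  move=> a0; rewrite -(norm_lf_act mX cA nL (Xv i) (v0 i) a0).
  exact: (nlf_norm nL (Xav i a) (vav i a a0)).
split=> [r s x Lr Ls|t x Lt].
  have [E1 _] := s1 r; have [E2 _] := s2 s.
  move: (Lr) (Ls); rewrite E1 E2 => -[y yL yE] [z zL zE].
  have yz i : y i = z i.
    apply/eqP; rewrite -subr_eq0; apply/eqP; apply: (vi (fun j => y j - z j)).
      by move=> j; apply: (rmodB (rmod_line _)); [exact: (yL j).2 | exact: (zL j).2].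
    by rewrite sumrB yE zE subrr.
  rewrite -yE; apply: (nlf_sum n3) => i.
  have [Li [a _ aE]] := yL i; have [Li' _] := zL i; rewrite -yz in Li'.
  have [a0|a0] := eqVneq a 0.
    by rewrite -aE a0 rscale0; exact: (nlf0 n3).
  rewrite -aE; rewrite -aE in Li Li'.
  apply/(le _ n3) => //; rewrite vN.
  move/(le _ n1 _ _ _ a0) : Li => Li; move/(le _ n2 _ _ _ a0) : Li' => Li'.
  have := ler_wpM2l th0 Li'; have th1' : 0 <= 1 - th by lra.
  have := ler_wpM2l th1' Li; lra.
have [E3 _] := s3 t; move: Lt; rewrite E3 => -[y yL <-].
exists n, y; split=> // i; have [Li [a _ aE]] := yL i.
have [a0|a0] := eqVneq a 0.
  rewrite -aE a0 rscale0; exists t, t; split; [exact: (nlf0 n1) | exact: (nlf0 n2) | lra].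
rewrite -aE; rewrite -aE in Li; exists (norm_lf L1 (v i) + w a), (norm_lf L2 (v i) + w a).
split; [exact/(le _ n1) | exact/(le _ n2) |].
by move/(le _ n3 _ _ _ a0): Li; rewrite vN; lra.
Qed.

(** The matrix units [q (j, k)] of an orthogonal basis of [L] lie in its square lattice function at
    level [al (b k) - al (b j)]. Since they also shift [M] by at least that level, for both orders
    of [j] and [k], the difference [be (b j) - al (b j)] does not depend on [j]; the diagonal units
    show that the basis splits [M] too. *)
Lemma square_translation L M : nlf w (@rscale A V) [set: V] L ->
  nlf w (@rscale A V) [set: V] M ->
  (forall t, square_lf L t `<=` square_lf M t) ->
  exists c, forall t v, M t v <-> L (t - c) v.
Proof.
move=> nL nM LM.
have mT := rmod_setT V.
have [n [b ob]] := orth_basis_exists cA mT nL (fgen_vect V); have [bX bS bL] := ob.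
have TE : [set: V] = im (\1 : 'End(V))%VF.
  by apply/esym/seteqP; split=> // v _; rewrite /im /= id_lfunE.
have nb i := nlf_norm nL (bX i).1 (bX i).2.
have mb i := nlf_norm nM (bX i).1 (bX i).2.
have [co [coE coD coZ coB]] : exists co : V -> 'I_n -> A,
    [/\ forall v, v = \sum_i rscale (co v i) (b i),
    forall u v i, co (u + v) i = co u i + co v i,
    forall a v i, co (rscale a v) i = co v i * a
    & forall i j, co (b i) j = if j == i then 1 else 0].
  have ob1 : orth_basis (@rscale A V) (im (\1 : 'End(V))%VF) L b by rewrite -TE.
  have nL1 : nlf w (@rscale A V) (im (\1 : 'End(V))%VF) L by rewrite -TE.
  have [|co [coE ? ? ?]] := orth_coef cA _ nL1 ob1; first by move=> v; rewrite !id_lfunE.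
  by exists co; split=> // v; rewrite -coE id_lfunE.
have [jk|q qE] := @choice _ _ (fun jk (F : 'End(V)) =>
    forall v, F v = rscale (co v jk.1) (b jk.2)).
  apply: linear_lfun => [u v|a v]; first by rewrite coD rscaleDl.
  by rewrite coZ rscaleM.
pose al := norm_lf L; pose be := norm_lf M.
have lea a i t : L t (rscale a (b i)) <-> vge w (t - al (b i)) a.
  split=> [Lt|ta]; last first.
    have -> : t = al (b i) + (t - al (b i)) by lra.
    by apply: (nlf_act_vge mT nL) => //; exact/nb.
  have [->|a0] := eqVneq a 0; first by left.
  right; rewrite lerBlDl -(norm_lf_act mT cA nL (bX i).1 (bX i).2 a0).
  apply/(nlf_norm nL) => //; apply: contra_neq (bX i).2.
  exact: (rmod_act_eq0 mT (cdv_unit cA a0) (bX i).1).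
have mea a i t : M t (rscale a (b i)) <-> vge w (t - be (b i)) a.
  split=> [Mt|ta]; last first.
    have -> : t = be (b i) + (t - be (b i)) by lra.
    by apply: (nlf_act_vge mT nM) => //; exact/mb.
  have [->|a0] := eqVneq a 0; first by left.
  right; rewrite lerBlDl -(norm_lf_act mT cA nM (bX i).1 (bX i).2 a0).
  apply/(nlf_norm nM) => //; apply: contra_neq (bX i).2.
  exact: (rmod_act_eq0 mT (cdv_unit cA a0) (bX i).1).
have Lq j k : square_lf L (al (b k) - al (b j)) (q (j, k)).
  move=> s v Ls; rewrite qE /= lea.
  have : L s (rscale (co v j) (b j)).
    by apply: (bL s (co v)); rewrite -coE.
  by rewrite lea; apply: vge_le; lra.
have le j k : al (b k) - al (b j) + be (b j) <= be (b k).
  have := LM _ _ (Lq j k) (be (b j)) (b j).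
  rewrite qE /= coB eqxx rscale1 => /(_ (proj2 (mb j _) (lexx _))).
  by move/mb; rewrite addrC.
have Mq j t v : M t v -> M t (rscale (co v j) (b j)).
  move=> Mt; have := LM _ _ (Lq j j) t v Mt.
  by rewrite qE subrr addr0.
have [c cE] : exists c, forall j, be (b j) = al (b j) + c.
  case: n {ob nb bX bS bL co coE coD coZ coB q qE lea mea Lq Mq mb} b le => [|n] b le.
    by exists 0; case.
  exists (be (b ord0) - al (b ord0)) => j.
  by apply/eqP; rewrite eq_le; have := le j ord0; have := le ord0 j; lra.
exists c => t v; split=> [Mt|Lt].
  rewrite (coE v); apply: (nlf_sum nL) => j; apply/lea.
  by have /mea := Mq j t v Mt; rewrite cE; apply: vge_le; lra.
rewrite (coE v); apply: (nlf_sum nM) => j; apply/mea.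
have /lea : L (t - c) (rscale (co v j) (b j)) by apply: (bL _ (co v)); rewrite -coE.
by rewrite cE; apply: vge_le; lra.
Qed.

(** [G] is a bare function described on [X] only, so that the statement serves both for an
    automorphism of [V'] and for its image under [psi], which is of this shape only on the
    component. *)
Lemma image_scale X L (e : 'End(V)) (G : V -> V) (z : A) t v :
  rmod (@rscale A V) X -> nlf w (@rscale A V) X L -> z != 0 ->
  (forall v, e (e v) = e v) -> (forall t v, L t v -> L t (e v)) ->
  (forall v, X v -> G v = rscale z (e v) + (v - e v)) -> X v ->
  (exists2 u, L t u & G u = v) <-> L (t + w z) (e v) /\ L t (v - e v).
Proof.
move=> mX nL z0 ee Le GE Xv; have uz := cdv_unit cA z0; split.
  move=> [u Lu <-]; have Xu := nlf_sub nL Lu.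
  have eG : e (G u) = rscale z (e u).
    by rewrite GE // linearD linearB /= lfun_rscale !ee subrr addr0.
  rewrite eG GE // addrAC subrr add0r; split.
    by apply: (nlf_act nL) => //; exact: Le.
  by apply: (nlfB mX cA nL) => //; exact: Le.
move=> [Le1 Le2]; pose u := rscale z^-1 (e v) + (v - e v).
have Lu : L t u.
  apply: (nlfD nL) => //; rewrite -[t](addrK (w z)) -(cdv_V cA z0).
  by apply: (nlf_act nL) => //; exact: cdv_invr_neq0.
have eu : e u = rscale z^-1 (e v).
  by rewrite /u linearD linearB /= lfun_rscale !ee subrr addr0.
exists u => //; rewrite GE; last exact: (nlf_sub nL Lu).
rewrite eu -rscaleM mulVr // rscale1 /u [_ + (v - e v)]addrC addrK addrC subrK //.
Qed.

Lemma line_norm L M u :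
  nlf w (@rscale A V) [set: V] L -> nlf w (@rscale A V) [set: V] M -> u != 0 ->
  exists s, forall t v, line u v -> (M t v <-> L (t - s) v).
Proof.
move=> nL nM u0; exists (norm_lf M u - norm_lf L u) => t _ [a _ <-].
have [->|a0] := eqVneq a 0.
  by rewrite rscale0; split=> _; [exact: (nlf0 nL) | exact: (nlf0 nM)].
have mT := rmod_setT V.
have au0 : rscale a u != 0.
  by apply: contra_neq u0; exact: (rmod_act_eq0 mT (cdv_unit cA a0)).
rewrite (nlf_norm nL I au0) (nlf_norm nM I au0).
rewrite (norm_lf_act mT cA nL) // (norm_lf_act mT cA nM) //.
by split=> ?; lra.
Qed.

End NormComparison.

Section Adjoints.
Variables (A : unitRingType) (V : vectType A^c) (h : V -> V -> A).
Variables (rho : A -> A) (eps : A).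
Hypotheses (hh : hermitian_form h rho eps) (irho : ring_involution rho).
Variable sigma : 'End(V) -> 'End(V).
Hypothesis sigmaP : forall f : 'End(V), adjoint_pair h f (sigma f).

Lemma adjoint_unique (f g g' : 'End(V)) : adjoint_pair h f g -> adjoint_pair h f g' -> g = g'.
Proof.
move=> H H'; apply/lfunP => v; apply/eqP; rewrite -subr_eq0; apply/eqP.
apply: (herm_nondegr hh irho) => u.
by rewrite (hermDr hh) (hermNr hh) -H -H' subrr.
Qed.

Lemma sigmaP' (f : 'End(V)) u v : h u (f v) = h (sigma f u) v.
Proof.
by rewrite (hermC hh irho) sigmaP -(hermC hh irho).
Qed.

Lemma sigma_comp (f g : 'End(V)) : sigma (f \o g)%VF = (sigma g \o sigma f)%VF.
Proof.
apply: (adjoint_unique (sigmaP _)) => u v.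
by rewrite !comp_lfunE !sigmaP.
Qed.

Lemma sigma_add (f g : 'End(V)) : sigma (f + g) = sigma f + sigma g.
Proof.
apply: (adjoint_unique (sigmaP _)) => u v.
by rewrite !add_lfunE (hermDl hh) (hermDr hh) !sigmaP.
Qed.

Lemma sigma0 : sigma 0 = 0.
Proof. by apply: (addrI (sigma 0)); rewrite -sigma_add !addr0. Qed.

Lemma sigma_sum (J : finType) (F : J -> 'End(V)) :
  sigma (\sum_j F j) = \sum_j sigma (F j).
Proof. by apply: (big_morph sigma); [exact: sigma_add | exact: sigma0]. Qed.

Lemma sigmaK (f : 'End(V)) : sigma (sigma f) = f.
Proof. by apply: (adjoint_unique (sigmaP _)) => u v; rewrite -sigmaP'. Qed.

Lemma dual_shift (R : realType) (nu : A -> \bar R) Y L (s t : R) v :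
  dual_lf nu h Y (shift_lf L s) t v <-> dual_lf nu h Y L (t + s) v.
Proof.
split=> -[Yv H]; split=> // r u tr Lu.
  apply: (H (r + s)); first lra.
  by rewrite /shift_lf addrK.
by apply: (H (r - s)) => //; lra.
Qed.

End Adjoints.

(** * Self-dual norms on sums of mutually dual summands *)

Section OrthogonalSum.
Variables (R : realType) (A : unitRingType) (w : A -> R) (cA : cdv w).
Variables (V : vectType A^c) (J : finType) (e : J -> 'End(V)) (Y : set V).
Variables (L : J -> R -> set V) (M : R -> set V).
Hypotheses (eE : forall i j v, e i (e j v) = if i == j then e j v else 0)
  (YE : forall v, Y v <-> \sum_j e j v = v)
  (nL : forall j, nlf w (@rscale A V) (im (e j)) (L j))
  (ME : forall t v, M t v <-> Y v /\ forall j, L j t (e j v)).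

Let Y_sub j v : im (e j) v -> Y v.
Proof.
move=> ev; apply/YE; rewrite -ev (bigD1 j) //= eE eqxx big1 ?addr0 // => i ij.
by rewrite eE (negPf ij).
Qed.

Lemma rmod_orth_sum : rmod (@rscale A V) Y.
Proof.
apply: rmod_rscale => [|u v /YE uE /YE vE|a v /YE vE]; apply/YE.
- by rewrite big1 // => j _; exact: linear0.
- rewrite -{2}uE -{2}vE -big_split; apply: eq_bigr => j _; exact: linearD.
- by rewrite -{2}vE rscale_sumr; apply: eq_bigr => j _; rewrite lfun_rscale.
Qed.
Let mY := rmod_orth_sum.

Lemma nlf_orth_sum : nlf w (@rscale A V) Y M.
Proof.
split.
- by move=> t v /ME[].
- move=> t; apply/ME; split=> [|j]; first exact: (rmod0 mY).
  by rewrite linear0; exact: (nlf0 (nL j)).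
- move=> t u v /ME[Yu Lu] /ME[Yv Lv]; apply/ME; split=> [|j]; first exact: (rmodD mY).
  by rewrite linearD; apply: (nlfD (nL j)).
- move=> t a v a0 /ME[Yv Lv]; apply/ME; split=> [|j]; first exact: (rmod_act mY).
  by rewrite lfun_rscale; apply: (nlf_act (nL j)).
- move=> s t v st /ME[Yv Lv]; apply/ME; split=> // j; exact: (nlf_le (nL j)) (Lv j).
- move=> t v Yv H; apply/ME; split=> // j; apply: (nlf_left (nL j)) => [|s st].
    by rewrite /im /= eE eqxx.
  by have /ME[_] := H s st.
- move=> v Yv; have [j|t tP] := @choice _ _ (fun j t => L j t (e j v)).
    by apply: (nlf_ex (nL j)); rewrite /im /= eE eqxx.
  exists (\big[Order.min/0]_j t j); apply/ME; split=> // j.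
  by apply: (nlf_le (nL j)) (tP j); rewrite (bigD1 j) //= ge_min lexx.
- move=> v /YE vE H; rewrite -vE big1 // => j _; apply: (nlf_sep (nL j)).
    by rewrite /im /= eE eqxx.
  by move=> t; have /ME[_] := H t.
Qed.

Variables (h : V -> V -> A) (rho : A -> A) (eps : A).
Hypotheses (hh : hermitian_form h rho eps) (irho : ring_involution rho).
Variables (nu : A -> \bar R) (c : R) (nw : normalized nu w c).
Variable dl : J -> J.
Hypotheses (eadj : forall j u v, h (e j u) v = h u (e (dl j) v))
  (Ldual : forall j, dual_lf nu h (im (e j)) (L (dl j)) = L j).

(** The summand [j] pairs only with [dl j], so duals are computed summand by summand. This serves
    for $V_i + V_{-i}$, where [dl] exchanges the two, and for $V$ as the orthogonal sum over $I_0
    \cup I_+$, where [dl] is the identity. *)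
Lemma dual_orth_sum : dual_lf nu h Y M = M.
Proof.
have nM := nlf_orth_sum.
apply/funext => t; apply/seteqP; split=> v.
  move=> /(dual_lfP hh irho cA nw _ _ _ nM)[Yv H]; apply/ME; split=> // j.
  rewrite -Ldual; apply/(dual_lfP hh irho cA nw _ _ _ (nL _)); split.
    by rewrite /im /= eE eqxx.
  move=> s z Lz; have ez : e (dl j) z = z := nlf_sub (nL _) Lz.
  rewrite eadj ez; apply: H; apply/ME; split=> [|i]; first exact: (@Y_sub (dl j)).
  rewrite -ez eE; case: eqP => [->|_]; last exact: (nlf0 (nL i)).
  by rewrite ez.
move=> /ME[Yv Lv]; apply/(dual_lfP hh irho cA nw _ _ _ nM); split=> // s z /ME[Yz Lz].
rewrite -(proj1 (YE v) Yv) (herm_suml hh); apply: (vge_sum cA) => j.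
have -> : h (e j v) z = h (e j v) (e (dl j) z) by rewrite -eadj eE eqxx.
have := Lv j; rewrite -{1}Ldual => /(dual_lfP hh irho cA nw _ _ _ (nL _))[_]; apply.
exact: Lz.
Qed.

End OrthogonalSum.

(** * The Broussous-Lemaire map on one factor *)

Section BroussousLemaireMap.
Variables (R : realType) (k : fieldType) (D : falgType k) (d : nat).
Variables (nuD : D -> \bar R) (V : vectType D^c).
Variables (E : fieldExtType k) (iota : E -> 'End(V)) (D' : falgType E).
Variables (nu' : D' -> \bar R) (V' : vectType D'^c) (psi : 'End(V') -> 'End(V)).
Variable jt : (R -> set V') -> (R -> set V).
Variables (wD : D -> R) (w' : D' -> R) (wE : E -> R).
Hypotheses (nD : normalized nuD wD d%:R^-1)
  (n' : normalized nu' w' (unif_value nu'))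
  (nE : normalized (valE nu') wE (unif_value (valE nu'))).
Hypotheses (ioD : forall x y : E, iota (x + y) = iota x + iota y)
  (ioM : forall x y : E, iota (x * y) = (iota x \o iota y)%VF)
  (ioZ : forall (a : k) v, iota (a%:A) v = rscale (a%:A : D) (iota 1 v)).
Hypothesis psiI : centralizer_iso iota psi.
Hypothesis bl : broussous_lemaire d nuD iota nu' psi jt.
Variables (pik : k) (kappa : R).
Hypotheses (pik0 : pik != 0) (w'pik : w' (tower_scalar D' pik) = 1)
  (wDpik : wD (pik%:A) = kappa).

Let cD := nz_cdv nD.
Let c' := nz_cdv n'.
Let X := component iota.
Local Notation bldg := (building_linear nu' (V' := V')).

Lemma io11 v : iota 1 (iota 1 v) = iota 1 v.
Proof. by rewrite -comp_lfunE -ioM mulr1. Qed.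

Lemma component_im : component iota = im (iota 1).
Proof.
apply/seteqP; split=> v; first by move=> [u _ <-]; exact: io11.
by move=> vE; exists v.
Qed.

Lemma psi_eq f : (iota 1 \o psi f \o iota 1 = psi f)%VF /\
  forall x, (psi f \o iota x = iota x \o psi f)%VF.
Proof.
have : range psi (psi f) by exists f.
by rewrite (ci_image psiI).
Qed.

Lemma psi_io f v : psi f (iota 1 v) = psi f v.
Proof. by rewrite -{1}(psi_eq f).1 !comp_lfunE io11 -!comp_lfunE (psi_eq f).1. Qed.

Lemma io_psi f v : iota 1 (psi f v) = psi f v.
Proof. by rewrite -[in LHS](psi_eq f).1 !comp_lfunE io11 -!comp_lfunE (psi_eq f).1. Qed.

Lemma psi_comm f x v : psi f (iota x v) = iota x (psi f v).
Proof. by rewrite -!comp_lfunE (psi_eq f).2. Qed.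

Lemma psiM f g v : psi (f \o g)%VF v = psi f (psi g v).
Proof. by rewrite (ci_mul psiI) comp_lfunE. Qed.

Lemma psi0 : psi 0 = 0.
Proof. by apply: (addrI (psi 0)); rewrite -(ci_add psiI) !addr0. Qed.

Lemma psiN f : psi (- f) = - psi f.
Proof. by apply/eqP; rewrite -addr_eq0 -(ci_add psiI) addNr psi0. Qed.

Lemma psi_sum (J : finType) (F : J -> 'End(V')) : psi (\sum_j F j) = \sum_j psi (F j).
Proof. by apply: (big_morph psi); [exact: (ci_add psiI) | exact: psi0]. Qed.

Lemma psi1 : psi \1%VF = iota 1.
Proof.
by apply: (ci_scalar psiI) => v; rewrite id_lfunE scale1r rscale1.
Qed.

Lemma scalar_End (x : E) : exists f : 'End(V'), forall v, f v = rscale (x%:A : D') v.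
Proof.
apply: linear_lfun => [u v|a v]; first exact: rscaleDr.
by rewrite -!rscaleM; congr rscale; rewrite -scalerAl mul1r -scalerAr mulr1.
Qed.

Lemma psi_scalar (a : k) (f : 'End(V')) :
  (forall v, f v = rscale (tower_scalar D' a) v) ->
  forall v, psi f v = rscale (a%:A : D) (iota 1 v).
Proof. by move=> fE v; rewrite (ci_scalar psiI (x := a%:A)) ?ioZ. Qed.

Lemma rmod_io : rmod (fun x => iota x) X.
Proof.
split.
- by exists 0; rewrite // linear0.
- by move=> _ _ [u _ <-] [v _ <-]; exists (u + v); rewrite // linearD.
- move=> x _ [u _ <-]; exists (iota x u) => //.
  by rewrite -!comp_lfunE -!ioM mulr1 mul1r.
- by move=> x u v; rewrite linearD.
- by move=> x y v; rewrite ioD add_lfunE.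
- by move=> x y v; rewrite -comp_lfunE -ioM mulrC.
- by move=> v [u _ <-]; exact: io11.
Qed.

Lemma rmod_X : rmod (@rscale D V) X.
Proof. rewrite /X component_im; exact: rmod_im. Qed.

Lemma bldg_nlf L : bldg L <-> nlf w' (@rscale D' V') [set: V'] L.
Proof.
split; first exact: (lattice_nlf n' (rmod_setT V')).
exact: (nlf_lattice n' (rmod_setT V') (fgen_vect V')).
Qed.

Lemma jt_nlf L : bldg L -> nlf wD (@rscale D V) X (jt L).
Proof.
move=> bL; have [jtf _ _] := bl_bij bl.
by apply: (lattice_nlf nD rmod_X); have [] := jtf _ bL.
Qed.

Lemma jt_square L t (f : 'End(V')) : bldg L -> square_lf (jt L) t (psi f) <-> square_lf L t f.
Proof. by move=> bldL; have <- := bl_square bl t bldL. Qed.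

Lemma jt_stable L (f : 'End(V')) : bldg L -> (forall t v, L t v -> L t (f v)) ->
  forall t v, jt L t v -> jt L t (psi f v).
Proof.
move=> bL Lf t v Lv; rewrite -[t]addr0; apply: (proj2 (jt_square _ _ bL)) => //.
by move=> s u Lu; rewrite addr0; exact: Lf.
Qed.

Section Shift.
Variables (L : R -> set V') (e : 'End(V')).
Hypotheses (bL : bldg L) (ee : forall v, e (e v) = e v).
Hypothesis Le : forall t v, L t v -> L t (e v).

Definition shift1 (s : R) : R -> set V' := fun t =>
  [set v | L (t - s) (e v) /\ L t (v - e v)].

Let nL : nlf w' (@rscale D' V') [set: V'] L := (bldg_nlf L).1 bL.

Let P := psi e.
Let Lam := jt L.

Let nLam : nlf wD (@rscale D V) X Lam := jt_nlf bL.

Let PP v : P (P v) = P v.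
Proof. by rewrite /P -psiM; congr (psi _ _); apply/lfunP => u; rewrite comp_lfunE. Qed.

Let LP t v : Lam t v -> Lam t (P v).
Proof. exact: jt_stable. Qed.

Lemma shift1_nlf s : nlf w' (@rscale D' V') [set: V'] (shift1 s).
Proof.
split=> //.
- move=> t; have e0 : e 0 = 0 := linear0 _.
  by split; rewrite e0 ?subr0; exact: (nlf0 nL).
- move=> t u v [Lu Lu'] [Lv Lv']; split; rewrite linearD /=.
    exact: (nlfD nL).
  by rewrite opprD addrACA; exact: (nlfD nL).
- move=> t a v a0 [Lv Lv']; split; rewrite lfun_rscale.
    by rewrite addrAC; exact: (nlf_act nL).
  by rewrite -rscalerN -rscaleDr; exact: (nlf_act nL).
- move=> r t v rt [Lv Lv']; split; first by apply: (nlf_le nL) Lv; rewrite lerD2r.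
  exact: (nlf_le nL) Lv'.
- move=> t v _ H; split; apply: (nlf_left nL) => // r rt.
    have rt' : r + s < t by lra.
    by have [] := H _ rt'; rewrite addrK.
  by have [] := H _ rt.
- move=> v _; have [t1 L1] := nlf_ex nL (I : [set: V'] (e v)).
  have [t2 L2] := nlf_ex nL (I : [set: V'] (v - e v)).
  exists (Order.min (t1 + s) t2); split; last by apply: (nlf_le nL) L2; rewrite ge_min lexx orbT.
  by apply: (nlf_le nL) L1; rewrite lerBlDr ge_min lexx.
- move=> v _ H.
  have e0 : e v = 0.
    by apply: (nlf_sep nL) => // t; have [] := H (t + s); rewrite addrK.
  by apply: (nlf_sep nL) => // t; have [_] := H t; rewrite e0 subr0.
Qed.

Lemma shift1_bldg s : bldg (shift1 s).
Proof. exact/bldg_nlf/shift1_nlf. Qed.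

(* shift1 m is the image of L under the element acting on the image of e as a
   power of a uniformizer of k and trivially on the kernel. *)
Lemma jt_shift1_nat (m : int) t v : jt (shift1 m%:~R) t v <->
  [/\ X v, Lam (t - kappa * m%:~R) (P v) & Lam t (v - P v)].
Proof.
have towerX (n : int) : tower_scalar D' (pik ^ n) = tower_scalar D' pik ^ n.
  by rewrite /tower_scalar -!in_algE !fmorphXz.
have t0 : tower_scalar D' pik != 0.
  by rewrite /tower_scalar -!in_algE !fmorph_eq0.
have wt (n : int) : w' (tower_scalar D' (pik ^ n)) = n%:~R.
  by rewrite towerX (cdv_expz c' n t0).2 w'pik mulr1.
have tn0 (n : int) : tower_scalar D' (pik ^ n) != 0.
  by rewrite towerX (cdv_expz c' n t0).1.
have pA0 : pik%:A != 0 :> D by rewrite -in_algE fmorph_eq0.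
have AX (n : int) : (pik ^ n)%:A = pik%:A ^ n :> D by rewrite -!in_algE fmorphXz.
have wA (n : int) : wD ((pik ^ n)%:A) = kappa * n%:~R.
  by rewrite AX (cdv_expz cD n pA0).2 wDpik mulrC.
have An0 (n : int) : (pik ^ n)%:A != 0 :> D by rewrite AX (cdv_expz cD n pA0).1.
pose gg (n : int) u := rscale (tower_scalar D' (pik ^ n)) (e u) + (u - e u).
have gex (n : int) : exists g : 'End(V'), forall u, g u = gg n u.
  have [f fE] := scalar_End ((pik ^ n)%:A).
  exists ((f \o e) + (\1 - e))%VF => u.
  by rewrite !add_lfunE opp_lfunE id_lfunE comp_lfunE fE.
have [g gE] := choice gex.
have gg0 (n p : int) : n + p = 0 -> (g n \o g p = \1)%VF.
  move=> np; apply/lfunP => u; rewrite comp_lfunE id_lfunE !gE /gg.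
  rewrite !linearD !linearN /= !lfun_rscale !ee subrr addr0 -rscaleM.
  have -> : tower_scalar D' (pik ^ p) * tower_scalar D' (pik ^ n) = 1.
    by rewrite !towerX -exprzDr ?(cdv_unit c') // addrC np.
  by rewrite rscale1 opprK addNr addr0 addrAC subrr add0r addrC subrK.
(* The exponent is negative because a vector of the image of [e] lies in the image of the ball at
   $t$ iff its multiple by the $m$-th power of [pik] lies in that ball, that is, iff it lies in the
   ball at $t - m$. *)
pose G := g (- m).
have aG : automorphism G by exists (g m); split; apply: gg0; rewrite ?addNr ?subrr.
have GE : shift1 m%:~R = image_lf G L.
  have GT x : [set: V'] x -> G x = rscale (tower_scalar D' (pik ^ (- m))) (e x) + (x - e x).
    by move=> _; exact: gE.
  apply/funext => r; apply/seteqP; split=> u.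
    move=> [H1 H2].
    apply: (proj2 (image_scale c' r (rmod_setT V') nL (tn0 (- m)) ee Le GT I)).
    by rewrite wt mulrNz.
  move=> Hu; have := proj1 (image_scale c' r (rmod_setT V') nL (tn0 (- m)) ee Le GT I) Hu.
  by rewrite wt mulrNz.
have psiG u : X u -> psi G u = rscale ((pik ^ (- m))%:A : D) (P u) + (u - P u).
  move=> Xu; have [f fE] := scalar_End ((pik ^ (- m))%:A).
  have -> : G = ((f \o e) + (\1 - e))%VF.
    by apply/lfunP => x; rewrite !add_lfunE opp_lfunE id_lfunE comp_lfunE fE gE.
  rewrite (ci_add psiI) (ci_add psiI) psiN psi1 !add_lfunE opp_lfunE psiM.
  rewrite (psi_scalar fE) io_psi; congr (_ + (_ - _)).
  by move: Xu; rewrite /X component_im.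
rewrite GE (bl_equivariant bl) // /image_lf.
have Pf v0 : Lam t v0 -> X v0 := @nlf_sub _ _ _ _ _ _ _ nLam t v0.
split=> [[u Lu uE]|[Xv H1 H2]].
  have Xv : X v.
    have Xu := Pf u Lu; have XP : X (P u) by rewrite /X component_im; exact: io_psi.
    rewrite -uE (psiG u Xu); apply: (rmodD rmod_X); first exact: (rmod_act rmod_X).
    exact: (rmodB rmod_X).
  have [|H1 H2] := (image_scale cD t rmod_X nLam (An0 (- m)) PP LP psiG Xv).1.
    by exists u.
  by split=> //; move: H1; rewrite wA mulrNz mulrN.
apply: (image_scale cD t rmod_X nLam (An0 (- m)) PP LP psiG Xv).2; split=> //.
by rewrite wA mulrNz mulrN.
Qed.

Let im_basis (f : 'End(V')) : (forall v, f (f v) = f v) ->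
  exists n (b : 'I_n -> V'), orth_basis (@rscale D' V') (im f) L b.
Proof.
move=> /fgen_im[n [b ->]].
by have [m [v ob]] := orth_basis_span c' (rmod_setT V') nL (b := b) (fun=> I);
  exists m, v.
Qed.

(** Orthogonal bases of the image and of the kernel of [e] together split every [shift1], and the
    norms of their vectors are affine functions of the shift. *)
Lemma shift1_convex s (m : R) : 0 < m -> convex_combination [set: V']
  ((s + m) / (m + m)) (shift1 (- m)) (shift1 m) (shift1 s).
Proof.
move=> m0; pose f : 'End(V') := (\1 - e)%VF.
have fE u : f u = u - e u by rewrite add_lfunE opp_lfunE id_lfunE.
have ff u : f (f u) = f u by rewrite !fE linearB /= ee subrr subr0.
have [n1 [b1 [b1X b1S b1L]]] := im_basis ee.
have [n2 [b2 [b2X b2S b2L]]] := im_basis ff.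
have eb1 i : e (b1 i) = b1 i := (b1X i).1.
have eb2 i : e (b2 i) = 0.
  by have := (b2X i).1; rewrite /im /= fE => /eqP; rewrite subr_eq addrC -subr_eq subrr eq_sym => /eqP.
pose b (i : 'I_(n1 + n2)) := match fintype.split i with inl j => b1 j | inr j => b2 j end.
have bl1 i : b (lshift n2 i) = b1 i by rewrite /b (unsplitK (inl i)).
have bl2 i : b (rshift n1 i) = b2 i by rewrite /b (unsplitK (inr i)).
have bN0 i : b i != 0.
  by rewrite /b; case: fintype.split => j; [exact: (b1X j).2 | exact: (b2X j).2].
have ob x : orth_basis (@rscale D' V') [set: V'] (shift1 x) b.
  split=> // [u _|t a].
    have [a1 a1E] := b1S _ (ee u); have [a2 a2E] := b2S _ (ff u).
    exists (fun i => match fintype.split i with inl j => a1 j | inr j => a2 j end).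
    rewrite big_split_ord /= -[LHS](addrNK (e u)) -fE [LHS]addrC a1E a2E; congr (_ + _).
      by apply: eq_bigr => i _; rewrite bl1 (unsplitK (inl i)).
    by apply: eq_bigr => i _; rewrite bl2 (unsplitK (inr i)).
  rewrite big_split_ord /=.
  under eq_bigr do rewrite bl1; under [X in _ + X]eq_bigr do rewrite bl2.
  have eS : e (\sum_(i < n1) rscale (a (lshift n2 i)) (b1 i) +
               \sum_(i < n2) rscale (a (rshift n1 i)) (b2 i)) =
            \sum_(i < n1) rscale (a (lshift n2 i)) (b1 i).
    rewrite linearD !linear_sum /= [X in _ + X]big1 ?addr0.
      by apply: eq_bigr => i _; rewrite -[RHS]/(_ _) -{2}eb1 -lfun_rscale.
    by move=> i _; rewrite -[LHS]/(e (rscale _ _)) lfun_rscale eb2 rscaler0.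
  rewrite /shift1 /= eS addrAC subrr add0r => -[/b1L H1 /b2L H2] i.
  rewrite lfun_rscale; case: (splitP i) => j ij.
    have -> : i = lshift n2 j by apply/val_inj.
    by rewrite bl1 eb1 subrr; split; [exact: H1 | exact: (nlf0 nL)].
  have -> : i = rshift n1 j by apply/val_inj.
  by rewrite bl2 eb2 rscaler0 subr0; split; [exact: (nlf0 nL) | exact: H2].
have sp x := orth_basis_split (rmod_setT V') (shift1_nlf x) (ob x).
have nb x i : norm_lf (shift1 x) (b i) = norm_lf L (b i) + (if fintype.split i is inl _ then x else 0).
  have N1 := nlf_norm (shift1_nlf x) (I : [set: V'] (b i)) (bN0 i).
  have N2 := nlf_norm nL (I : [set: V'] (b i)) (bN0 i).
  have H t : shift1 x t (b i) <-> L (t - (if fintype.split i is inl _ then x else 0)) (b i).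
    rewrite /shift1 /= /b; case: fintype.split => j.
      by rewrite eb1 subrr; split=> [[]//|]; split=> //; exact: (nlf0 nL).
    by rewrite eb2 !subr0; split=> [[]//|]; split=> //; exact: (nlf0 nL).
  apply/eqP; rewrite eq_le; apply/andP; split.
    by rewrite -lerBlDr; apply/N2/H/N1.
  by apply/N1/H/N2; rewrite addrK.
exists (n1 + n2)%N, b; split.
- exact: (sp 0).1.
- exact: (sp _).2.
- exact: (sp _).2.
- exact: (sp _).2.
- move=> i; rewrite !nb; set th := (s + m) / (m + m).
  have thE : th * (m + m) = s + m by rewrite divfK //; lra.
  case: fintype.split => _; last by ring.
  have -> : (1 - th) * (norm_lf L (b i) - m) + th * (norm_lf L (b i) + m) =
    norm_lf L (b i) - m + th * (m + m) by ring.
  by rewrite thE; lra.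
Qed.

(* Affinity extends jt_shift1_nat to real s: shift1 s lies on the segment from
   shift1 (- m) to shift1 m for every integer m > |s|. *)
Lemma jt_shift1 s t v : jt (shift1 s) t v <->
  [/\ X v, Lam (t - kappa * s) (P v) & Lam t (v - P v)].
Proof.
have [M MP] : exists M : nat, `|s| < M%:R.
  by exists (Num.truncn `|s|).+1; rewrite truncnS_gt.
pose m : R := M%:R.
have m0 : 0 < m by apply: le_lt_trans MP.
have /andP[sm1 sm2] : - m < s < m by rewrite -ltr_norml.
pose th := (s + m) / (m + m).
have thE : th * (m + m) = s + m by rewrite divfK //; lra.
have th01 : 0 <= th <= 1.
  by rewrite /th divr_ge0 ?ler_pdivrMr; lra.
have cc := bl_affine bl th01 (shift1_bldg _) (shift1_bldg _) (shift1_bldg _)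
  (shift1_convex s m0).
have [G1 G2] := convex_combinationP cD rmod_X (jt_nlf (shift1_bldg _))
  (jt_nlf (shift1_bldg _)) (jt_nlf (shift1_bldg s)) th01 cc.
have Jm r x : jt (shift1 (- m)) r x <-> [/\ X x, Lam (r + kappa * m) (P x) & Lam r (x - P x)].
  have -> : - m = (- M%:Z)%:~R by rewrite mulrNz.
  by rewrite jt_shift1_nat mulrNz mulrN opprK.
have Jp r x : jt (shift1 m) r x <-> [/\ X x, Lam (r - kappa * m) (P x) & Lam r (x - P x)].
  by have := jt_shift1_nat M r x.
have XP x : X (P x) by rewrite /X component_im; exact: io_psi.
split=> [Jv|[Xv H1 H2]].
  have Xv := nlf_sub (jt_nlf (shift1_bldg s)) Jv.
  have [n [y [vE yP]]] := G2 t v Jv.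
  (* With weights $1 - th$ and $th$ the shifts $kappa\, m$ and $-kappa\, m$ average to $-kappa\, s$;
     and a level not exceeding a convex combination of two levels does not exceed one of them. *)
  have Py i : Lam (t - kappa * s) (P (y i)) /\ Lam t (y i - P (y i)).
    have [r [q [/Jm[_ r1 r2] /Jp[_ q1 q2] tE]]] := yP i.
    move: th01 => /andP[th0 th1].
    have max_ge (a b u : R) : u <= (1 - th) * a + th * b -> u <= a \/ u <= b.
      move=> le; have [|lt] := lerP u a; [by left | right].
      by rewrite leNgt; apply/negP => lt'; nra.
    split; last by have [] := max_ge _ _ _ tE => ?; apply: (nlf_le nLam); eauto.
    have rqE : (1 - th) * (r + kappa * m) + th * (q - kappa * m) =
        (1 - th) * r + th * q + kappa * (m - th * (m + m)) by ring.
    rewrite thE in rqE.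
    have : t - kappa * s <= (1 - th) * (r + kappa * m) + th * (q - kappa * m) by rewrite rqE; lra.
    by move=> /max_ge[] ?; apply: (nlf_le nLam); eauto.
  split=> //; rewrite vE linear_sum ?/=.
    by apply: (nlf_sum nLam) => i; exact: (Py i).1.
  by rewrite -sumrB; apply: (nlf_sum nLam) => i; exact: (Py i).2.
rewrite -[v](subrK (P v)) addrC; apply: (nlfD (jt_nlf (shift1_bldg s))).
  have -> : t = (1 - th) * (t - kappa * s - kappa * m) + th * (t - kappa * s + kappa * m).
    have -> : (1 - th) * (t - kappa * s - kappa * m) + th * (t - kappa * s + kappa * m) =
      t - kappa * (s + m) + kappa * (th * (m + m)) by ring.
    by rewrite thE subrK.
  by apply: G1; [apply/Jm | apply/Jp]; split=> //; rewrite ?subrK ?addrK ?PP ?subrr //;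
    exact: (nlf0 nLam).
have -> : t = (1 - th) * t + th * t by ring.
have XvP : X (v - P v) by apply: (rmodB rmod_X).
by apply: G1; [apply/Jm | apply/Jp]; split=> //; rewrite linearB /= PP subrr ?subr0 //;
  exact: (nlf0 nLam).
Qed.

End Shift.

(** The idempotents are handled one at a time by [jt_shift1]; [sr r] performs only the shifts
    indexed by [r]. The intermediate points remain stable under all idempotents, as the next step
    requires. *)
Lemma jt_shift (J : finType) (e : J -> 'End(V')) (s : J -> R) L M :
  idem_family e -> bldg L -> (forall j t v, L t v -> L t (e j v)) -> bldg M ->
  (forall t v, M t v <-> forall j, L (t - s j) (e j v)) ->
  forall t v, jt M t v <-> X v /\ forall j, jt L (t - kappa * s j) (psi (e j) v).
Proof.
move=> ie bL Le bM ME.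
have nL := (bldg_nlf L).1 bL.
pose sr (r : seq J) j := if j \in r then s j else 0.
have pe0 i j v : i != j -> psi (e i) (psi (e j) v) = 0.
  move=> ij; rewrite -psiM; have -> : (e i \o e j)%VF = 0.
    by apply/lfunP => u; rewrite comp_lfunE (idem_neq ie) // zero_lfunE.
  by rewrite psi0 zero_lfunE.
have pee j v : psi (e j) (psi (e j) v) = psi (e j) v.
  by rewrite -psiM; congr (psi _ _); apply/lfunP => u; rewrite comp_lfunE (idem_id ie).
have psum v : \sum_j psi (e j) v = iota 1 v.
  by rewrite -sum_lfunE -psi_sum (idem_End ie) psi1.
have step (r : seq J) : uniq r -> exists M', [/\ bldg M',
    forall t v, M' t v <-> forall j, L (t - sr r j) (e j v)
  & forall t v, jt M' t v <-> X v /\ forall j, jt L (t - kappa * sr r j) (psi (e j) v)].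
  elim: r => [_|j0 r IH /= /andP[j0r /IH[M' [bM' M'E jM'E]]]].
    exists L; split=> // t v.
      split=> [Lv j|Lv]; first by rewrite /sr subr0; exact: Le.
      rewrite -(idem_sum ie v); apply: (nlf_sum nL) => j.
      by have := Lv j; rewrite /sr subr0.
    have nj := jt_nlf bL; split=> [Lv|[Xv Lv]].
      split=> [|j]; first exact: (nlf_sub nj Lv).
      by rewrite /sr mulr0 subr0; apply: jt_stable (Le j) _ _ Lv.
    move: (Xv); rewrite /X component_im => <-; rewrite -psum; apply: (nlf_sum nj) => j.
    by have := Lv j; rewrite /sr mulr0 subr0.
  have sr0 : sr r j0 = 0 by rewrite /sr (negPf j0r).
  have src j : sr (j0 :: r) j = if j == j0 then s j0 else sr r j.
    by rewrite /sr inE; case: eqP => [->|].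
  have M'e t v : M' t v -> M' t (e j0 v).
    move=> /M'E H; apply/M'E => j; rewrite (idem_orth ie); case: eqP => [<-|_] //.
    exact: (nlf0 nL).
  have ej0 v : e j0 (e j0 v) = e j0 v := idem_id ie j0 v.
  exists (shift1 M' (e j0) (s j0)); split.
  - exact: shift1_bldg.
  - move=> t v; rewrite /shift1 /= !M'E; split=> [[H1 H2] j|H].
      rewrite src; case: eqP => [->|/eqP jj0].
        by have := H1 j0; rewrite sr0 subr0 ej0.
      by have := H2 j; rewrite linearB /= (idem_neq ie) // subr0.
    split=> j.
      have [->|jj0] := eqVneq j j0; last by rewrite (idem_neq ie) //; exact: (nlf0 nL).
      by have := H j0; rewrite src eqxx sr0 subr0 ej0.
    have [->|jj0] := eqVneq j j0.
      by rewrite linearB /= ej0 subrr; exact: (nlf0 nL).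
    by have := H j; rewrite src (negPf jj0) linearB /= (idem_neq ie) // subr0.
  - have nj := jt_nlf bL.
    have XP v : X (psi (e j0) v) by rewrite /X component_im; exact: io_psi.
    move=> t v; split=> [/(jt_shift1 bM' ej0 M'e)[Xv /jM'E[_ H1] /jM'E[_ H2]]|[Xv H]].
      split=> // j; rewrite src; case: eqP => [->|/eqP jj0].
        by have := H1 j0; rewrite sr0 mulr0 subr0 pee.
      by have := H2 j; rewrite linearB /= pe0 // subr0.
    apply/(jt_shift1 bM' ej0 M'e); split=> //; apply/jM'E.
      split=> // j; have [->|jj0] := eqVneq j j0; last by rewrite pe0 //; exact: (nlf0 nj).
      by have := H j0; rewrite src eqxx sr0 mulr0 subr0 pee.
    split=> [|j]; first exact: (rmodB rmod_X).
    have [->|jj0] := eqVneq j j0.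
      by rewrite linearB /= pee subrr; exact: (nlf0 nj).
    by have := H j; rewrite src (negPf jj0) linearB /= pe0 // subr0.
have [M' [bM' M'E jM'E]] := step (enum J) (enum_uniq J).
have srE : sr (enum J) =1 s by move=> j; rewrite /sr mem_enum.
have -> : M = M'.
  apply/funext => t; apply/seteqP; split=> v; rewrite ME M'E => H j.
    by rewrite srE.
  by rewrite -srE.
by move=> t v; rewrite jM'E; split=> -[Xv H]; split=> // j; have := H j; rewrite srE.
Qed.

Lemma jt_translate L M c : bldg L -> bldg M ->
  (forall t v, M t v <-> L (t - c) v) ->
  forall t v, jt M t v <-> jt L (t - kappa * c) v.
Proof.
move=> bL bM ME t v.
pose e (_ : unit) : 'End(V') := \1%VF.
have ie : idem_family e.
  split=> [[] [] u|u]; first by rewrite eqxx /e !id_lfunE.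
  by rewrite (bigD1 tt) //= big1 ?addr0 ?id_lfunE //; case.
have Le1 (j : unit) r u : L r u -> L r (e j u) by rewrite /e id_lfunE.
have ME1 r u : M r u <-> forall j, L (r - c) (e j u).
  by rewrite ME; split=> [Lu j|H]; [|have := H tt]; rewrite /e id_lfunE.
have [H1 H2] := @jt_shift _ e (fun=> c) L M ie bL Le1 bM ME1 t v.
have nj := jt_nlf bL.
split=> [/H1[Xv /(_ tt)]|Lv].
  by rewrite psi1; move: Xv; rewrite /X component_im => ->.
have Xv := nlf_sub nj Lv; apply: H2; split=> // j; rewrite -[e j]/(\1)%VF psi1.
by move: Xv; rewrite /X component_im => ->.
Qed.

Section SelfDual.
Variables (h : V -> V -> D) (rho : D -> D) (eps : D).
Hypotheses (hh : hermitian_form h rho eps) (irho : ring_involution rho).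
Hypotheses (D2 : (2%:R : D) != 0) (wD2 : wD 2%:R = 0).
Variable sigma : 'End(V) -> 'End(V).
Hypothesis sigmaP : forall f : 'End(V), adjoint_pair h f (sigma f).
Variable sE : E -> E.
Hypotheses (sio : forall x, sigma (iota x) = iota (sE x)) (isE : ring_involution sE).
Hypotheses (E2 : (2%:R : E) != 0) (wE2 : wE 2%:R = 0).
Let wrho := involution_val cD D2 wD2 irho.

(** [sigma] maps the image of [E] onto itself, hence it maps the centralizer of [E] to itself. *)
Lemma psi_adjoint f : exists g, psi g = sigma (psi f).
Proof.
suff : range psi (sigma (psi f)) by move=> [g _ <-]; exists g.
rewrite (ci_image psiI); split.
  have s1 : sigma (iota 1) = iota 1 by rewrite sio (invol_one isE).
  rewrite -{1 2}s1 -!(sigma_comp hh irho sigmaP); congr sigma.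
  by apply/lfunP => v; rewrite !comp_lfunE psi_io io_psi.
move=> x; rewrite -(invol_invol isE x) -sio -!(sigma_comp hh irho sigmaP); congr sigma.
by apply/lfunP => v; rewrite !comp_lfunE psi_comm.
Qed.

Lemma component_nondeg v : X v -> (forall u, X u -> h v u = 0) -> v = 0.
Proof.
move=> Xv H; apply: (herm_nondeg hh) => u.
move: (Xv); rewrite {1}/X component_im => <-.
rewrite sigmaP sio (invol_one isE); apply: H.
by rewrite /X component_im; exact: io11.
Qed.

(** To use surjectivity of [jt], the dual must also be a lattice function over $o_E$. This holds
    since the adjoint of [iota x] is [iota (sE x)] and the involution [sE] preserves the valuation
    of [E]. *)
Lemma jt_dual L : bldg L ->
  exists2 M, bldg M & jt M = dual_lf nuD h X (jt L).
Proof.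
move=> bL; have [jtf _ jts] := bl_bij bl; have nj := jt_nlf bL.
suff /jts[M bM <-] : lattice_functions_DE d nuD iota nu' (dual_lf nuD h X (jt L)).
  by exists M.
have fX : fgen (@rscale D V) X by rewrite /X component_im; apply: fgen_im; exact: io11.
have nd := nlf_dual hh irho cD wrho nD rmod_X rmod_X fX nj component_nondeg.
split; first exact: (nlf_lattice nD rmod_X fX nd).
have [_ lE] := jtf _ bL.
apply: (nlf_lattice nE rmod_io).
  by have [n [b [_ XE]]] := latf_lattice lE 0; exists n, b.
have njE := lattice_nlf nE rmod_io lE.
case: nd => *; split=> //.
move=> t x v x0 /(dual_lfP hh irho cD nD _ _ _ nj)[Xv H].
apply/(dual_lfP hh irho cD nD _ _ _ nj); split; first exact: (rmod_act rmod_io).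
move=> s u Lu; rewrite sigmaP sio -addrA [wE x + s]addrC; apply: H.
have sx0 : sE x != 0.
  by apply: contra_neq x0 => sx; rewrite -(invol_invol isE x) sx (rho0 isE).
rewrite -(involution_val (nz_cdv nE) E2 wE2 isE x0); exact: (nlf_act njE).
Qed.

Variables (h' : V' -> V' -> D') (rho' : D' -> D') (eps' : D').
Hypotheses (hh' : hermitian_form h' rho' eps') (irho' : ring_involution rho').
Hypotheses (D'2 : (2%:R : D') != 0) (w'2 : w' 2%:R = 0).
Hypothesis sigma'P : forall f g, psi g = sigma (psi f) -> adjoint_pair h' f g.
Let wrho' := involution_val c' D'2 w'2 irho'.

(* The dual of jt L is jt M for some M.  Adjunction exchanges the square lattice functions
   of a lattice function and of its dual, so those of M and L agree: M is a translate of L. *)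
Lemma jt_selfdual_shift L : bldg L -> dual_lf nu' h' [set: V'] L = L ->
  exists s, dual_lf nuD h X (shift_lf (jt L) s) = shift_lf (jt L) s.
Proof.
move=> bL Ld; have nL := (bldg_nlf L).1 bL; have nj := jt_nlf bL.
have [M bM jM] := jt_dual bL.
have sv := selfdual_vge hh' irho' c' n' nL Ld.
have [t f Lf|c cE] := square_translation c' nL ((bldg_nlf M).1 bM).
  have [g gE] := psi_adjoint f; have fg := sigma'P gE.
  have Lg : square_lf L t g.
    move=> s v Lv; rewrite -Ld; apply/(dual_lfP hh' irho' c' n' _ _ _ nL); split=> // r u Lu.
    apply: (vge_herm hh' irho' c' wrho'); rewrite -fg.
    have -> : s + t + r = (r + t) + s by lra.
    by apply: sv => //; exact: Lf.
  apply: (proj1 (jt_square t f bM)); rewrite jM => s v /(dual_lfP hh irho cD nD _ _ _ nj)[Xv H].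
  apply/(dual_lfP hh irho cD nD _ _ _ nj); split.
    by rewrite /X component_im; exact: io_psi.
  move=> r u Lu; rewrite sigmaP -gE -addrA [t + r]addrC; apply: H.
  exact: (proj2 (jt_square t g bL) Lg).
have jt_c := jt_translate bL bM cE; rewrite jM in jt_c.
(* The dual of the shift of [jt L] by $s$ is its shift by $kappa\, c - s$; the two agree for this
   $s$. *)
exists (kappa * c / 2); apply/funext => t; apply/seteqP; split=> v.
  by move=> /dual_shift/jt_c; rewrite /shift_lf; apply: (nlf_le nj); lra.
by move=> Lv; apply/dual_shift/jt_c; apply: (nlf_le nj) Lv; lra.
Qed.

End SelfDual.

End BroussousLemaireMap.

(** * Split tori *)

Section SplitTori.
Variables (k : fieldType) (D : falgType k) (V : vectType D^c) (k0 : set k).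
Local Notation cs a v := (rscale (a%:A : D) v).
Hypotheses (k01 : k0 1) (k0M : forall a b, k0 a -> k0 b -> k0 (a * b)).
Hypothesis k0V : forall a, k0 a -> k0 a^-1.
Variable tau : k.
Hypotheses (k0tau : k0 tau) (tau0 : tau != 0).
Hypothesis tau_free : forall n : int, tau ^ n = 1 -> n = 0.

Lemma cscaleM a b (v : V) : cs (a * b) v = cs a (cs b v).
Proof. by rewrite -rscaleM mulr_algl scalerA mulrC. Qed.

Lemma cscaleB a b (v : V) : cs (a - b) v = cs a v - cs b v.
Proof. by rewrite scalerBl rscaleDl rscaleN. Qed.

Lemma cscale_eq0 a (v : V) : a != 0 -> cs a v = 0 -> v = 0.
Proof.
move=> a0 E0; rewrite -[v](rscale1 (A := D)) -(scale1r (1 : D)) -(mulVf a0).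
by rewrite cscaleM E0 rscaler0.
Qed.

Definition torus_char (N : finType) (t : N -> k) (w : N -> int) : k := \prod_i t i ^ w i.

Section Characters.
Variable N : finType.
Implicit Types (s t : N -> k) (w : N -> int).

Lemma torus_charM s t w :
  torus_char (fun i => s i * t i) w = torus_char s w * torus_char t w.
Proof. by rewrite -big_split; apply: eq_bigr => i _; rewrite expfzMl. Qed.

Lemma torus_char_neq0 t w : (forall i, t i != 0) -> torus_char t w != 0.
Proof. by move=> t0; apply/prodf_neq0 => i _; apply: expfz_neq0. Qed.

Lemma torus_char_fixed t w : (forall i, k0 (t i)) -> k0 (torus_char t w).
Proof.
have k0X a (n : nat) : k0 a -> k0 (a ^+ n).
  by move=> ka; elim: n => [|n IH]; rewrite ?exprS //; apply: k0M.
move=> kt; apply: big_ind => // i _; case: (w i) => n; first exact: k0X.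
by apply: k0V; exact: k0X.
Qed.

Definition torus_delta (i : N) : N -> k := fun j => if j == i then tau else 1.

Lemma torus_delta_point i j : torus_delta i j != 0 /\ k0 (torus_delta i j).
Proof. by rewrite /torus_delta; case: ifP => _; split=> //; exact: oner_neq0. Qed.

Lemma torus_char_delta i w : torus_char (torus_delta i) w = tau ^ w i.
Proof.
rewrite /torus_char (bigD1 i) //= /torus_delta eqxx big1 ?mulr1 // => j ji.
by rewrite (negPf ji) exp1rz.
Qed.

Lemma torus_char0 t w : (forall i, w i = 0) -> torus_char t w = 1.
Proof. by move=> w0; rewrite /torus_char big1 // => i _; rewrite w0 expr0z. Qed.

End Characters.

Lemma torus_char_inj (N : finType) (w w' : N -> int) :
  (forall t, (forall i, t i != 0 /\ k0 (t i)) -> torus_char t w = torus_char t w') ->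
  w = w'.
Proof.
move=> H; apply/funext => i; have := H _ (torus_delta_point i).
rewrite !torus_char_delta => E1; apply/eqP; rewrite -subr_eq0; apply/eqP/tau_free.
by rewrite expfzDr // E1 -expfzDr // subrr expr0z.
Qed.

(** Artin's argument with coefficients in [V]: each [q] other than [p] has a point [T q] separating
    its character from that of [p]. Translating the relation by [T q] and subtracting the value of
    the [q]-th character there kills the [q]-th term and keeps the [p]-th one. *)
Lemma torus_char_indep n r (w : 'I_r -> 'I_n -> int) (c : 'I_r -> V) : injective w ->
  (forall t, torus_points k0 t -> \sum_p cs (torus_char t (w p)) (c p) = 0) ->
  forall p, c p = 0.
Proof.
move=> winj c0 p.
have [q|T TP] := @choice _ _ (fun q t => torus_points k0 t /\
    (q != p -> torus_char t (w q) != torus_char t (w p))).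
  have [->|qp] := eqVneq q p; last first.
    apply: contrapT => nT; move/eqP: qp; apply; apply: winj; apply: torus_char_inj => t tP.
    by apply/eqP; apply: contraT => ne; case: nT; exists t.
  by exists (fun=> 1); split=> [i|]; [split=> //; exact: oner_neq0 | rewrite eqxx].
have main (s : seq 'I_r) : forall t, torus_points k0 t -> \sum_q
    cs ((\prod_(j <- s) (torus_char (T j) (w q) - torus_char (T j) (w j))) *
        torus_char t (w q)) (c q) = 0.
  elim: s => [|j s IH] t tP.
    by rewrite -[RHS](c0 t tP); apply: eq_bigr => q _; rewrite big_nil mul1r.
  have tj : torus_points k0 (fun i => T j i * t i).
    move=> i; have [T1 T2] := (TP j).1 i; have [t1 t2] := tP i.
    by split; [rewrite mulf_neq0 | exact: k0M].
  have E1 := IH _ tj; have E2 := IH t tP.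
  transitivity ((0 : V) - cs (torus_char (T j) (w j)) 0); last by rewrite rscaler0 subrr.
  rewrite -[X in X - _]E1 -[X in _ - cs _ X]E2 rscale_sumr -sumrB.
  apply: eq_bigr => q _; rewrite -cscaleM -cscaleB big_cons torus_charM; congr rscale.
  by congr (_ *: _); ring.
have := main [seq q <- enum 'I_r | q != p] (fun=> 1).
have one_pt : torus_points k0 (fun _ : 'I_n => 1 : k) by move=> i; split=> //; exact: oner_neq0.
move/(_ one_pt); rewrite (bigD1 p) //= [X in _ + X]big1 ?addr0 => [|q qp].
  apply: cscale_eq0; rewrite mulf_neq0 ?torus_char_neq0 //; last by move=> i; exact: oner_neq0.
  rewrite prodf_seq_neq0; apply/allP => q; rewrite mem_filter => /andP[qp _] /=.
  by rewrite subr_eq0 eq_sym (TP q).2.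
rewrite (big_rem q) /= ?subrr ?mul0r ?scale0r ?rscale0 //.
by rewrite mem_filter qp mem_enum.
Qed.

(** [tw_comm] expresses that the weight projections inherit the symmetries of [S]; with it they
    commute with [beta], or with a subtorus, whenever [S] does. *)
Record torus_weights (S : set 'End(V)) n r (w : 'I_r -> 'I_n -> int)
    (e : 'I_r -> 'End(V)) : Prop := {
  tw_inj : injective w;
  tw_neq0 : forall p, e p != 0;
  tw_idem : idem_family e;
  tw_torus : S = [set g | exists2 t, torus_points k0 t &
     forall v, g v = \sum_p cs (torus_char t (w p)) (e p v)];
  tw_comm : forall f : 'End(V), (forall g v, S g -> f (g v) = g (f v)) ->
     forall p v, f (e p v) = e p (f v) }.

Lemma split_torus_weights G S : split_torus k0 G S ->
  S `<=` G /\ exists n r (w : 'I_r -> 'I_n -> int) e, torus_weights S w e.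
Proof.
move=> [n [r [w [e [[winj e0] _ [L1 LM] SE SG]]]]]; split=> //; exists n, r, w, e.
have LE t v : laurent w e t v = \sum_p cs (torus_char t (w p)) (e p v) by [].
have Lev p s v : torus_points k0 s ->
    e p (laurent w e s v) = cs (torus_char s (w p)) (e p v).
  move=> sP; apply/eqP; rewrite -subr_eq0; apply/eqP; move: p.
  apply: (@torus_char_indep _ _ w (fun p => e p (laurent w e s v) - cs (torus_char s (w p)) (e p v))) => // t tP.
  have := LM t s v tP sP; rewrite !LE => /esym/eqP; rewrite -subr_eq0 -sumrB => /eqP E0; rewrite -[RHS]E0.
  apply: eq_bigr => p _; rewrite rscaleDr rscalerN; congr (_ - _).
  by rewrite -cscaleM -torus_charM.
have eo p q v : e p (e q v) = if p == q then e q v else 0.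
  apply/eqP; rewrite -subr_eq0; apply/eqP; move: q.
  apply: (@torus_char_indep _ _ w (fun q => e p (e q v) - if p == q then e q v else 0)) => // t tP.
  have /eqP := Lev p t v tP; rewrite -subr_eq0 => /eqP E0.
  rewrite -[RHS]E0 LE linear_sum.
  have -> : cs (torus_char t (w p)) (e p v) =
      \sum_q cs (torus_char t (w q)) (if p == q then e q v else 0).
    rewrite (bigD1 p) //= eqxx big1 ?addr0 // => q qp.
    by rewrite eq_sym (negPf qp) rscaler0.
  rewrite -sumrB; apply: eq_bigr => q _; rewrite rscaleDr rscalerN.
  by congr (_ - _); rewrite -[RHS]/(e p _) lfun_rscale.
split=> //.
- split=> // v; rewrite -[RHS]L1 LE; apply: eq_bigr => p _.
  rewrite [torus_char _ _]big1 ?scale1r ?rscale1 // => i _; exact: exp1rz.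
- move=> f fS p v; apply/eqP; rewrite -subr_eq0; apply/eqP; move: p.
  apply: (@torus_char_indep _ _ w (fun p => f (e p v) - e p (f v))) => // t tP.
  have [g gE] : exists g : 'End(V), forall v, g v = laurent w e t v.
    apply: linear_lfun => [x y|a x]; rewrite !LE.
      by rewrite -big_split; apply: eq_bigr => q _; rewrite linearD rscaleDr.
    rewrite rscale_sumr; apply: eq_bigr => q _; rewrite lfun_rscale -!rscaleM.
    by rewrite mulr_algl mulr_algr.
  have Sg : S g by rewrite SE; exists t.
  have /eqP := fS g v Sg; rewrite !gE !LE linear_sum -subr_eq0 -sumrB => /eqP E0.
  rewrite -[RHS]E0; apply: eq_bigr => q _.
  by rewrite rscaleDr rscalerN; congr (_ - _); rewrite -[RHS]/(f _) lfun_rscale.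
Qed.

Lemma tw_e S n r (w : 'I_r -> 'I_n -> int) e : torus_weights S w e ->
  forall t g, (forall v, g v = \sum_p cs (torus_char t (w p)) (e p v)) ->
  forall p v, g (e p v) = cs (torus_char t (w p)) (e p v).
Proof.
move=> tw t g gE p v; rewrite gE (bigD1 p) //= (idem_id (tw_idem tw)) big1 ?addr0 // => q qp.
by rewrite (idem_neq (tw_idem tw)) // rscaler0.
Qed.

Lemma tw_abelian S n r (w : 'I_r -> 'I_n -> int) e : torus_weights S w e ->
  forall f g v, S f -> S g -> f (g v) = g (f v).
Proof.
move=> tw f g v; rewrite (tw_torus tw) => -[s sP fE] [t tP gE].
rewrite (gE v) (fE v) !linear_sum; apply: eq_bigr => p _ /=.
rewrite -[LHS]/(f _) -[RHS]/(g _) !lfun_rscale (tw_e tw fE) (tw_e tw gE) -!cscaleM.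
by rewrite mulrC.
Qed.

(** The index types are arbitrary, so that coordinates can be orbits of an involution and weights
    can be indexed by an option type. It suffices that the weights generate the coordinate
    vectors. *)
Lemma split_torus_of_weights (N P : finType) (w : P -> N -> int) (e : P -> 'End(V)) G S :
  injective w -> (forall p, e p != 0) ->
  (forall i, exists c : P -> int, forall j, \sum_p c p * w p j = (i == j)%:R) ->
  idem_family e ->
  S = [set g : 'End(V) | exists2 t : N -> k, (forall i, t i != 0 /\ k0 (t i)) &
     forall v, g v = \sum_p cs (torus_char t (w p)) (e p v)] ->
  S `<=` G -> split_torus k0 G S.
Proof.
move=> winj e0 gen ie SE SG.
pose w1 (p : 'I_#|P|) (i : 'I_#|N|) := w (enum_val p) (enum_val i).
pose e1 (p : 'I_#|P|) := e (enum_val p).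
have reP (M : zmodType) (F : P -> M) : \sum_(p : 'I_#|P|) F (enum_val p) = \sum_p F p.
  by rewrite [RHS](reindex _ (onW_bij _ (enum_val_bij P))).
have chE (t : N -> k) p : \prod_i t (enum_val i) ^ w1 p i = torus_char t (w (enum_val p)).
  by rewrite /torus_char [RHS](reindex _ (onW_bij _ (enum_val_bij N))).
have LE (t : N -> k) v : laurent w1 e1 (fun i => t (enum_val i)) v =
    \sum_p cs (torus_char t (w p)) (e p v).
  by rewrite /laurent -[RHS]reP; apply: eq_bigr => p _; rewrite chE.
have tE (t : 'I_#|N| -> k) : t = fun i => t (enum_rank (enum_val i)).
  by apply/funext => i; rewrite enum_valK.
exists #|N|, #|P|, w1, e1; split.
- split=> [p q E1|p]; last exact: e0.
  apply/enum_val_inj/winj/funext => i; have := congr1 (@^~ (enum_rank i)) E1.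
  by rewrite /w1 enum_rankK.
- move=> a; have [c cE] := choice gen.
  exists (fun p => \sum_i a (enum_rank i) * c i (enum_val p)) => i.
  rewrite (reP _ (fun p => (\sum_i a (enum_rank i) * c i p) * w p (enum_val i))).
  under eq_bigr do rewrite mulr_suml.
  rewrite exchange_big (bigD1 (enum_val i)) //= [X in _ + X]big1 ?addr0 => [|j ji].
    under eq_bigr do rewrite -mulrA.
    by rewrite -mulr_sumr cE eqxx mulr1 enum_valK.
  under eq_bigr do rewrite -mulrA.
  by rewrite -mulr_sumr cE (negPf ji) mulr0.
- split=> [v|s t v _ _].
    rewrite (LE (fun=> 1)) -[RHS](idem_sum ie); apply: eq_bigr => p _.
    by rewrite [torus_char _ _]big1 ?scale1r ?rscale1 // => i _; exact: exp1rz.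
  rewrite (tE s) (tE t) (LE (fun i => s (enum_rank i) * t (enum_rank i))).
  rewrite (LE (fun i => t (enum_rank i))) (LE (fun i => s (enum_rank i))).
  apply: eq_bigr => p _; rewrite linear_sum (bigD1 p) //= [X in _ + X]big1 ?addr0 => [|q qp].
    by rewrite lfun_rscale (idem_id ie) -cscaleM torus_charM.
  by rewrite lfun_rscale (idem_neq ie) ?rscaler0 // eq_sym.
- rewrite SE; apply/seteqP; split=> g [t tP gE].
    exists (fun i => t (enum_val i)); first by move=> i; exact: tP.
    by move=> v; rewrite gE LE.
  exists (fun i => t (enum_rank i)); first by move=> i; exact: tP.
  by move=> v; rewrite -LE gE {1}(tE t).
- exact: SG.
Qed.

End SplitTori.

(** * Split tori in unitary groups *)

Section UnitaryTori.
Variables (R : realType) (k : fieldType) (D : falgType k) (wD : D -> R) (cD : cdv wD).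
Variables (V : vectType D^c) (h : V -> V -> D) (rho : D -> D) (eps : D).
Hypotheses (hh : hermitian_form h rho eps) (irho : ring_involution rho).
Variable sigma : 'End(V) -> 'End(V).
Hypothesis sigmaP : forall f : 'End(V), adjoint_pair h f (sigma f).
Local Notation cs a v := (rscale (a%:A : D) v).
Local Notation k0 := (fixed_field rho).
Variable tau : k.
Hypotheses (k0tau : k0 tau) (tau0 : tau != 0).
Hypothesis tau_free : forall n : int, tau ^ n = 1 -> n = 0.

Lemma fixed_field1 : k0 1.
Proof. by rewrite /fixed_field /= scale1r (invol_one irho). Qed.

Let algM (a b : k) : (a * b)%:A = a%:A * b%:A :> D.
Proof. by rewrite mulr_algl scalerA. Qed.

Let algC (a : k) (x : D) : a%:A * x = x * a%:A.
Proof. by rewrite mulr_algl mulr_algr. Qed.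

Let alg1 (a : k) : a%:A = 1 :> D -> a = 1.
Proof.
move=> E1; apply/eqP; rewrite -subr_eq0 -(fmorph_eq0 (in_alg D)).
by rewrite /= scalerBl E1 scale1r subrr.
Qed.

Lemma fixed_fieldM a b : k0 a -> k0 b -> k0 (a * b).
Proof. by rewrite /fixed_field /= => ka kb; rewrite algM (invol_mul irho) ka kb algC. Qed.

Lemma fixed_fieldV a : k0 a -> k0 a^-1.
Proof.
rewrite /fixed_field /= => ka; have [->|a0] := eqVneq a 0; first by rewrite invr0 scale0r (rho0 irho).
have E1 : rho a^-1%:A * a%:A = 1.
  by rewrite -[X in _ * X]ka -(invol_mul irho) -algM mulfV // scale1r (invol_one irho).
transitivity (rho a^-1%:A * (a%:A * a^-1%:A)); last by rewrite mulrA E1 mul1r.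
by rewrite -algM mulfV // scale1r mulr1.
Qed.

Lemma herm_fixed a b u v : k0 a -> h (cs a u) (cs b v) = (a * b)%:A * h u v.
Proof.
by move=> ka; rewrite (hermZl hh irho) (hermZr hh irho) ka -algC mulrA -algM.
Qed.

Lemma unitaryP (g : 'End(V)) : unitary_group sigma g <-> forall u v, h (g u) (g v) = h u v.
Proof.
split=> [gU u v|gU].
  by rewrite sigmaP -comp_lfunE gU id_lfunE.
apply/lfunP => v; rewrite id_lfunE; apply/eqP; rewrite -subr_eq0; apply/eqP.
apply: (herm_nondegr hh irho) => u.
by rewrite (hermDr hh) (hermNr hh) comp_lfunE -sigmaP gU subrr.
Qed.

(** An isometry in [S] multiplies a pairing of weight vectors by the product of the two characters.
    At the point with [tau] in coordinate [i] and 1 elsewhere this product is a power of [tau],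
    which has infinite order. *)
Lemma weight_dual S n r (w : 'I_r -> 'I_n -> int) e : torus_weights k0 S w e ->
  S `<=` unitary_group sigma ->
  forall p q u v, h (e p u) (e q v) != 0 -> forall i, w q i = - w p i.
Proof.
move=> tw SU p q u v hne i; pose t := torus_delta tau i.
have tP j : t j != 0 /\ k0 (t j) by exact: (torus_delta_point fixed_field1 k0tau tau0).
have [g gE] : exists g : 'End(V), forall v, g v = \sum_p cs (torus_char t (w p)) (e p v).
  apply: linear_lfun => [x y|a x].
    by rewrite -big_split; apply: eq_bigr => j _; rewrite linearD rscaleDr.
  rewrite rscale_sumr; apply: eq_bigr => j _; rewrite lfun_rscale -!rscaleM.
  by rewrite mulr_algl mulr_algr.
have Sg : S g by rewrite (tw_torus tw); exists t.
have /unitaryP gU := SU _ Sg.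
have := gU (e p u) (e q v); rewrite !(tw_e tw gE) herm_fixed; last first.
  by apply: (torus_char_fixed fixed_field1 fixed_fieldM fixed_fieldV) => j; case: (tP j).
rewrite !torus_char_delta -expfzDr // => E1.
have E2 : (tau ^ (w p i + w q i))%:A = 1 :> D.
  by apply: (mulIr (cdv_unit cD hne)); rewrite E1 mul1r.
by move: (tau_free (alg1 E2)) => /eqP; rewrite addrC addr_eq0 => /eqP.
Qed.

Section OrthogonalTorus.
Variables (K : finType) (f : option K -> 'End(V)) (st : K -> K).
Hypotheses (idf : idem_family f) (stK : involutive st) (stN : forall q, st q != q).
Hypotheses (f0 : forall q, f (Some q) != 0) (fs : forall o, sigma (f o) = f (omap st o)).

(** The common form of the torus of a Witt decomposition, where the images are lines, and of a torus
    of the centralizer, where they are the larger spaces of the grading. *)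
Definition orth_torus : set 'End(V) := [set g | unitary_group sigma g /\
  (forall q, exists2 a, k0 a & forall v, g (f (Some q) v) = cs a (f (Some q) v)) /\
  forall v, g (f None v) = f None v].

(* one of the two elements of each orbit of [st] *)
Let rep q := (enum_rank q < enum_rank (st q))%N.

Let rep_st q : ~~ rep q -> rep (st q).
Proof.
rewrite /rep stK -leqNgt leq_eqVlt => /orP[/eqP/val_inj/enum_rank_inj E1|//].
by have := stN q; rewrite E1 eqxx.
Qed.

Let rep_neq q q' : rep q -> rep q' -> st q != q'.
Proof.
move=> rq rq'; apply/eqP => E1; move: rq'; rewrite -E1 /rep stK ltnNge.
by rewrite (ltnW rq).
Qed.

Let N := {q : K | rep q}.
Let wt (o : option K) (i : N) : int :=
  if o is Some q then (q == val i)%:Z - (st q == val i)%:Z else 0.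

Let wt_st q i : wt (Some (st q)) i = - wt (Some q) i.
Proof. by rewrite /= stK opprB. Qed.

Let wt_rep (i j : N) : wt (Some (val i)) j = (i == j)%:R.
Proof.
rewrite /= (negPf (rep_neq (valP i) (valP j))) subr0 val_eqE.
by case: (i == j).
Qed.

Let wt_inj q o : wt (Some q) = wt o -> o = Some q.
Proof.
move=> E1; have [rq|nq] := boolP (rep q).
  pose i : N := Sub q rq; have := congr1 (@^~ i) E1.
  rewrite [LHS](wt_rep i i) eqxx; case: o {E1} => //= q' /eqP.
  have [->|_] := eqVneq q' q; first by [].
  by case: (st q' == q).
pose i : N := Sub (st q) (rep_st nq); have := congr1 (@^~ i) E1.
rewrite -[q in LHS]stK wt_st [X in - X](wt_rep i i) eqxx.
case: o {E1} => //= q' /eqP; have [E2|_] := eqVneq (st q') (st q).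
  by move=> _; rewrite (can_inj stK E2).
by case: (q' == st q).
Qed.

Let coef (t : N -> k) o := torus_char t (wt o).

Let coef_st t q : (forall i, t i != 0) -> coef t (Some q) * coef t (Some (st q)) = 1.
Proof.
move=> t0; rewrite /coef /torus_char -big_split big1 // => i _ /=.
by rewrite -[X in _ * _ ^ X]/(wt (Some (st q)) i) wt_st -expfzDr // subrr expr0z.
Qed.

Let coef_rep t i : coef t (Some (val i)) = t i.
Proof.
rewrite /coef /torus_char (bigD1 i) //= -[X in _ ^ X]/(wt (Some (val i)) i) wt_rep eqxx.
rewrite big1 ?mulr1 // => j ji.
by rewrite -[X in _ ^ X]/(wt (Some (val i)) j) wt_rep eq_sym (negPf ji) expr0z.
Qed.

Let f_herm o o' u v : o' != omap st o -> h (f o u) (f o' v) = 0.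
Proof. by move=> ne; rewrite sigmaP fs (idem_neq idf) ?(herm0r hh) // eq_sym. Qed.

(** There is one coordinate for each orbit of [st], the partner carrying the inverse character. The
    subtype [P] drops the kernel when its projection is 0, since the coefficients of a split torus
    must be nonzero. *)
Lemma orth_torus_split G : orth_torus `<=` G -> split_torus k0 G orth_torus.
Proof.
pose P := {o : option K | (o != None) || (f None != 0)}.
have sumP (F : option K -> V) : (f None = 0 -> F None = 0) ->
    \sum_(p : P) F (val p) = \sum_o F o.
  move=> F0; rewrite [RHS](bigID (fun o => (o != None) || (f None != 0))) /=.
  rewrite [X in _ + X]big1 ?addr0 => [|[q|] //=]; last first.
    by rewrite negbK => /eqP; exact: F0.
  rewrite [RHS](reindex_omap (val : P -> option K) insub) /=; last by move=> o Po; rewrite insubT.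
  by apply: eq_bigl => o; rewrite valK eqxx andbT; apply/esym/(valP o).
apply: (@split_torus_of_weights _ _ _ _ N P (fun p => wt (val p)) (fun p => f (val p))).
- move=> p p' /= E1; apply: val_inj; case Ep : (\val p) => [q|].
    by apply/esym/wt_inj; rewrite -Ep.
  by case Ep' : (\val p') => [q|] //; rewrite -Ep; apply: wt_inj; rewrite -Ep'.
- by case=> -[q|] //= _; exact: f0.
- move=> i; have Pi : (Some (val i) != None) || (f None != 0) by [].
  exists (fun p => (val p == Some (val i))%:Z) => j.
  rewrite (bigD1 (exist _ (Some (val i)) Pi : P)) //= eqxx mul1r big1 ?addr0 => [|p pi].
    exact: wt_rep.
  by case: eqP => [E1|]; rewrite ?mul0r //; case/eqP: pi; apply: val_inj.
- split=> [p p' v|v]; first by rewrite (idem_orth idf) val_eqE.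
  rewrite (sumP (fun o => f o v)) ?(idem_sum idf) // => ->.
  by rewrite zero_lfunE.
- apply/seteqP; split=> g.
    move=> [/unitaryP gU [gK gN]].
    have aex q : exists x, k0 x /\ forall v, g (f (Some q) v) = cs x (f (Some q) v).
      by have [x] := gK q; exists x.
    have [a aP] := choice aex.
    have aa q : a q * a (st q) = 1.
      have [u fu] : exists u, f (Some q) u != 0.
        apply: contrapT => nu; move/eqP: (f0 q); apply; apply/lfunP => u.
        by rewrite zero_lfunE; apply/eqP; apply: contraT => fu; case: nu; exists u.
      have [v hv] : exists v, h (f (Some q) u) v != 0.
        apply: contrapT => nv; move/eqP: fu; apply; apply: (herm_nondeg hh) => v.
        by apply/eqP; apply: contraT => hv; case: nv; exists v.
      have hE : h (f (Some q) u) v = h (f (Some q) u) (f (Some (st q)) v).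
        by rewrite -[in LHS](idem_id idf) [LHS]sigmaP fs.
      have := gU (f (Some q) u) (f (Some (st q)) v).
      rewrite !(proj2 (aP _)) herm_fixed => [E1|]; last exact: (proj1 (aP q)).
      rewrite hE in hv; apply: alg1.
      by apply: (mulIr (cdv_unit cD hv)); rewrite E1 mul1r.
    have a0 q : a q != 0 by apply/eqP => a0; have /eqP := aa q; rewrite a0 mul0r eq_sym oner_eq0.
    exists (fun i => a (val i)) => [i|v]; first by split; [exact: a0 | case: (aP (val i))].
    have cE q : coef (fun i => a (val i)) (Some q) = a q.
      have [rq|nq] := boolP (rep q); first exact: (coef_rep _ (Sub q rq : N)).
      have ck : coef (fun i => a (val i)) (Some (st q)) = a (st q).
        exact: (coef_rep _ (Sub (st q) (rep_st nq) : N)).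
      apply: (mulIf (a0 (st q))); rewrite aa -ck coef_st // => i; exact: a0.
    rewrite (sumP (fun o => cs (coef (fun i => a (val i)) o) (f o v))); last first.
      by move=> ->; rewrite zero_lfunE rscaler0.
    rewrite -{1}(idem_sum idf v) linear_sum; apply: eq_bigr => -[q|] _ /=.
      by rewrite cE; case: (aP q).
    by rewrite /coef torus_char0 // scale1r rscale1 -[LHS]/(g _) gN.
  move=> [t tP gE]; have t0 i : t i != 0 by case: (tP i).
  have tk i : k0 (t i) by case: (tP i).
  have {}gE v : g v = \sum_o cs (coef t o) (f o v).
    rewrite gE (sumP (fun o => cs (coef t o) (f o v))) // => ->.
    by rewrite zero_lfunE rscaler0.
  have ge o v : g (f o v) = cs (coef t o) (f o v).
    rewrite gE (bigD1 o) //= (idem_id idf) big1 ?addr0 // => o' oo'.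
    by rewrite (idem_neq idf) // rscaler0.
  have ck o : k0 (coef t o).
    exact: (torus_char_fixed fixed_field1 fixed_fieldM fixed_fieldV).
  have c1 : coef t None = 1 by rewrite /coef torus_char0.
  split; last split.
  + apply/unitaryP => u v; rewrite !gE (herm_suml hh).
    rewrite -[in RHS](idem_sum idf u) (herm_suml hh); apply: eq_bigr => o _.
    rewrite (herm_sumr hh) -[in RHS](idem_sum idf v) (herm_sumr hh); apply: eq_bigr => o' _.
    rewrite herm_fixed //; have [->|ne] := eqVneq o' (omap st o); last first.
      by rewrite f_herm // mulr0.
    case: o => [q|] /=; first by rewrite coef_st // scale1r mul1r.
    by rewrite c1 mulr1 scale1r mul1r.
  + by move=> q; exists (coef t (Some q)).
  + by move=> v; rewrite ge c1 scale1r rscale1.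
Qed.

End OrthogonalTorus.

Section WittTorus.
Variables (K : finType) (u : K -> V) (st : K -> K).
Hypotheses (wu : witt_basis h u st)
  (wd : witt_decomposition h (fun p => line (u p))).
Local Notation W := (fun p => line (u p)).
Let T := witt_torus h ((fun a : k => a%:A : D) @` k0) (unitary_group sigma) W.

Let line_scalar (g : 'End(V)) (a : k) p :
  g (u p) = cs a (u p) -> forall v, line (u p) v -> g v = cs a v.
Proof.
by move=> gu v [x _ <-]; rewrite lfun_rscale gu -!rscaleM mulr_algl mulr_algr.
Qed.

Lemma witt_torus_orth : exists2 e : option K -> 'End(V), idem_family e &
  [/\ forall p, im (e (Some p)) = line (u p), im (e None) = witt_kernel h W,
      forall o, sigma (e o) = e (omap st o), forall p, e (Some p) != 0 &
      T = orth_torus e].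
Proof.
have [e [ie eE eL eK eA]] := wb_projections cD hh irho wu.
have eu p : e (Some p) (u p) = u p by have : im (e (Some p)) (u p) by rewrite eL; exact: line_id.
exists e => //; split=> //.
- by move=> o; apply: (adjoint_unique hh irho (sigmaP _)) => x y; exact: eA.
- by move=> p; apply/eqP => E0; have := wb_neq0 hh wu p; rewrite -eu E0 zero_lfunE eqxx.
- apply/seteqP; split=> g.
    move=> [gU gl gk]; split=> //; split=> [q|v].
      have [_ [a ka <-] ga] := gl q; exists a => // v; apply: ga; rewrite -eL.
      exact: (idem_id ie).
    by apply: gk; rewrite -eK; exact: (idem_id ie).
  move=> [gU [gl gk]]; split=> // [p|v].
    have [a ka ga] := gl p; exists (a%:A : D); first by exists a.
    by move=> v; rewrite -[line _]eL => <-.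
  by rewrite -eK => <-.
Qed.

(** A split torus containing [T] is abelian, so its weight projections commute with [T] and preserve
    the eigenspaces of elements of [T], in particular each line and the kernel. On a line such a
    projection is 0 or 1. In the kernel a vector of nonzero weight is isotropic because weights pair
    only with their negatives. *)
Lemma witt_torus_maximal : maximal_split_torus k0 (unitary_group sigma) T.
Proof.
have [e ie [eL eK es e0 TE]] := witt_torus_orth.
have stK : involutive st := wb_inv wu.
have stN q : st q != q by exact: (wb_neq wu).
have k01 := fixed_field1; have k0M := fixed_fieldM; have k0V := fixed_fieldV.
have eu p : e (Some p) (u p) = u p by have : im (e (Some p)) (u p) by rewrite eL; exact: line_id.
split; first by rewrite TE; apply: orth_torus_split => // g [].
move=> S' S's TS'; apply/seteqP; split; last exact: TS'.
have [S'U [n [r [w [e' tw]]]]] := split_torus_weights k01 k0M k0tau tau0 tau_free S's.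
have ab := tw_abelian tw.
have e'S f : S' f -> forall p v, f (e' p v) = e' p (f v).
  by move=> Sf; apply: (tw_comm tw) => g v Sg; exact: ab.
(* the element of T with eigenvalues tau, tau^-1 on the lines p, st p *)
have tp p : exists2 g : 'End(V), T g & [/\ g (u p) = cs tau (u p),
    forall v, g v = v -> e (Some p) v = 0 & forall v, g v = cs tau v -> line (u p) v].
  pose a o := if o == Some p then tau else if o == Some (st p) then tau^-1 else 1.
  have [g gE] : exists g : 'End(V), forall v, g v = \sum_o cs (a o) (e o v).
    apply: linear_lfun => [x y|b x].
      by rewrite -big_split; apply: eq_bigr => j _; rewrite linearD rscaleDr.
    rewrite rscale_sumr; apply: eq_bigr => j _; rewrite lfun_rscale -!rscaleM.
    by rewrite mulr_algl mulr_algr.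
  have ge o v : g (e o v) = cs (a o) (e o v).
    rewrite gE (bigD1 o) //= (idem_id ie) big1 ?addr0 // => o' oo'.
    by rewrite (idem_neq ie) // rscaler0.
  have ak o : k0 (a o) by rewrite /a; case: ifP => _ //; case: ifP => _ //; exact: k0V.
  have ast o : a o * a (omap st o) = 1.
    rewrite /a; case: o => [q|] /=; last by rewrite mulr1.
    rewrite !(inj_eq Some_inj).
    have [->|qp] := eqVneq q p; first by rewrite (negPf (stN p)) eqxx mulfV.
    have [->|qs] := eqVneq q (st p); first by rewrite stK eqxx mulVf.
    rewrite (can2_eq stK stK) (negPf qs) (inj_eq (can_inj stK)) (negPf qp) mulr1 //.
  exists g.
    rewrite TE; split; last split.
    - apply/unitaryP => x y; rewrite !gE (herm_suml hh).
      rewrite -[in RHS](idem_sum ie x) (herm_suml hh); apply: eq_bigr => o _.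
      rewrite (herm_sumr hh) -[in RHS](idem_sum ie y) (herm_sumr hh); apply: eq_bigr => o' _.
      rewrite herm_fixed //; have [->|ne] := eqVneq o' (omap st o).
        by rewrite ast scale1r mul1r.
      by rewrite sigmaP es (idem_neq ie) ?(herm0r hh) ?mulr0 // eq_sym.
    - by move=> q; exists (a (Some q)).
    - by move=> v; rewrite ge /a /= scale1r rscale1.
  have eg o v : g (e o v) = e o (g v).
    by rewrite ge gE linear_sum (bigD1 o) //= big1 ?addr0 => [|o' oo'];
      rewrite lfun_rscale ?(idem_id ie) // (idem_neq ie) ?rscaler0 // eq_sym.
  have t1 : tau - 1 != 0.
    by rewrite subr_eq0; apply/eqP => E1; have /tau_free : tau ^ (1 : int) = 1 by rewrite expr1z.
  split=> [|v gv|v gv]; first by rewrite -{1}eu ge /a eqxx eu.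
    apply: (cscale_eq0 t1); rewrite cscaleB scale1r rscale1.
    by have := ge (Some p) v; rewrite /a eqxx => <-; rewrite eg gv subrr.
  rewrite -eL /im /= -[RHS](idem_sum ie) (bigD1 (Some p)) //= big1 ?addr0 // => o op.
  (* The other eigenvalues are $\tau^{-1}$ and 1, both different from $\tau$, which has infinite
     order. *)
  have ao : a o - tau != 0.
    rewrite /a (negPf op) subr_eq0; apply/eqP; case: ifP => _ E1.
      suff /tau_free : tau ^ (2%:Z : int) = 1 by [].
      by rewrite -exprnP expr2 -{1}E1 mulVf.
    by move: t1; rewrite -E1 subrr eqxx.
  apply: (cscale_eq0 ao); rewrite cscaleB -ge.
  by rewrite eg gv lfun_rscale subrr.
have e'T f : T f -> forall q v, f (e' q v) = e' q (f v) by move/TS'; exact: e'S.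
have e'_kernel q v : im (e None) v -> im (e None) (e' q v).
  move=> kv; have y0 p : e (Some p) (e' q v) = 0.
    have [g Tg [_ gf _]] := tp p; apply: gf; rewrite e'T //; congr (e' q _).
    by have [_ _] := Tg; apply; rewrite -eK.
  by rewrite /im /= -[RHS](idem_sum ie) sum_option big1 ?addr0.
have e'_line q p : e' q (u p) = 0 \/ e' q (u p) = u p.
  have [g Tg [gu _ gl]] := tp p.
  have [x _ xE] : line (u p) (e' q (u p)) by apply: gl; rewrite e'T // gu lfun_rscale.
  have [x0|x0] := eqVneq x 0; first by left; rewrite -xE x0 rscale0.
  have ux := cdv_unit cD x0.
  right; rewrite -[u p](rscale1 (A := D)) -(mulrV ux) rscaleM lfun_rscale.
  by rewrite xE (idem_id (tw_idem tw)) -xE.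
move=> g Sg; have := Sg; rewrite {1}(tw_torus tw) => -[t tP gE].
split=> [|p|v].
- exact: S'U.
- have [q e'q] : exists q, e' q (u p) = u p.
    apply: contrapT => nq; have /eqP := wb_neq0 hh wu p; apply.
    rewrite -(idem_sum (tw_idem tw) (u p)) big1 // => q _.
    by case: (e'_line q p) => // E1; case: nq; exists q.
  exists (torus_char t (w q))%:A.
    exists (torus_char t (w q)) => //; apply: torus_char_fixed => // i; by case: (tP i).
  by apply: line_scalar; rewrite -{1}e'q (tw_e tw gE) e'q.
- rewrite -eK => kv; rewrite gE -[RHS](idem_sum (tw_idem tw)); apply: eq_bigr => q _.
  have [w0|wN0] := pselect (forall i, w q i = 0).
    by rewrite torus_char0 // scale1r rscale1.
  suff -> : e' q v = 0 by rewrite rscaler0.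
  have ky : witt_kernel h W (e' q v) by rewrite -eK; exact: e'_kernel.
  apply: (witt_anisotropic wd ky); apply/eqP; apply: contraT => hne; case: wN0 => i.
  by apply/eqP; rewrite -eqNr -(weight_dual tw S'U hne i).
Qed.
End WittTorus.
End UnitaryTori.

(** * The map j *)

Section OddLocalFields.
Variables (R : realType) (k : fieldType) (nu : k -> \bar R).
Hypothesis Hk : odd_local_field nu.
Let w x := fine (nu x).
Let vnu := lf_val Hk.

Lemma local_field_unif : exists2 p, p != 0 & nu p = 1%E.
Proof.
have : range (fun n : int => (n%:~R : R)%:E) 1%E by exists 1%:Z.
by rewrite -(lf_normalized Hk) => -[p p0 pE]; exists p.
Qed.

Lemma cdv_local_field : cdv w.
Proof.
split.
- by move=> x; rewrite unitfE.
- exact: fine_valM vnu.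
- exact: vge_valD vnu.
- have [p p0 pE] := local_field_unif; exists p; rewrite // /w pE; split; first exact: ltr01.
  move=> x x0.
  have : [set nu x | x in [set x | x != 0]] (nu x) by exists x.
  by rewrite (lf_normalized Hk) => -[n _ <-]; exists n; rewrite mulr1.
- move=> u cu; have [M|l lP] := lf_complete Hk (u := u).
    have [N NP] := cu M; exists N => p q Np Nq; exact/(vge_nu vnu)/NP.
  exists l => M; have [N NP] := lP M; exists N => p Np; exact/(vge_nu vnu)/NP.
Qed.

(** For the odd prime [p] of positive value, $1 = p - 2 \lfloor p/2 \rfloor$ would have positive
    value if 2 had. *)
Lemma local_field_two : (2%:R : k) != 0 /\ w 2%:R = 0.
Proof.
have cA := cdv_local_field.
have nat0 (n : nat) : vge w 0 (n%:R : k).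
  elim: n => [|n IH]; first by left.
  by rewrite -natr1; apply: (cdv_add cA) => //; right; rewrite (cdv_1 cA).
have pos0 (x : k) : max_ideal nu x -> exists2 s, 0 < s & vge w s x.
  move=> xpos; have [->|x0] := eqVneq x 0; first by exists 1 => //; left.
  exists (w x); last exact: vge_self.
  by rewrite -lte_fin fineK // (val_fin vnu).
have [p [_ odp /pos0[s s0 sp]]] := lf_odd_residue_char Hk.
have no2 (r : R) : 0 < r -> ~ vge w r (2%:R : k).
  move=> r0 r2; have : vge w (Order.min s r) (1 : k).
    have -> : (1 : k) = p%:R - 2%:R * (p./2)%:R.
      by rewrite -natrM mul2n -{1}(odd_double_half p) odp natrD addrK.
    apply: (vgeB cA); first by apply: vge_le sp; rewrite ge_min lexx.
    rewrite -[Order.min _ _]addr0; apply: (vgeM cA) => //.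
    by apply: vge_le r2; rewrite ge_min lexx orbT.
  move/(vge_neq0 (oner_neq0 k)); rewrite (cdv_1 cA) leNgt lt_min s0 r0 //.
have t0 : (2%:R : k) != 0 by apply/eqP => t0; apply: (no2 1) => //; left.
split=> //; apply/eqP; rewrite eq_le (vge_neq0 t0 (nat0 2)) andbT leNgt.
by apply/negP => w2; apply: (no2 _ w2); right.
Qed.

End OddLocalFields.

Lemma falg_two (R : realType) (F : fieldType) (B : falgType F) (nu : F -> \bar R)
    (nuB : B -> \bar R) : (forall a, nuB (a%:A) = nu a) ->
  (2%:R : F) != 0 -> fine (nu 2%:R) = 0 -> (2%:R : B) != 0 /\ fine (nuB 2%:R) = 0.
Proof.
move=> ext t0 w2; have -> : (2%:R : B) = (2%:R : F)%:A.
  by rewrite -[_%:A]/(in_alg B _) rmorph_nat.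
by rewrite ext -[_%:A]/(in_alg B _) fmorph_eq0.
Qed.

Lemma cdv_falg (R : realType) (F : fieldType) (B : falgType F) (nu : F -> \bar R)
    (nuB : B -> \bar R) : valuation nu -> cdv (fun x => fine (nu x)) ->
  valuation nuB -> (forall a, nuB (a%:A) = nu a) ->
  (forall x : B, x != 0 -> x \is a GRing.unit) -> cdv (fun x => fine (nuB x)).
Proof.
move=> vnu cA vB ext uB.
apply: (cdv_extends vnu cA vB ext) => //; last exact: fgen_falg.
- exact: (rmorphD (in_alg B)).
- exact: (rmorphM (in_alg B)).
- exact: (rmorph1 (in_alg B)).
Qed.

Lemma nlf_shift (R : realType) (A : unitRingType) (w : A -> R) (V : zmodType)
    (act : A -> V -> V) X L s : nlf w act X L -> nlf w act X (shift_lf L s).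
Proof.
move=> nL; rewrite /shift_lf; split.
- by move=> t v; exact: (nlf_sub nL).
- by move=> t; exact: (nlf0 nL).
- by move=> t u v; exact: (nlfD nL).
- by move=> t a v a0 Lv; rewrite addrAC; exact: (nlf_act nL).
- by move=> r t v rt; apply: (nlf_le nL); rewrite lerD2r.
- move=> t v Xv H; apply: (nlf_left nL) => // r rt.
  by have := H (r + s); rewrite addrK; apply; lra.
- by move=> v Xv; have [t Lt] := nlf_ex nL Xv; exists (t + s); rewrite addrK.
- by move=> v Xv H; apply: (nlf_sep nL) => // t; have := H (t + s); rewrite addrK.
Qed.

(** * The action of sigma on the factors of $k[\beta]$ *)

Section Centralizer.
Variables (R : realType)
  (k : fieldType) (nu : k -> \bar R) (Hk : odd_local_field nu)
  (D : falgType k) (HD : central_division_algebra D)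
  (d : nat) (Hd : \dim {:D} = (d ^ 2)%N)
  (nuD : D -> \bar R) (HnuD : extends_val nu (fun a : k => a%:A : D) nuD)
  (rho : D -> D) (Hrho : ring_involution rho)
  (V : vectType D^c) (eps : D) (h : V -> V -> D) (Hh : hermitian_form h rho eps)
  (sigma : 'End(V) -> 'End(V)) (Hsigma : forall f, adjoint_pair h f (sigma f))
  (beta : 'End(V)) (Hbeta : sigma beta = - beta).
Variables (I : finType) (E : I -> fieldExtType k) (iota : forall i, E i -> 'End(V))
  (sI : I -> I) (Ip : {set I})
  (D' : forall i, falgType (E i)) (nu' : forall i, D' i -> \bar R)
  (V' : forall i, vectType (D' i)^c) (psi : forall i, 'End(V' i) -> 'End(V))
  (rho' : forall i, D' i -> D' i) (eps' : forall i, D' i)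
  (h' : forall i, V' i -> V' i -> D' i)
  (jt : forall i, (R -> set (V' i)) -> (R -> set V)).
Arguments iota : clear implicits.
Arguments nu' : clear implicits.
Arguments psi : clear implicits.
Arguments rho' : clear implicits.
Arguments h' : clear implicits.
Arguments jt : clear implicits.
Hypotheses (HE : product_of_fields beta iota)
  (HI : sigma_indices sigma iota sI Ip)
  (HD' : forall i, central_division_algebra (D' i))
  (Hnu' : forall i, extends_val nu (@tower_scalar k (E i) (D' i)) (nu' i))
  (Hpsi : forall i, centralizer_iso (iota i) (psi i))
  (Hrho' : forall i, sI i = i -> ring_involution (rho' i))
  (Hh' : forall i, sI i = i -> hermitian_form (h' i) (rho' i) (eps' i))
  (Hsigma' : forall i, sI i = i -> forall f g,
     psi i g = sigma (psi i f) -> adjoint_pair (h' i) f g)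
  (Hjt : forall i, broussous_lemaire d nuD (iota i) (nu' i) (psi i) (jt i)).

Let ck := cdv_local_field Hk.
Let vnu := lf_val Hk.

Lemma cdv_D0 : cdv (fun x => fine (nuD x)).
Proof. by case: HnuD => vD eD; exact: (cdv_falg vnu ck vD eD (cda_division HD)). Qed.

Definition wD (x : D) : R := fine (nuD x) * (d%:R^-1 / unif_value nuD).

Lemma d_gt0 : 0 < (d%:R : R)^-1.
Proof.
rewrite invr_gt0 ltr0n lt0n; apply/eqP => d0.
by have := adim_gt0 {:D}%AS; rewrite Hd d0.
Qed.

Lemma normalized_D : normalized nuD wD d%:R^-1.
Proof. by apply: (normalized_scale d_gt0); apply: normalized_val cdv_D0; case: HnuD. Qed.

Lemma valE_valuation i : valuation (valE (nu' i)) /\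
  forall a : k, valE (nu' i) a%:A = nu a.
Proof.
have [vD' eD'] := Hnu' i; split; last exact: eD'.
have AM (x y : E i) : (x * y)%:A = x%:A * y%:A :> D' i by rewrite -!in_algE rmorphM.
have AD (x y : E i) : (x + y)%:A = x%:A + y%:A :> D' i by rewrite -!in_algE rmorphD.
split.
- by rewrite /valE scale0r (val_zero vD').
- by move=> x x0; rewrite /valE (val_fin vD') // -in_algE fmorph_eq0.
- by move=> x y; rewrite /valE AM (Defs.valM vD').
- by move=> x y; rewrite /valE AD (Defs.valD vD').
Qed.

Lemma cdv_E i : cdv (fun x => fine (valE (nu' i) x)).
Proof.
have [vE eE] := valE_valuation i.
by apply: (cdv_falg vnu ck vE eE) => x; rewrite unitfE.
Qed.

Lemma cdv_D' i : cdv (fun x => fine (nu' i x)).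
Proof.
have [vE _] := valE_valuation i; have [vD' _] := Hnu' i.
exact: (cdv_falg vE (cdv_E i) vD' (fun=> erefl) (cda_division (HD' i))).
Qed.

Definition w' i (x : D' i) : R := fine (nu' i x).
Definition wE i (x : E i) : R := fine (valE (nu' i) x).

Lemma normalized_D' i : normalized (nu' i) (@w' i) (unif_value (nu' i)).
Proof. by apply: normalized_val (cdv_D' i); case: (Hnu' i). Qed.

Lemma normalized_E i : normalized (valE (nu' i)) (@wE i) (unif_value (valE (nu' i))).
Proof. by apply: normalized_val (cdv_E i); case: (valE_valuation i). Qed.

Lemma two_D : (2%:R : D) != 0 /\ wD 2%:R = 0.
Proof.
have [t0 w2] := local_field_two Hk; case: HnuD => vD eD.
by have [? E0] := falg_two eD t0 w2; split=> //; rewrite /wD E0 mul0r.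
Qed.

Lemma two_E i : (2%:R : E i) != 0 /\ wE (2%:R : E i) = 0.
Proof.
have [t0 w2] := local_field_two Hk; have [vE eE] := valE_valuation i.
exact: (falg_two eE t0 w2).
Qed.

Lemma two_D' i : (2%:R : D' i) != 0 /\ w' (2%:R : D' i) = 0.
Proof. by have [t0 w2] := two_E i; exact: (falg_two (fun=> erefl) t0 w2). Qed.

Lemma iota0 i : iota i 0 = 0.
Proof. by apply: (addrI (iota i 0)); rewrite -(pf_add HE) !addr0. Qed.

Lemma iota_idem i v : iota i 1 (iota i 1 v) = iota i 1 v.
Proof. by rewrite -comp_lfunE -(pf_mul HE) mulr1. Qed.

Lemma iota_orth i j (x : E i) (y : E j) v : i != j -> iota i x (iota j y v) = 0.
Proof. by move=> ij; rewrite -comp_lfunE (pf_orth HE) // zero_lfunE. Qed.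

Lemma iota_inj i : injective (iota i).
Proof.
move=> x y xy; apply/eqP; rewrite -subr_eq0; apply: contraT => d0.
have E0 : iota i (x - y) = 0.
  by apply: (addIr (iota i y)); rewrite -(pf_add HE) subrK xy add0r.
have := pf_nonzero HE i.
have -> : iota i 1 = (iota i (x - y) \o iota i (x - y)^-1)%VF.
  by rewrite -(pf_mul HE) divff.
by rewrite E0 comp_lfun0l eqxx.
Qed.

Lemma iota_sum v : \sum_i iota i 1 v = v.
Proof. by rewrite -sum_lfunE (pf_one HE) id_lfunE. Qed.

Lemma iota_generated i x : generated_algebra beta (iota i x).
Proof.
rewrite (pf_image HE); exists (dfwith (fun j => 0 : E j) x) => //.
rewrite (bigD1 i) //= dfwith_in big1 ?addr0 // => j ji.
by rewrite dfwith_out 1?eq_sym // iota0.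
Qed.

Lemma generated_comm (g f : 'End(V)) : (forall v, g (beta v) = beta (g v)) ->
  generated_algebra beta f -> forall v, g (f v) = f (g v).
Proof.
move=> gb [p fE] v; rewrite !fE linear_sum; apply: eq_bigr => n _ /=.
rewrite -[LHS]/(g _) lfun_rscale; congr rscale.
by elim: (nat_of_ord n) => //= m <-; rewrite gb.
Qed.

Lemma generated_sum (N : nat) (a : nat -> k) (f : 'End(V)) :
  (forall v, f v = \sum_(n < N) rscale ((a n)%:A : D) (iter n beta v)) ->
  generated_algebra beta f.
Proof.
move=> fE; exists (\poly_(n < N) a n) => v; rewrite fE.
rewrite (big_ord_widen N (fun n => rscale (((\poly_(n < N) a n)`_n)%:A : D) (iter n beta v))
  (size_poly _ _)) [RHS]big_mkcond; apply: eq_bigr => n _.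
case: ifPn => [_|]; first by rewrite coef_poly ltn_ord.
rewrite -leqNgt => /(nth_default 0); rewrite coef_poly ltn_ord => ->.
by rewrite scale0r rscale0.
Qed.

Lemma beta_generated : generated_algebra beta beta.
Proof.
apply: (@generated_sum 2 (fun n => if n is 1%N then 1 else 0)) => v.
by rewrite big_ord_recl big_ord1 /= scale0r rscale0 add0r scale1r rscale1.
Qed.

Lemma central_comm (a : k) (x : D) : a%:A * x = x * a%:A.
Proof. by rewrite mulr_algl mulr_algr. Qed.

Lemma rho_center (a : k) : exists b : k, rho a%:A = b%:A.
Proof.
apply: (cda_central HD) => y.
by rewrite -{1 2}(invol_invol Hrho y) -!(invol_mul Hrho) central_comm.
Qed.

(** [sigma] sends $\sum a_n \beta^n$ to $\sum \rho(a_n) (-\beta)^n$, and [rho] preserves $k$, the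
    centre of $D$. *)
Lemma sigma_generated f : generated_algebra beta f -> generated_algebra beta (sigma f).
Proof.
move=> [p fE]; have [r rE] := choice rho_center.
apply: (@generated_sum (size p) (fun n => (-1) ^+ n * r p`_n)) => v.
apply/eqP; rewrite -subr_eq0; apply/eqP; apply: (herm_nondegr Hh Hrho) => u.
rewrite (hermDr Hh) (hermNr Hh) -Hsigma fE (herm_suml Hh) (herm_sumr Hh) -sumrB.
apply: big1 => n _; rewrite (hermZl Hh Hrho) (hermZr Hh Hrho) rE.
suff -> : forall m u v, h (iter m beta u) v = ((-1) ^+ m)%:A * h u (iter m beta v).
  rewrite -central_comm mulrA -scalerAl mul1r scalerA [(-1) ^+ n * _]mulrC.
  by rewrite subrr.
elim=> [|m IH] x y; first by rewrite expr0 scale1r mul1r.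
rewrite /= Hsigma Hbeta opp_lfunE (hermNr Hh) IH -iterSr exprS mulN1r scaleNr mulNr.
by [].
Qed.

Lemma sI_inv i : sI (sI i) = i.
Proof.
apply/eqP; apply: contraT => ne.
have E1 : iota (sI (sI i)) 1 = iota i 1.
  by rewrite -!(si_action HI) (sigmaK Hh Hrho Hsigma).
have := pf_nonzero HE i.
suff -> : iota i 1 = 0 by rewrite eqxx.
apply/lfunP => v; rewrite zero_lfunE -iota_idem -{1}E1; exact: iota_orth.
Qed.

Lemma sigma_iota i : sI i = i -> exists s : E i -> E i, ring_involution s /\
  forall x, sigma (iota i x) = iota i (s x).
Proof.
move=> si; have s1 : sigma (iota i 1) = iota i 1 by rewrite (si_action HI) si.
have [x|s sE] := @choice _ _ (fun x y => sigma (iota i x) = iota i y).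
  have /sigma_generated : generated_algebra beta (iota i x) by exact: iota_generated.
  rewrite (pf_image HE) => -[y _ yE]; exists (y i).
  have -> : sigma (iota i x) = (iota i 1 \o sigma (iota i x))%VF.
    by rewrite -s1 -(sigma_comp Hh Hrho Hsigma) -(pf_mul HE) mulr1.
  rewrite -yE; apply/lfunP => v; rewrite comp_lfunE sum_lfunE linear_sum (bigD1 i) //=.
  rewrite big1 => [|j ji]; last by apply: iota_orth; rewrite eq_sym.
  by rewrite addr0 -comp_lfunE -(pf_mul HE) mul1r.
exists s; split=> //; split.
- by move=> x y; apply: iota_inj; rewrite -sE !(pf_add HE) (sigma_add Hh Hrho Hsigma) !sE.
- move=> x y; apply: iota_inj; rewrite -sE !(pf_mul HE) (sigma_comp Hh Hrho Hsigma) !sE.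
  by [].
- by apply: iota_inj; rewrite -sE s1.
- by move=> x; apply: iota_inj; rewrite -!sE (sigmaK Hh Hrho Hsigma).
Qed.

Lemma kappa_ex : exists pik kappa, [/\ pik != 0,
  forall i, w' (tower_scalar (D' i) pik) = 1 & wD (pik%:A) = kappa].
Proof.
have [p p0 pE] := local_field_unif Hk; exists p, (wD p%:A); split=> //.
by move=> i; rewrite /w' (proj2 (Hnu' i)) pE.
Qed.

(** Projection onto $V_i$ or $V_i + V_{-i}$, the sum of components on which [h] is nondegenerate. *)
Definition eY i : 'End(V) :=
  if sI i == i then iota i 1 else iota i 1 + iota (sI i) 1.

Local Notation jfac i := (@j_factor R k D nuD V h I E iota sI D' V' jt i).
Local Notation tower i := (@tower_scalar k (E i) (D' i)).

(* What the rest of the proof uses of one factor: S and T are an apartment of H_i and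
   its torus, the F (Some j) project V onto the subspaces corresponding to the lines
   (for i in I_+, to the lines and their duals in V_{-i}), and F None onto the one
   corresponding to the anisotropic kernel. *)
Record local_data (i : I) (J : finType) (F : option J -> 'End(V)) (dl : J -> J)
    (S : set (R -> set (V' i))) (T : set 'End(V' i)) : Prop := {
  ld_orth : forall a b v, F a (F b v) = if a == b then F b v else 0;
  ld_sum : forall v, \sum_a F a v = eY i v;
  ld_sigma : forall a, sigma (F a) = F (omap dl a);
  ld_dlK : involutive dl;
  ld_dl : forall j, dl j != j;
  ld_neq0 : forall j, F (Some j) != 0;
  ld_beta : forall a v, F a (beta v) = beta (F a v);
  ld_nlf : forall x, S x -> nlf wD (@rscale D V) (im (eY i)) (jfac i x);
  ld_dual : forall x, S x -> dual_lf nuD h (im (eY i)) (jfac i x) = jfac i x;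
  ld_stable : forall x, S x -> forall a t v, jfac i x t v -> jfac i x t (F a v);
  ld_shift : forall x y, S x -> S y -> forall a, exists s, (a = None -> s = 0) /\
    forall t v, F a v = v -> (jfac i y t v <-> jfac i x (t - s) v);
  ld_torus : forall g, centralizer_group sigma beta g ->
    (exists2 f, T f & psi i f = (g \o iota i 1)%VF) <->
    (forall j, exists2 a, fixed_field rho a &
       forall v, g (F (Some j) v) = rscale (a%:A : D) (F (Some j) v)) /\
    forall v, g (F None v) = F None v }.

(** Duality negates a shift on the image of a self-adjoint idempotent, so two self-dual norms cannot
    differ by a nonzero shift there; [key] gives one inequality and is applied in both directions.
    This cancels, on the anisotropic kernel, the normalizing shifts in [j_zero]. *)
Lemma selfdual_translate (Y : set V) (M M' : R -> set V) (e : 'End(V)) s :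
  nlf wD (@rscale D V) Y M -> nlf wD (@rscale D V) Y M' ->
  dual_lf nuD h Y M = M -> dual_lf nuD h Y M' = M' ->
  (forall v, e (e v) = e v) -> (forall x y, h (e x) y = h x (e y)) ->
  (forall t v, M t v -> M t (e v)) -> (forall t v, M' t v -> M' t (e v)) ->
  (forall t v, e v = v -> (M' t v <-> M (t - s) v)) ->
  forall t v, e v = v -> (M' t v <-> M t v).
Proof.
move=> nM nM' dM dM' ee eadj Me Me' MM'.
have key (K K' : R -> set V) r : nlf wD (@rscale D V) Y K -> nlf wD (@rscale D V) Y K' ->
    dual_lf nuD h Y K = K -> dual_lf nuD h Y K' = K' ->
    (forall t v, K' t v -> K' t (e v)) ->
    (forall t v, e v = v -> (K' t v <-> K (t - r) v)) ->
    forall v, Y v -> v != 0 -> e v = v -> 0 <= r.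
  move=> nK nK' dK dK' Ke KK' v Yv v0 ev.
  have Kv := proj2 (nlf_norm nK Yv v0 _) (lexx (norm_lf K v)).
  set a := norm_lf K v in Kv.
  have : K (a - r - r) v.
    apply/KK' => //; rewrite -dK'.
    apply/(dual_lfP Hh Hrho (nz_cdv normalized_D) normalized_D _ _ _ nK'); split=> // q u Ku.
    have /KK' : K' q (e u) by exact: Ke.
    rewrite ee => /(_ erefl) Ku'.
    move: Kv; rewrite -{1}dK => /(dual_lfP Hh Hrho (nz_cdv normalized_D) normalized_D _ _ _ nK)[_ H].
    have := H _ _ Ku'; rewrite -eadj ev; apply: vge_le; lra.
  move/(nlf_norm nK Yv v0); rewrite -/a; lra.
move=> t v ev; have [->|v0] := eqVneq v 0.
  by split=> _; [exact: (nlf0 nM) | exact: (nlf0 nM')].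
suff Ys : Y v -> s = 0.
  split=> Mv.
    by have := proj1 (MM' t v ev) Mv; rewrite Ys ?subr0 //; exact: (nlf_sub nM' Mv).
  by apply/MM' => //; rewrite Ys ?subr0 //; exact: (nlf_sub nM Mv).
move=> Yv; have s0 : 0 <= s by apply: (key M M' s _ _ _ _ _ _ v).
have s0' : 0 <= - s.
  apply: (key M' M (- s) _ _ _ _ _ _ v) => // r u eu.
  by rewrite opprK MM' // addrK.
lra.
Qed.

Lemma psi_eqR i (f : 'End(V' i)) v : psi i f (iota i 1 v) = psi i f v.
Proof. exact: (psi_io (@pf_mul _ _ _ _ _ _ _ HE i) (Hpsi i)). Qed.

Lemma psi_eqL i (f : 'End(V' i)) v : iota i 1 (psi i f v) = psi i f v.
Proof. exact: (io_psi (@pf_mul _ _ _ _ _ _ _ HE i) (Hpsi i)). Qed.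

Lemma psi_beta i (f : 'End(V' i)) v : psi i f (beta v) = beta (psi i f v).
Proof.
apply/esym; have := beta_generated; rewrite (pf_image HE) => -[x _ xE].
have bE u : beta u = \sum_j iota j (x j) u by rewrite -xE sum_lfunE.
rewrite !bE linear_sum; apply: eq_bigr => j _ /=; rewrite -[RHS]/(psi i f _).
have [ij|ij] := eqVneq i j; first by case: _ / ij; rewrite (psi_comm (Hpsi i)).
have -> : psi i f (iota j (x j) v) = 0 by rewrite -psi_eqR iota_orth //; exact: linear0.
by rewrite -psi_eqL iota_orth // eq_sym.
Qed.

Lemma psi_idem i (J : finType) (e : J -> 'End(V' i)) : idem_family e ->
  (forall a b v, psi i (e a) (psi i (e b) v) = if a == b then psi i (e b) v else 0) /\
  forall v, \sum_a psi i (e a) v = iota i 1 v.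
Proof.
move=> ie; split=> [a b v|v].
  rewrite -(psiM (Hpsi i)).
  have -> : (e a \o e b)%VF = if a == b then e b else 0.
    by apply/lfunP => u; rewrite comp_lfunE (idem_orth ie); case: ifP; rewrite ?zero_lfunE.
  by case: ifP => _ //; rewrite (psi0 (Hpsi i)) zero_lfunE.
by rewrite -sum_lfunE -(psi_sum (Hpsi i)) (idem_End ie) (psi1 (Hpsi i)).
Qed.

Lemma psi_scalarE i a (f : 'End(V' i)) :
  (forall v, f v = rscale (tower i a) v) -> forall v, psi i f v = rscale (a%:A : D) (iota i 1 v).
Proof. exact: (psi_scalar (@pf_scale _ _ _ _ _ _ _ HE i) (Hpsi i)). Qed.

Lemma bldg_norm i x : lattice_function (nu' i) (@rscale (D' i) (V' i)) [set: V' i]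
  (unif_value (nu' i)) x <-> nlf (@w' i) (@rscale (D' i) (V' i)) [set: V' i] x.
Proof. exact: (bldg_nlf (normalized_D' i)). Qed.

(** * Factors of unitary type *)

Section I0.
Variable i : I.
Hypothesis si : sI i = i.
Variables (J : finType) (W : J -> set (V' i)).
Hypothesis wW : witt_decomposition (h' i) W.

Lemma local_data_I0 : exists (F : option J -> 'End(V)) (dl : J -> J),
  local_data F dl (witt_apartment (nu' i) (h' i) (unif_value (nu' i)) W)
    (witt_torus (h' i) (tower i @` fixed_field rho) (@factor_unitary_group _ _ _ sigma _ _ iota _ _ psi i) W).
Proof.
have [pik [kappa [pik0 w'pik wDpik]]] := kappa_ex.
have [s [isE sio]] := sigma_iota si.
have [u [st [wu WE]]] := witt_basis_of (Hh' si) (Hrho' si) wW.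
have [e [ie eE eL eK eadj]] := wb_projections (cdv_D' i) (Hh' si) (Hrho' si) wu.
have Wim : witt_family (h' i) W = fun o => im (e o).
  by rewrite WE; apply/funext => -[p|] /=; rewrite ?eL ?eK.
have WS j : W j = im (e (Some j)) by rewrite -[LHS]/(witt_family (h' i) W (Some j)) Wim.
have WN : witt_kernel (h' i) W = im (e None) by rewrite -[LHS]/(witt_family (h' i) W None) Wim.
have eYE : eY i = iota i 1 by rewrite /eY si eqxx.
have YE : im (eY i) = component (iota i).
  by rewrite eYE (component_im (@pf_mul _ _ _ _ _ _ _ HE i)).
have [forth fsum] := psi_idem ie.
have fsig a : sigma (psi i (e a)) = psi i (e (omap st a)).
  have [g gE] := psi_adjoint (@pf_mul _ _ _ _ _ _ _ HE i) (Hpsi i) Hh Hrho Hsigma sio isE (e a).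
  rewrite -gE; congr (psi _ _); apply: (adjoint_unique (Hh' si) (Hrho' si)) (eadj a).
  exact: (Hsigma' si).
have jE x : jfac i x = shift_lf (jt i x) (xget 0 [set r : R |
    dual_lf nuD h (component (iota i)) (shift_lf (jt i x) r) = shift_lf (jt i x) r]).
  by rewrite /j_factor si eqxx.
have bl := Hjt i; have nD := normalized_D; have nD' := normalized_D' i.
have [D2 wD2] := two_D; have [E2 wE2] := two_E i; have [D'2 w'2] := two_D' i.
set S := witt_apartment _ _ _ _.
have Sb x : S x -> building_linear (nu' i) x by case=> -[].
have Sn x : S x -> nlf (@w' i) (@rscale (D' i) (V' i)) [set: V' i] x.
  by move=> /Sb/bldg_norm.
have Sd x : S x -> dual_lf (nu' i) (h' i) [set: V' i] x = x by case=> -[].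
have Se x : S x -> forall a t v, x t v -> x t (e a v).
  move=> Sx; have [_] := Sx; rewrite Wim.
  by move/(idem_split ie (nlfD (Sn x Sx)) (nlf0 (Sn x Sx))).
have jn x : S x -> nlf wD (@rscale D V) (im (eY i)) (jt i x).
  by move=> Sx; rewrite YE; apply: (jt_nlf nD (@pf_mul _ _ _ _ _ _ _ HE i) bl); exact: Sb.
have jfn x : S x -> nlf wD (@rscale D V) (im (eY i)) (jfac i x).
  by move=> Sx; rewrite jE; apply: nlf_shift; exact: jn.
have jfd x : S x -> dual_lf nuD h (im (eY i)) (jfac i x) = jfac i x.
  move=> Sx; have [r rP] := jt_selfdual_shift nD nD' (normalized_E i) (@pf_add _ _ _ _ _ _ _ HE i)
    (@pf_mul _ _ _ _ _ _ _ HE i) (@pf_scale _ _ _ _ _ _ _ HE i) (Hpsi i) bl pik0 (w'pik i) wDpik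
    Hh Hrho D2 wD2 Hsigma sio isE E2 wE2 (Hh' si) (Hrho' si) D'2 w'2 (Hsigma' si)
    (Sb x Sx) (Sd x Sx).
  rewrite jE YE.
  exact: (@xgetPex _ 0 [set r | dual_lf nuD h (component (iota i)) (shift_lf (jt i x) r)
    = shift_lf (jt i x) r] (ex_intro _ r rP)).
have jts x : S x -> forall a t v, jt i x t v -> jt i x t (psi i (e a) v).
  by move=> Sx a t v; apply: (jt_stable bl (Sb x Sx) (Se x Sx a)).
have jfs x : S x -> forall a t v, jfac i x t v -> jfac i x t (psi i (e a) v).
  by move=> Sx a t v; rewrite jE; exact: jts.
have sadj x y : h (psi i (e None) x) y = h x (psi i (e None) y).
  by rewrite Hsigma fsig.
exists (fun a => psi i (e a)), st; split=> //.
- by move=> v; rewrite eYE.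
- exact: (wb_inv wu).
- exact: (wb_neq wu).
- move=> j; apply/eqP => p0; have := psi0 (Hpsi i); rewrite -p0 => /(ci_inj (Hpsi i)) e0.
  have := line_id (u j); rewrite -[line _]/((fun j => line (u j)) j) -WE WS /im /= -e0.
  by rewrite zero_lfunE => /esym/eqP; rewrite (negPf (wb_neq0 (Hh' si) wu j)).
- by move=> a v; exact: psi_beta.
- move=> x y Sx Sy.
  (* Two points of the apartment differ by a shift on each line and coincide on the kernel, where
     [selfdual_anisotropic] determines the norm. *)
  have [a|sh shP] := @choice _ _ (fun a r => (a = None -> r = 0) /\
      forall t v, im (e a) v -> (y t v <-> x (t - r) v)).
    case: a => [j|].
      have [r rP] := line_norm (cdv_D' i) (Sn x Sx) (Sn y Sy) (wb_neq0 (Hh' si) wu j).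
      by exists r; split=> // t v; rewrite -WS WE; exact: rP.
    exists 0; split=> // t v ev; rewrite subr0.
    have an v0 : im (e None) v0 -> h' i v0 v0 = 0 -> v0 = 0.
      by rewrite -WN; exact: (witt_anisotropic wW).
    have A z (Sz : S z) := selfdual_anisotropic (cdv_D' i) (Hh' si) (Hrho' si) D'2 w'2
      nD' t (Sn z Sz) (Sd z Sz) (idem_id ie None) (eadj None) (Se z Sz None) an ev.
    by rewrite (A x Sx) (A y Sy).
  have yE t v : y t v <-> forall a, x (t - sh a) (e a v).
    split=> [yv a|xv].
      by apply/(shP a).2; [exact: (idem_id ie) | exact: Se].
    rewrite -(idem_sum ie v); apply: (nlf_sum (Sn y Sy)) => a.
    by apply/(shP a).2; [exact: (idem_id ie) | exact: xv].
  have js := jt_shift nD nD' (@pf_mul _ _ _ _ _ _ _ HE i)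
    (@pf_scale _ _ _ _ _ _ _ HE i) (Hpsi i) bl pik0 (w'pik i) wDpik ie (Sb x Sx) (Se x Sx) (Sb y Sy) yE.
  have js1 a t v : psi i (e a) v = v -> (jt i y t v <-> jt i x (t - kappa * sh a) v).
    move=> av; split=> [/js[_ /(_ a)]|xv]; first by rewrite av.
    apply/js; split.
      by rewrite -YE eYE -av /im /=; exact: psi_eqL.
    move=> b; have [->|ba] := eqVneq b a; first by rewrite av.
    by rewrite -av forth (negPf ba); exact: (nlf0 (jn x Sx)).
  move=> a.
  (* The normalizing shifts of the two points may differ, which adds the same amount to the shift on
     every projection; on the kernel the total is forced to be 0. *)
  have [r1 r1E] : exists r, jfac i x = shift_lf (jt i x) r by rewrite jE; eexists.
  have [r2 r2E] : exists r, jfac i y = shift_lf (jt i y) r by rewrite jE; eexists.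
  have H t v : psi i (e a) v = v -> (jfac i y t v <-> jfac i x (t - (r2 + kappa * sh a - r1)) v).
    move=> av; rewrite r1E r2E /shift_lf.
    have -> : t - (r2 + kappa * sh a - r1) - r1 = t - r2 - kappa * sh a by lra.
    exact: js1.
  case: a H => [j|] H; first by exists (r2 + kappa * sh (Some j) - r1).
  exists 0; split=> // t v ev; rewrite subr0.
  have see z : psi i (e None) (psi i (e None) z) = psi i (e None) z by rewrite forth eqxx.
  exact: (selfdual_translate (jfn x Sx) (jfn y Sy) (jfd x Sx) (jfd y Sy) see sadj
    (jfs x Sx None) (jfs y Sy None) H).
- move=> g [Ug gb]; split.
    move=> [f [Uf fW fN] fE].
    have gv v : g (iota i 1 v) = psi i f v by rewrite fE comp_lfunE.
    have gp q v : g (psi i q v) = psi i (f \o q)%VF v.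
      by rewrite -psi_eqL gv (psiM (Hpsi i)).
    split=> [j|v].
      have [_ [a a0 <-] aE] := fW j; exists a => // v.
      have [sc scE] := scalar_End (D' := D' i) (V' i) (a%:A).
      rewrite gp; have -> : (f \o e (Some j))%VF = (sc \o e (Some j))%VF.
        apply/lfunP => z; rewrite !comp_lfunE scE aE // WS; exact: (idem_id ie).
      by rewrite (psiM (Hpsi i)) (psi_scalarE scE) psi_eqL.
    rewrite gp; congr (psi i _ v); apply/lfunP => z; rewrite comp_lfunE fN // WN.
    exact: (idem_id ie).
  move=> [gS gN].
  have [a aP] := @choice _ _ (fun j a => fixed_field rho a /\
      forall v, g (psi i (e (Some j)) v) = rscale (a%:A : D) (psi i (e (Some j)) v))
    (fun j => let: ex_intro2 a H1 H2 := gS j in ex_intro _ a (conj H1 H2)).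
  have [sc scE] := choice (fun j => scalar_End (D' := D' i) (V' i) ((a j)%:A)).
  pose f : 'End(V' i) := \sum_j (sc j \o e (Some j))%VF + e None.
  have fE v : f v = \sum_j rscale (tower i (a j)) (e (Some j) v) + e None v.
    by rewrite add_lfunE sum_lfunE; congr (_ + _); apply: eq_bigr => j _; rewrite comp_lfunE scE.
  have pf : psi i f = (g \o iota i 1)%VF.
    apply/lfunP => v; rewrite comp_lfunE -fsum sum_option linearD linear_sum /= gN.
    rewrite (ci_add (Hpsi i)) (psi_sum (Hpsi i)) add_lfunE sum_lfunE addrC; congr (_ + _).
    apply: eq_bigr => j _; rewrite (psiM (Hpsi i)) (psi_scalarE (scE j)) psi_eqL.
    by rewrite -[RHS]/(g _) (aP j).2.
  exists f => //; split.
  - rewrite /factor_unitary_group /= pf (sigma_comp Hh Hrho Hsigma) (si_action HI) si.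
    apply/lfunP => v; rewrite !comp_lfunE -[sigma g _]comp_lfunE.
    by have -> : (sigma g \o g)%VF = \1%VF := Ug; rewrite id_lfunE iota_idem.
  - move=> j; exists (tower i (a j)); first by exists (a j); [exact: (aP j).1 |].
    move=> v; rewrite WS => ev; rewrite fE (bigD1 j) //= ev (idem_im_neq ie (j := Some j)) //.
    rewrite big1 ?addr0 // => q qj; rewrite (idem_im_neq ie (j := Some j)) ?rscaler0 //.
  - move=> v; rewrite WN => ev; rewrite fE ev big1 ?add0r // => q _.
    by rewrite (idem_im_neq ie (j := None)) ?rscaler0.
Qed.

End I0.

Lemma sigma_beta (f : 'End(V)) : (forall v, f (beta v) = beta (f v)) ->
  forall v, sigma f (beta v) = beta (sigma f v).
Proof.
move=> fb v; have E1 : (f \o beta = beta \o f)%VF.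
  by apply/lfunP => u; rewrite !comp_lfunE fb.
have := congr1 sigma E1; rewrite !(sigma_comp Hh Hrho Hsigma) Hbeta => /lfunP/(_ v).
by rewrite !comp_lfunE !opp_lfunE linearN /= => /oppr_inj.
Qed.

(** * Factors of general linear type *)

Section Iplus.
Variable i : I.
Hypothesis iIp : i \in Ip.
Variables (J : finType) (W : J -> set (V' i)).
Hypothesis wW : line_decomposition [set: V' i] W.

Let si : sI i != i := si_plus_moved HI iIp.

(** A line of $V'_i$ gives two summands of $V$: the image of [p j] in $V_i$ and that of its adjoint
    [q j] in $V_{-i}$. A shift on the first is accompanied by the opposite shift on the second.
    There is no anisotropic kernel, hence [F None] is 0. *)
Lemma local_data_Ip : exists (J' : finType) (F : option J' -> 'End(V)) (dl : J' -> J'),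
  local_data F dl (line_apartment (nu' i) (unif_value (nu' i)) W)
    (line_torus (tower i @` fixed_field rho) W).
Proof.
have [pik [kappa [pik0 w'pik wDpik]]] := kappa_ex.
have [Wl WD] := wW.
have [u uP] := choice Wl.
have Wr j : rmod (@rscale (D' i) (V' i)) (W j) by rewrite (uP j).2; exact: rmod_line.
have [e ie WE] := decomposition_idem Wr WD.
have eYE : eY i = iota i 1 + iota (sI i) 1 by rewrite /eY (negPf si).
have [forth fsum] := psi_idem ie.
pose p j := psi i (e j); pose q j := sigma (p j).
have pL j v : iota i 1 (p j v) = p j v := psi_eqL (e j) v.
have pR j v : p j (iota i 1 v) = p j v := psi_eqR (e j) v.
have s1 : sigma (iota i 1) = iota (sI i) 1 := si_action HI i.
have sc := sigma_comp Hh Hrho Hsigma.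
have qL j v : iota (sI i) 1 (q j v) = q j v.
  rewrite -s1 -comp_lfunE -sc; congr (sigma _ v); apply/lfunP => z; rewrite comp_lfunE; exact: pR.
have qR j v : q j (iota (sI i) 1 v) = q j v.
  rewrite -s1 -comp_lfunE -sc; congr (sigma _ v); apply/lfunP => z; rewrite comp_lfunE; exact: pL.
have pq a b v : p a (q b v) = 0.
  by rewrite -qL -pR iota_orth ?linear0 // eq_sym.
have qp a b v : q a (p b v) = 0 by rewrite -pL -qR iota_orth ?linear0.
have qq a b v : q a (q b v) = if a == b then q b v else 0.
  rewrite -comp_lfunE -sc.
  have -> : (p b \o p a)%VF = if a == b then p b else 0.
    apply/lfunP => z; rewrite comp_lfunE forth eq_sym; case: eqP => [->|] //.
    by rewrite zero_lfunE.
  by case: ifP => _ //; rewrite (sigma0 Hh Hrho Hsigma) zero_lfunE.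
have qsum v : \sum_j q j v = iota (sI i) 1 v.
  rewrite -sum_lfunE -(sigma_sum Hh Hrho Hsigma) -s1; congr (sigma _ v).
  by apply/lfunP => z; rewrite sum_lfunE fsum.
pose F (o : option (J * bool)) : 'End(V) :=
  if o is Some (j, b) then (if b then q j else p j) else 0.
pose dl (o : J * bool) := (o.1, ~~ o.2).
have jE x : jfac i x = fun t => [set z + z' | z in jt i x t &
    z' in dual_lf nuD h (component (iota (sI i))) (jt i x) t].
  by rewrite /j_factor (negPf si).
have bl := Hjt i; have nD := normalized_D; have nD' := normalized_D' i.
have cD := nz_cdv nD.
have [D2 wD2] := two_D.
have wrho := involution_val cD D2 wD2 Hrho.
set S := line_apartment _ _ _.
have Sb x : S x -> building_linear (nu' i) x by case.
have Sn x : S x -> nlf (@w' i) (@rscale (D' i) (V' i)) [set: V' i] x.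
  by move=> /Sb/bldg_norm.
have Se x : S x -> forall a t v, x t v -> x t (e a v).
  move=> Sx; have [_] := Sx.
  have -> : W = fun j => im (e j) by apply/funext => j; exact: WE.
  by move/(idem_split ie (nlfD (Sn x Sx)) (nlf0 (Sn x Sx))).
have ci1 := component_im (@pf_mul _ _ _ _ _ _ _ HE i).
have ci2 := component_im (@pf_mul _ _ _ _ _ _ _ HE (sI i)).
have jn x : S x -> nlf wD (@rscale D V) (im (iota i 1)) (jt i x).
  by move=> Sx; rewrite -ci1; apply: (jt_nlf nD (@pf_mul _ _ _ _ _ _ _ HE i) bl); exact: Sb.
have adj1 : adjoint_pair h (iota i 1) (iota (sI i) 1) by rewrite -s1.
have nd v : im (iota (sI i) 1) v -> (forall z, im (iota i 1) z -> h v z = 0) -> v = 0.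
  move=> ev H; apply: (herm_nondeg Hh) => z.
  rewrite -ev -s1 -(sigmaP' Hh Hrho Hsigma); apply: H; exact: iota_idem.
pose Du x := dual_lf nuD h (im (iota (sI i) 1)) (jt i x).
have dn x : S x -> nlf wD (@rscale D V) (im (iota (sI i) 1)) (Du x).
  move=> Sx; apply: (nlf_dual Hh Hrho cD wrho nD (rmod_im _) (rmod_im _) _ (jn x Sx) nd).
  exact: (fgen_im (@iota_idem i)).
have dd x : S x -> dual_lf nuD h (im (iota i 1)) (Du x) = jt i x.
  move=> Sx; apply: (dual_dual cD Hh Hrho D2 wD2 nD _ (@iota_idem i) adj1 (jn x Sx)).
  by move=> f; exists (sigma f).
have jP x : S x -> forall t v, jfac i x t v <->
    [/\ im (eY i) v, jt i x t (iota i 1 v) & Du x t (iota (sI i) 1 v)].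
  move=> Sx t v; rewrite jE ci2; split.
    move=> [z Lz [z' Dz' <-]].
    have ez : iota i 1 z = z := nlf_sub (jn x Sx) Lz.
    have ez' : iota (sI i) 1 z' = z' := nlf_sub (dn x Sx) Dz'.
    have E1 : iota i 1 (z + z') = z.
      by rewrite linearD /= ez -ez' iota_orth ?addr0 // eq_sym.
    have E2 : iota (sI i) 1 (z + z') = z'.
      by rewrite linearD /= ez' -ez iota_orth ?add0r.
    by rewrite E1 E2; split=> //; rewrite eYE /im /= add_lfunE E1 E2.
  move=> [ev L1 L2]; exists (iota i 1 v) => //; exists (iota (sI i) 1 v) => //.
  by rewrite -add_lfunE -eYE.
(* $V_i + V_{-i}$ is viewed as a sum over [bool], with negation as duality, so that [nlf_orth_sum]
   and [dual_orth_sum] apply. *)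
pose eb (b : bool) := if b then iota (sI i) 1 else iota i 1.
have ebE a b v : eb a (eb b v) = if a == b then eb b v else 0.
  by case: a b => [] [] /=; rewrite /eb ?iota_idem // iota_orth // eq_sym.
have ebY v : im (eY i) v <-> \sum_b eb b v = v.
  by rewrite /im /= eYE add_lfunE big_bool /= addrC.
have ebL x (Sx : S x) b : nlf wD (@rscale D V) (im (eb b)) (if b then Du x else jt i x).
  by case: b; [exact: dn | exact: jn].
have ebM x (Sx : S x) t v : jfac i x t v <->
    im (eY i) v /\ forall b, (if b then Du x else jt i x) t (eb b v).
  split=> [/(jP x Sx)[Yv L1 L2]|[Yv H]]; first by split=> // -[].
  by apply/(jP x Sx); split=> //; [exact: (H false) | exact: (H true)].
have jfn x : S x -> nlf wD (@rscale D V) (im (eY i)) (jfac i x).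
  by move=> Sx; exact: (nlf_orth_sum ebE ebY (ebL x Sx) (ebM x Sx)).
have jfd x : S x -> dual_lf nuD h (im (eY i)) (jfac i x) = jfac i x.
  move=> Sx; apply: (dual_orth_sum cD ebE ebY (ebL x Sx) (ebM x Sx) Hh Hrho nD (dl := negb)).
    by case=> y z; rewrite Hsigma /eb ?s1 // (si_action HI) sI_inv.
  by case; rewrite //= dd.
have inY1 x (Sx : S x) t v : jt i x t v -> jfac i x t v.
  move=> Lv; have ev : iota i 1 v = v := nlf_sub (jn x Sx) Lv.
  apply/(jP x Sx); split; [by apply/ebY; rewrite big_bool /= -{1}ev iota_orth // add0r | by rewrite ev |].
  by rewrite -ev iota_orth //; exact: (nlf0 (dn x Sx)).
have inY2 x (Sx : S x) t v : Du x t v -> jfac i x t v.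
  move=> Lv; have ev : iota (sI i) 1 v = v := nlf_sub (dn x Sx) Lv.
  have ne : i != sI i by rewrite eq_sym.
  apply/(jP x Sx); split; [by apply/ebY; rewrite big_bool /= -{2}ev iota_orth // addr0 | | by rewrite ev].
  by rewrite -ev iota_orth //; exact: (nlf0 (jn x Sx)).
have ps x (Sx : S x) j t v : jt i x t v -> jt i x t (p j v).
  by apply: (jt_stable bl (Sb x Sx)); exact: Se.
have qadj j y z : h (q j y) z = h y (p j z) by rewrite (sigmaP' Hh Hrho Hsigma).
have qs x (Sx : S x) j t v : Du x t v -> Du x t (q j v).
  move=> /(dual_lfP Hh Hrho cD nD _ _ _ (jn x Sx))[_ H].
  apply/(dual_lfP Hh Hrho cD nD _ _ _ (jn x Sx)); split; first exact: qL.
  by move=> r z Lz; rewrite qadj; apply: H; exact: ps.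
have jfp x (Sx : S x) j t v : p j v = v -> (jfac i x t v <-> jt i x t v).
  move=> pv; split; last exact: inY1.
  by move=> /(jP x Sx)[_]; rewrite -pv pL.
have jfq x (Sx : S x) j t v : q j v = v -> (jfac i x t v <-> Du x t v).
  move=> qv; split; last exact: inY2.
  by move=> /(jP x Sx)[_ _]; rewrite -qv qL.
have FN v : F None v = 0 by rewrite /= zero_lfunE.
have psi_neq0 j : p j != 0.
  apply/eqP => p0; have := psi0 (Hpsi i); rewrite -p0 => /(ci_inj (Hpsi i)) e0.
  have := line_id (u j); rewrite -(uP j).2 WE /im /= -e0 zero_lfunE => /esym/eqP.
  by rewrite (negPf (uP j).1).
exists (J * bool)%type, F, dl; split.
- move=> [[a []]|] [[b []]|] v //=; rewrite ?zero_lfunE ?linear0 //.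
  + by rewrite qq -[Some _ == _]/((a, true) == (b, true)) xpair_eqE eqxx andbT.
  + by rewrite qp -[Some _ == _]/((a, true) == (b, false)) xpair_eqE andbF.
  + by rewrite pq -[Some _ == _]/((a, false) == (b, true)) xpair_eqE andbF.
  + by rewrite forth -[Some _ == _]/((a, false) == (b, false)) xpair_eqE eqxx andbT.
- move=> v; rewrite sum_option FN add0r eYE add_lfunE -fsum -qsum -big_split /=.
  rewrite (eq_bigr (fun o : J * bool => (fun j b => F (Some (j, b)) v) o.1 o.2)); last by case.
  rewrite -(pair_bigA _ (fun j b => F (Some (j, b)) v)) /=.
  by apply: eq_bigr => j _; rewrite big_bool /= addrC.
- move=> [[a []]|] //=; last exact: (sigma0 Hh Hrho Hsigma).
  exact: (sigmaK Hh Hrho Hsigma).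
- by case=> j b; rewrite /dl /= negbK.
- by case=> j b; rewrite /dl xpair_eqE eqxx /=; case: b.
- case=> j [] /=; last exact: psi_neq0.
  apply: contra_neq (psi_neq0 j) => q0.
  by rewrite -[p j](sigmaK Hh Hrho Hsigma) -/(q j) q0 (sigma0 Hh Hrho Hsigma).
- move=> [[j []]|] v /=; last by rewrite !zero_lfunE linear0.
    by apply: sigma_beta => z; exact: psi_beta.
  exact: psi_beta.
- exact: jfn.
- exact: jfd.
- move=> x Sx [[j []]|] t v Lv /=; last by rewrite zero_lfunE; exact: (nlf0 (jfn x Sx)).
    by apply: inY2 => //; rewrite -qR; apply: qs => //; case/(jP x Sx): Lv.
  by apply: inY1 => //; rewrite -pR; apply: ps => //; case/(jP x Sx): Lv.
- move=> x y Sx Sy.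
  have [j|sh shP] := @choice _ _ (fun j r => forall t v, im (e j) v -> (y t v <-> x (t - r) v)).
    have [r rP] := line_norm (cdv_D' i) (Sn x Sx) (Sn y Sy) (uP j).1.
    by exists r => t v; rewrite -WE (uP j).2; exact: rP.
  have yE t v : y t v <-> forall j, x (t - sh j) (e j v).
    split=> [yv a|xv].
      by apply/shP; [exact: (idem_id ie) | exact: Se].
    rewrite -(idem_sum ie v); apply: (nlf_sum (Sn y Sy)) => a.
    by apply/shP; [exact: (idem_id ie) | exact: xv].
  have js := jt_shift nD nD' (@pf_mul _ _ _ _ _ _ _ HE i)
    (@pf_scale _ _ _ _ _ _ _ HE i) (Hpsi i) bl pik0 (w'pik i) wDpik ie
    (Sb x Sx) (Se x Sx) (Sb y Sy) yE.
  have js1 a t v : p a v = v -> (jt i y t v <-> jt i x (t - kappa * sh a) v).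
    move=> av; split=> [/js[_ /(_ a)]|xv]; first by rewrite -/(p a) av.
    apply/js; split; first by rewrite ci1 -av; exact: pL.
    move=> b; have [->|ba] := eqVneq b a; first by rewrite -/(p a) av.
    by rewrite -av forth (negPf ba); exact: (nlf0 (jn x Sx)).
  have pp a v : p a (p a v) = p a v by rewrite forth eqxx.
  case=> [[j []]|].
  + exists (- (kappa * sh j)); split=> // t v qv.
    rewrite (jfq y Sy j) // (jfq x Sx j) // opprK.
    have DuP z (Sz : S z) r := dual_lfP Hh Hrho cD nD (im (iota (sI i) 1)) r v (jn z Sz).
    split=> [/(DuP y Sy)[ev H]|/(DuP x Sx)[ev H]].
      apply/(DuP x Sx); split=> // r z Lz; rewrite -qv qadj.
      have -> : t + kappa * sh j + r = t + (r + kappa * sh j) by lra.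
      by apply: H; apply/js1; [exact: pp | rewrite addrK; exact: ps].
    apply/(DuP y Sy); split=> // r z Lz; rewrite -qv qadj.
    have -> : t + r = t + kappa * sh j + (r - kappa * sh j) by lra.
    by apply: H; apply/js1; [exact: pp | exact: ps].
  + exists (kappa * sh j); split=> // t v pv.
    by rewrite (jfp y Sy j) // (jfp x Sx j) //; exact: js1.
  + exists 0; split=> // t v; rewrite FN => <-.
    by split=> _; [exact: (nlf0 (jfn x Sx)) | exact: (nlf0 (jfn y Sy))].
- move=> g [Ug gb]; have gbv v : g (beta v) = beta (g v).
    by rewrite -!comp_lfunE gb.
  have gi j x v : g (iota j x v) = iota j x (g v).
    by apply: generated_comm => //; exact: iota_generated.
  have gU v : sigma g (g v) = v.
    by rewrite -comp_lfunE (_ : (sigma g \o g)%VF = \1%VF) ?id_lfunE.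
  split.
    move=> [f [af fW] fE].
    have gv v : g (iota i 1 v) = psi i f v by rewrite fE comp_lfunE.
    split; last by move=> v; rewrite FN linear0.
    have key j : exists2 a, fixed_field rho a & (forall v, g (p j v) = rscale (a%:A : D) (p j v)) /\
        forall v, p j (g v) = rscale (a%:A : D) (p j v).
      have [_ [a a0 <-] aE] := fW j; exists a => //.
      have [z zE] := scalar_End (D' := D' i) (V' i) (a%:A).
      have fe : (f \o e j)%VF = (z \o e j)%VF.
        by apply/lfunP => v; rewrite !comp_lfunE zE aE // WE; exact: (idem_id ie).
      have ef : (e j \o f)%VF = (z \o e j)%VF.
        apply/lfunP => v; rewrite !comp_lfunE -[in LHS](idem_sum ie v) !linear_sum (bigD1 j) //=.
        rewrite -[f _]comp_lfunE fe comp_lfunE zE lfun_rscale (idem_id ie) big1 ?addr0 //.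
        move=> l lj; have [_ [b b0 <-] bE] := fW l.
        have -> : f (e l v) = rscale (tower i b) (e l v) by apply: bE; rewrite WE; exact: (idem_id ie).
        by rewrite lfun_rscale (idem_neq ie) 1?eq_sym // rscaler0.
      have zp v : psi i (z \o e j)%VF v = rscale (a%:A : D) (p j v).
        by rewrite (psiM (Hpsi i)) (psi_scalarE zE) psi_eqL.
      split=> v; first by rewrite -[in LHS]pL gv -(psiM (Hpsi i)) fe zp.
      by rewrite -[in LHS]pR -gi gv -(psiM (Hpsi i)) ef zp.
    case=> j []; have [a a0 [gp pg]] := key j; last by exists a.
    have aN0 : a != 0.
      apply: contra_neq (psi_neq0 j) => a00; apply/lfunP => v.
      by rewrite zero_lfunE -(gU (p j v)) gp a00 scale0r rscale0 linear0.
    (* An isometry acting by [a] on the image of [p j] acts by the inverse on that of [q j], since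
       [a] is fixed by [rho]. *)
    exists a^-1.
      rewrite /fixed_field /=; have ua : (a%:A : D) \is a GRing.unit.
        by apply: (cda_division HD); rewrite -in_algE fmorph_eq0.
      have aV : (a^-1)%:A = (a%:A)^-1 :> D by rewrite -!in_algE fmorphV.
      rewrite aV; apply: (mulrI ua); rewrite divrr // -{1}(a0 : rho a%:A = a%:A).
      by rewrite -(invol_mul Hrho) mulVr // (invol_one Hrho).
    have sz v : q j v = rscale (a%:A : D) (g (q j v)).
      apply/eqP; rewrite -subr_eq0; apply/eqP; apply: (herm_nondegr Hh Hrho) => y.
      rewrite (hermDr Hh) (hermNr Hh) (hermZr Hh Hrho) -Hsigma.
      have -> : h y (g (q j v)) = h (p j (sigma g y)) v.
        by rewrite (sigmaP' Hh Hrho Hsigma) -Hsigma.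
      apply/eqP; rewrite subr_eq0; apply/eqP.
      rewrite -central_comm -{1}(a0 : rho a%:A = a%:A) -(hermZl Hh Hrho); congr (h _ v).
      (* [g] is surjective, its left inverse [sigma g] being a right inverse in finite dimension. *)
      have [y' ->] : exists y', y = g y'.
        by exists (sigma g y); rewrite (End_inverse_comm (cda_division HD) gU).
      by rewrite gU pg.
    move=> v /=; rewrite {2}sz -rscaleM.
    by rewrite -[_ * _]/(_ * _) -scalerAl mul1r scalerA divff // scale1r rscale1.
  move=> [gS _].
  have [a aP] := @choice _ _ (fun j a => fixed_field rho a /\
      forall v, g (p j v) = rscale (a%:A : D) (p j v))
    (fun j => let: ex_intro2 a H1 H2 := gS (j, false) in ex_intro _ a (conj H1 H2)).
  have aN0 j : a j != 0.
    apply: contra_neq (psi_neq0 j) => a00; apply/lfunP => v.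
    by rewrite zero_lfunE -(gU (p j v)) (aP j).2 a00 scale0r rscale0 linear0.
  have [sc' scE] := choice (fun j => scalar_End (D' := D' i) (V' i) ((a j)%:A)).
  have [sd sdE] := choice (fun j => scalar_End (D' := D' i) (V' i) ((a j)^-1%:A)).
  pose f : 'End(V' i) := \sum_j (sc' j \o e j)%VF.
  pose f' : 'End(V' i) := \sum_j (sd j \o e j)%VF.
  have fe j v : e j v = v -> f v = rscale (tower i (a j)) v.
    move=> ev; rewrite sum_lfunE (bigD1 j) //= comp_lfunE scE ev big1 ?addr0 // => l lj.
    by rewrite comp_lfunE scE -ev (idem_neq ie) // rscaler0.
  have f'e j v : e j v = v -> f' v = rscale (tower i (a j)^-1) v.
    move=> ev; rewrite sum_lfunE (bigD1 j) //= comp_lfunE sdE ev big1 ?addr0 // => l lj.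
    by rewrite comp_lfunE sdE -ev (idem_neq ie) // rscaler0.
  have tw b : b != 0 -> tower i b * tower i b^-1 = 1.
    by move=> b0; rewrite /tower_scalar -!in_algE -rmorphM -rmorphM divff // !rmorph1.
  have tw' b : b != 0 -> tower i b^-1 * tower i b = 1.
    by move=> b0; rewrite /tower_scalar -!in_algE -rmorphM -rmorphM mulVf // !rmorph1.
  exists f.
    split; last first.
      move=> j; exists (tower i (a j)); first by exists (a j); [exact: (aP j).1 |].
      by move=> v; rewrite WE; exact: fe.
    exists f'; split; apply/lfunP => v; rewrite comp_lfunE id_lfunE -[in RHS](idem_sum ie v)
        -[in LHS](idem_sum ie v) !linear_sum; apply: eq_bigr => j _ /=.
      rewrite -[LHS]/(f (f' _)) (f'e j) ?(idem_id ie) // lfun_rscale (fe j) ?(idem_id ie) //.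
      by rewrite -rscaleM tw // rscale1.
    rewrite -[LHS]/(f' (f _)) (fe j) ?(idem_id ie) // lfun_rscale (f'e j) ?(idem_id ie) //.
    by rewrite -rscaleM tw' // rscale1.
  apply/lfunP => v; rewrite comp_lfunE -fsum linear_sum /= (psi_sum (Hpsi i)) sum_lfunE.
  apply: eq_bigr => j _; rewrite (psiM (Hpsi i)) (psi_scalarE (scE j)) psi_eqL.
  by rewrite -[RHS]/(g _) -/(p j) (aP j).2.
Qed.
End Iplus.

Local Notation idx := (Defs.index sI Ip).

(** $I_0 \cup I_+$ contains exactly one element of each orbit of [sI]. *)
Lemma idx_sI_neq (i j : idx) : val i != val j -> val i != sI (val j).
Proof.
move=> ij; apply/eqP => E1; have /orP[/eqP jj|jp] := valP j.
  by move/eqP: ij; apply; rewrite E1 jj.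
have jm := si_plus_moved HI jp.
have /orP[|ip] := valP i; first by rewrite E1 sI_inv eq_sym (negPf jm).
by have := si_plus_minus HI jm; rewrite -E1 ip jp.
Qed.

Lemma eY_iota (i : I) : eY i = iota i 1 + (if sI i == i then 0 else iota (sI i) 1).
Proof. by rewrite /eY; case: ifP => _; rewrite ?addr0. Qed.

Lemma eY_orth (i j : idx) v :
  eY (val i) (eY (val j) v) = if i == j then eY (val j) v else 0.
Proof.
case: eqP => [->|/eqP ij].
  rewrite eY_iota; case: ifPn => si; first by rewrite addr0 iota_idem.
  have si' : val j != sI (val j) by rewrite eq_sym.
  by rewrite !add_lfunE !linearD /= !iota_idem !iota_orth // addr0 add0r.
have ij' : val i != val j by [].
have ji' : val j != val i by rewrite eq_sym.
have ne1 := idx_sI_neq ij'; have ne2 := idx_sI_neq ji'.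
have ne3 : sI (val i) != val j by rewrite eq_sym.
have ne4 : sI (val i) != sI (val j).
  by apply: contra_neq ij' => E1; rewrite -(sI_inv (val i)) E1 sI_inv.
rewrite !eY_iota; case: ifP => _; case: ifP => _; rewrite ?addr0 ?add_lfunE ?linearD /=;
  by rewrite !iota_orth // ?addr0.
Qed.

Lemma eY_total v : \sum_(i : idx) eY (val i) v = v.
Proof.
have -> : \sum_(i : idx) eY (val i) v = \sum_(i | (sI i == i) || (i \in Ip)) eY i v.
  rewrite [RHS](reindex_omap (val : idx -> I) insub) /=; last by move=> i Pi; rewrite insubT.
  by apply: eq_bigl => i; rewrite valK eqxx andbT; apply/esym/(valP i).
have -> : \sum_(i | (sI i == i) || (i \in Ip)) eY i v =
    \sum_(i | (sI i == i) || (i \in Ip)) iota i 1 v + \sum_(i in Ip) iota (sI i) 1 v.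
  under eq_bigr do rewrite eY_iota add_lfunE.
  rewrite big_split /=; congr (_ + _); rewrite [LHS]big_mkcond [RHS]big_mkcond.
  apply: eq_bigr => i _; case: (boolP (i \in Ip)) => ip.
    by rewrite orbT (negPf (si_plus_moved HI ip)).
  by rewrite orbF; case: ifP => [->|_] //; rewrite zero_lfunE.
rewrite -[RHS]iota_sum [RHS](bigID (fun i => (sI i == i) || (i \in Ip))) /=; congr (_ + _).
rewrite (reindex_inj (h := sI)) /=; last by apply: inv_inj; exact: sI_inv.
apply: eq_big => i; last by rewrite sI_inv.
rewrite negb_or; have [si|si] := eqVneq (sI i) i.
  by rewrite si /=; apply/negP => ip; have := si_plus_moved HI ip; rewrite si eqxx.
by rewrite (si_plus_minus HI si).
Qed.

Lemma sigma_eY i : sigma (eY i) = eY i.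
Proof.
rewrite /eY; case: ifP => [/eqP si|_]; first by rewrite (si_action HI) si.
by rewrite (sigma_add Hh Hrho Hsigma) !(si_action HI) sI_inv addrC.
Qed.

(** * Gluing the factors: a Witt decomposition of $V$ for an apartment of $H$ *)

Section Global.
Variables (J : idx -> finType) (F : forall i : idx, option (J i) -> 'End(V)).
Variables (dl : forall i : idx, J i -> J i).
Variables (Si : forall i : idx, set (R -> set (V' (val i))))
  (Ti : forall i : idx, set 'End(V' (val i))).
Arguments F : clear implicits.
Arguments dl : clear implicits.
Arguments Si : clear implicits.
Arguments Ti : clear implicits.
Hypothesis ld : forall i : idx, local_data (F i) (dl i) (Si i) (Ti i).

Let O := option {i : idx & J i}.
(** The kernels of all factors form the single degree [None]; it is the only self-dual one, as
    [graded_witt] requires. *)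
Definition grading (o : O) : 'End(V) :=
  if o is Some x then F (tag x) (Some (tagged x)) else \sum_i F i None.
Definition grading_dual (o : O) : O :=
  omap (fun x => Tagged (fun i => J i) (dl (tag x) (tagged x))) o.

Local Notation mapj := (@map_j R k D nuD V h I E iota sI Ip D' V' jt).
Local Notation jfac i := (@j_factor R k D nuD V h I E iota sI D' V' jt i).

Lemma eY_F i a v : eY (val i) (F i a v) = F i a v.
Proof.
rewrite -(ld_sum (ld i)) (bigD1 a) //= (ld_orth (ld i)) eqxx big1 ?addr0 // => b ba.
by rewrite (ld_orth (ld i)) (negPf ba).
Qed.

Lemma F_eY i a v : F i a (eY (val i) v) = F i a v.
Proof.
rewrite -(ld_sum (ld i)) linear_sum (bigD1 a) //= (ld_orth (ld i)) eqxx big1 ?addr0 //.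
by move=> b ba; rewrite (ld_orth (ld i)) eq_sym (negPf ba).
Qed.

Lemma F_neq i j a b v : i != j -> F i a (F j b v) = 0.
Proof. by move=> ij; rewrite -F_eY -[F j b v]eY_F eY_orth (negPf ij) linear0. Qed.

Lemma F_None i j a v : F i None (F j (Some a) v) = 0.
Proof.
have [ij|ij] := eqVneq i j; last exact: F_neq.
by case: _ / ij a => a; rewrite (ld_orth (ld i)).
Qed.

Lemma F_None' i j a v : F j (Some a) (F i None v) = 0.
Proof.
have [ij|ij] := eqVneq i j; last by rewrite F_neq // eq_sym.
by case: _ / ij a => a; rewrite (ld_orth (ld i)).
Qed.

Lemma grading_idem : idem_family grading.
Proof.
split=> [[x|] [y|] v|v] /=.
- rewrite -[Some x == Some y]/(x == y) -tag_eqE /tag_eq; case: x y => [i a] [j b] /=.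
  have [ij|ij] /= := eqVneq i j; last exact: F_neq.
  by case: _ / ij b => b; rewrite (ld_orth (ld i)) tagged_asE.
- by rewrite sum_lfunE linear_sum big1 // => i _; exact: F_None'.
- by rewrite sum_lfunE big1 // => i _; exact: F_None.
- rewrite !sum_lfunE; apply: eq_bigr => i _; rewrite linear_sum (bigD1 i) //=.
  rewrite (ld_orth (ld i)) eqxx big1 ?addr0 // => j ji; apply: F_neq; by rewrite eq_sym.
rewrite sum_option /= sum_lfunE.
rewrite -(sig_big_dep xpredT (fun=> xpredT) (fun i j => F i (Some j) v)) /=.
rewrite -big_split -[RHS]eY_total; apply: eq_bigr => i _ /=.
by rewrite -(ld_sum (ld i)) sum_option.
Qed.

Lemma sigma_grading o : sigma (grading o) = grading (grading_dual o).
Proof.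
case: o => [[i a]|] /=; first by rewrite (ld_sigma (ld i)).
by rewrite (sigma_sum Hh Hrho Hsigma); apply: eq_bigr => i _; rewrite (ld_sigma (ld i)).
Qed.

Lemma grading_dualK : involutive grading_dual.
Proof. by case=> [[i a]|] //=; rewrite (ld_dlK (ld i)). Qed.

Lemma grading_dual_fix o : grading_dual o = o -> o = None.
Proof.
case: o => [[i a]|] //= [] /eqP; rewrite -tag_eqE /tag_eq /= eqxx tagged_asE.
by rewrite (negPf (ld_dl (ld i) a)).
Qed.

Lemma grading_pairing o o' u v : o' != grading_dual o -> h (grading o u) (grading o' v) = 0.
Proof.
by move=> ne; rewrite Hsigma sigma_grading (idem_neq grading_idem) ?(herm0r Hh) // eq_sym.
Qed.

Section Lattices.
Variable x : forall i : idx, R -> set (V' (val i)).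
Arguments x : clear implicits.
Hypothesis Sx : forall i, Si i (x i).

Lemma map_jP t v : mapj x t v <-> [set: V] v /\ forall i : idx, jfac (val i) (x i) t (eY (val i) v).
Proof.
split=> [[y yP <-]|[_ H]].
  split=> // i; have ey j : eY (val j) (y j) = y j.
    exact: (nlf_sub (ld_nlf (ld j) (Sx j)) (yP j)).
  rewrite linear_sum (bigD1 i) //= ey big1 ?addr0; first exact: yP.
  by move=> j ji; rewrite -ey eY_orth eq_sym (negPf ji).
by exists (fun i => eY (val i) v) => //; exact: eY_total.
Qed.

Let total v : [set: V] v <-> \sum_(i : idx) eY (val i) v = v.
Proof. by split=> // _; exact: eY_total. Qed.

Lemma map_j_nlf : nlf wD (@rscale D V) [set: V] (mapj x).
Proof. exact: (nlf_orth_sum eY_orth total (fun i => ld_nlf (ld i) (Sx i)) map_jP). Qed.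

Lemma map_j_dual : dual_lf nuD h [set: V] (mapj x) = mapj x.
Proof.
apply: (dual_orth_sum (nz_cdv normalized_D) eY_orth total
  (fun i => ld_nlf (ld i) (Sx i)) map_jP Hh Hrho normalized_D (dl := id)).
  by move=> i u v; rewrite Hsigma sigma_eY.
by move=> i; exact: (ld_dual (ld i) (Sx i)).
Qed.

Lemma eY_grading_F i j a v : eY (val i) (F j a v) = if i == j then F j a v else 0.
Proof. by rewrite -eY_F eY_orth eY_F. Qed.

Lemma map_j_F i a t v : mapj x t (F i a v) <-> jfac (val i) (x i) t (F i a v).
Proof.
rewrite map_jP; split=> [[_ /(_ i)]|H]; first by rewrite eY_F.
split=> // j; rewrite eY_grading_F; case: eqP => [->|_] //.
exact: (nlf0 (ld_nlf (ld j) (Sx j))).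
Qed.

Lemma map_j_stable o t v : mapj x t v -> mapj x t (grading o v).
Proof.
have FS i a : mapj x t v -> mapj x t (F i a v).
  move=> /map_jP[_ H]; apply/map_j_F; rewrite -F_eY.
  exact: (ld_stable (ld i) (Sx i)).
move=> Lv; case: o => [[i a]|] /=; first exact: FS.
by rewrite sum_lfunE; apply: (nlf_sum map_j_nlf) => i; exact: FS.
Qed.

End Lattices.

(** In degree [None] the shift is 0 in every factor, which is why one shift serves this whole
    degree. *)
Lemma map_j_shift (x y : @family_lf R k I E sI Ip D' V') : (forall i, Si i (x i)) -> (forall i, Si i (y i)) ->
  forall o, exists s, forall t v, grading o v = v -> (mapj y t v <-> mapj x (t - s) v).
Proof.
move=> Sx Sy [[i a]|].
  have [s [_ sP]] := ld_shift (ld i) (Sx i) (Sy i) (Some a).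
  exists s => t v /= <-; rewrite !map_j_F //; apply: sP.
  by rewrite (ld_orth (ld i)) eqxx.
exists 0 => t v /=; rewrite sum_lfunE subr0 => vE.
have eYv i : eY (val i) v = F i None v.
  rewrite -vE linear_sum (bigD1 i) //= eY_F big1 ?addr0 => [|j ji].
    by rewrite linear_sum (bigD1 i) //= (ld_orth (ld i)) eqxx big1 ?addr0 // => j ji; rewrite F_neq // eq_sym.
  by rewrite eY_grading_F eq_sym (negPf ji).
have H i : jfac (val i) (y i) t (F i None v) <-> jfac (val i) (x i) t (F i None v).
  have [s [/(_ erefl) -> sP]] := ld_shift (ld i) (Sx i) (Sy i) None.
  by rewrite -{2}(subr0 t); apply: sP; rewrite (ld_orth (ld i)) eqxx.
rewrite !map_jP //; split=> -[_ K]; split=> // i; have := K i; rewrite eYv;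
  by move/H.
Qed.

(** The basis is adapted to one point [x0] only. For another point [x], the projection onto a line
    of the basis factors through the degree containing that line, where the norms of [x] and [x0]
    differ by a shift; stability under the projection is insensitive to this shift. *)
Theorem global_witt : exists (K : finType) (u : K -> V) (st : K -> K),
  [/\ witt_basis h u st, witt_decomposition h (fun p => line (u p)),
      forall p, exists o, grading o (u p) = u p,
      forall v, (forall p, h (u p) v = 0) -> forall o, o != None -> grading o v = 0
    & forall x : @family_lf R k I E sI Ip D' V', (forall i, Si i (x i)) ->
        witt_apartment nuD h (d%:R^-1) (fun p => line (u p)) (mapj x)].
Proof.
have [D2 wD2] := two_D; have nD := normalized_D; have cD := nz_cdv nD.
have gf o o' : grading_dual o = o -> grading_dual o' = o' -> o = o'.
  by move=> /grading_dual_fix -> /grading_dual_fix ->.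
have gn o : o != None -> grading_dual o != o.
  by move=> oN; apply/eqP => /grading_dual_fix E1; rewrite E1 eqxx in oN.
(* Without a point in the apartment the Witt decomposition is built with no condition on a lattice
   function; torality still refers to it. *)
have [[x0 Sx0]|noS] := pselect (exists x : @family_lf R k I E sI Ip D' V', forall i, Si i (x i)); last first.
  have [//|//|//|K [u [st [wu wd gu kg _]]]] := @graded_witt _ _ _ cD _ _ _ _ Hh Hrho D2 wD2 _ _ nD
    _ _ _ grading_idem grading_dualK grading_pairing gf False (fun=> setT).
  exists K, u, st; split=> //; first by move=> v kv o oN; apply: (kg v kv); exact: gn.
  by move=> x Sx; case: noS; exists x.
have [K [u [st [wu wd gu kg /(_ Logic.I) spl]]]] := @graded_witt _ _ _ cD _ _ _ _ Hh Hrho D2 wD2 _ _ nD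
  _ _ _ grading_idem grading_dualK grading_pairing gf True (mapj x0)
  (fun=> map_j_nlf Sx0) (fun=> map_j_dual Sx0) (fun=> map_j_stable Sx0).
exists K, u, st; split=> //; first by move=> v kv o oN; apply: (kg v kv); exact: gn.
move=> x Sx; have nx := map_j_nlf Sx; have n0 := map_j_nlf Sx0.
split; first split.
- exact: (nlf_lattice nD (rmod_setT V) (fgen_vect V) nx).
- exact: map_j_dual.
have [e [ie eE eL eK _]] := wb_projections cD Hh Hrho wu.
have eW : witt_family h (fun p => line (u p)) = fun o => im (e o).
  by apply/funext => -[p|] /=; rewrite ?eL ?eK.
rewrite eW in spl *.
have e0 := proj1 (idem_split ie (nlfD n0) (nlf0 n0)) spl.
apply/(idem_split ie (nlfD nx) (nlf0 nx)).
have eS p t v : mapj x t v -> mapj x t (e (Some p) v).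
  move=> Lv; have [o og] := gu p; have [o2 og2] := gu (st p).
  have oE : o = grading_dual o2.
    apply/eqP; apply: contraT => ne; have := wb_pair wu (st p).
    by rewrite (wb_inv wu) -og -og2 grading_pairing // eqxx.
  have eg : e (Some p) v = e (Some p) (grading o v).
    rewrite !eE; congr (rscale (_ * _) _).
    rewrite -[in LHS](idem_sum grading_idem v) (herm_sumr Hh) (bigD1 o) //=.
    by rewrite big1 ?addr0 // => o' oo'; rewrite -og2 grading_pairing // -oE.
  have [s sP] := map_j_shift Sx0 Sx o.
  have gg : grading o (grading o v) = grading o v := idem_id grading_idem o v.
  have L1 : mapj x0 (t - s) (grading o v) by apply/sP => //; exact: map_j_stable.
  rewrite eg; apply/sP; first by rewrite eE lfun_rscale og.
  exact: e0.
case=> [p|] t v Lv; first exact: eS.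
have -> : e None v = v - \sum_p e (Some p) v.
  by apply/eqP; rewrite eq_sym subr_eq eq_sym -[eqbRHS](idem_sum ie) sum_option.
apply: (nlfB (rmod_setT V) cD nx) => //; apply: (nlf_sum nx) => p; exact: eS.
Qed.

End Global.

Lemma map_j_apartment : maps_apartments_into_apartments d nuD h iota sI Ip nu' h' jt.
Proof.
move=> S [Si [Sif SE]].
have loc (i : idx) : exists (J : finType) (F : option J -> 'End(V)) (dl : J -> J)
    (T : set 'End(V' (val i))), local_data F dl (Si i) T.
  have := Sif i; rewrite /is_factor_apartment.
  case: ifPn => [/eqP si|si] [J [W [wW ->]]].
    by have [F [dl ld]] := local_data_I0 si wW; exists J, F, dl; eexists; exact: ld.
  have ip : val i \in Ip by have := valP i; rewrite (negPf si).
  by have [J' [F [dl ld]]] := local_data_Ip ip wW; exists J', F, dl; eexists; exact: ld.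
pose P (i : idx) (z : {J : finType & ((option J -> 'End(V)) * (J -> J))%type}) :=
  exists T : set 'End(V' (val i)), local_data (projT2 z).1 (projT2 z).2 (Si i) T.
have [i|z zP] := @choice _ _ P.
  by have [J [F [dl [T ld]]]] := loc i; exists (existT _ J (F, dl)), T.
have [T TP] : exists T : forall i : idx, set 'End(V' (val i)),
    forall i, local_data (projT2 (z i)).1 (projT2 (z i)).2 (Si i) (T i).
  exists (fun i => sval (cid (zP i))) => i; exact: (svalP (cid (zP i))).
have [K [u [st [wu wd _ _ ap]]]] := global_witt TP.
exists (witt_apartment nuD h (d%:R^-1) (fun p => line (u p))); split.
  by exists K, (fun p => line (u p)).
by rewrite SE => _ [x Sx <-]; exact: ap.
Qed.


(** * Torality *)

Section Toral.
Local Notation k0 := (fixed_field rho).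
Local Notation cs a v := (rscale (a%:A : D) v).

(** For a uniformizer $\pi$ of $k$, the product $\pi\rho(\pi)$ is fixed by [rho] and has value 2, so
    its order is infinite. *)
Lemma tau_ex : exists tau, [/\ k0 tau, tau != 0 & forall n : int, tau ^ n = 1 -> n = 0].
Proof.
have [p p0 pE] := local_field_unif Hk; have [q qE] := rho_center p.
have [vD eD] := HnuD; have [t0 t2] := local_field_two Hk; have [D0 D2] := falg_two eD t0 t2.
have wrho := involution_val cdv_D0 D0 D2 Hrho.
have pA : (p%:A : D) != 0 by rewrite -[_%:A]/(in_alg D _) fmorph_eq0.
have wp : fine (nuD p%:A) = 1 by rewrite eD pE.
have wq : fine (nuD q%:A) = 1 by rewrite -qE wrho.
have q0 : q != 0.
  by apply/eqP => q0; have /eqP := rho_neq0 Hrho pA; rewrite qE q0 scale0r.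
exists (p * q); split; last 1 first.
- move=> n E1; have [_] := cdv_expz ck n (mulf_neq0 p0 q0).
  rewrite E1 (cdv_1 ck) (cdv_mul ck) // -!eD wp wq => /esym/eqP.
  rewrite mulf_eq0 intr_eq0 => /orP[/eqP //|/eqP E2].
  by exfalso; move: E2; lra.
- have algM (a b : k) : (a * b)%:A = a%:A * b%:A :> D by rewrite mulr_algl scalerA.
  have pE' : rho q%:A = p%:A by rewrite -qE (invol_invol Hrho).
  by rewrite /fixed_field /= algM (invol_mul Hrho) qE pE'.
- exact: mulf_neq0.
Qed.

Variables (T : set 'End(V)) (n r : nat) (w : 'I_r -> 'I_n -> int) (e : 'I_r -> 'End(V)).
Hypotheses (tw : torus_weights k0 T w e) (TG : T `<=` centralizer_group sigma beta).

Let TU : T `<=` unitary_group sigma.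
Proof. by move=> g /TG[]. Qed.

Lemma weight_beta p v : e p (beta v) = beta (e p v).
Proof.
apply/esym/(tw_comm tw) => g x Tg; have [_ gb] := TG Tg.
by rewrite -!comp_lfunE gb.
Qed.

Lemma weight_iota p i (x : E i) v : e p (iota i x v) = iota i x (e p v).
Proof. by apply: (generated_comm (weight_beta p)); exact: iota_generated. Qed.

(** Nondegeneracy of [h] pairs each weight space with some other one or itself, and by [weight_dual]
    its weight is the opposite one. *)
Lemma weight_dual_ex : exists dl : 'I_r -> 'I_r, [/\ involutive dl,
  forall p, sigma (e p) = e (dl p) & forall p, dl p = p -> forall i, w p i = 0].
Proof.
have [tau [kt t0 tf]] := tau_ex.
have wdual := weight_dual cdv_D0 Hh Hrho Hsigma kt t0 tf tw TU.
have winj := tw_inj tw; have ie := tw_idem tw.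
have dex p : exists q, forall i, w q i = - w p i.
  have [u pu] : exists u, e p u != 0.
    apply: contrapT => nu0; move/eqP: (tw_neq0 tw p); apply; apply/lfunP => u.
    by rewrite zero_lfunE; apply/eqP; apply: contraT => fu; case: nu0; exists u.
  apply: contrapT => nq; move/eqP: pu; apply; apply: (herm_nondeg Hh) => v.
  rewrite -(idem_sum ie v) (herm_sumr Hh) big1 // => q _; apply/eqP.
  by apply: contraT => hne; case: nq; exists q; exact: (wdual _ _ _ _ hne).
have [dl dlE] := choice dex.
have uniq_dl p q : (forall i, w q i = - w p i) -> q = dl p.
  by move=> qE; apply/winj/funext => i; rewrite qE dlE.
exists dl; split.
- by move=> p; apply/esym/uniq_dl => i; rewrite dlE opprK.
- move=> p; apply: (adjoint_unique Hh Hrho (Hsigma _)) => u v.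
  have h0 p' q' x y : q' != dl p' -> h (e p' x) (e q' y) = 0.
    move=> ne; apply/eqP; apply: contraT => /wdual wE.
    by case/eqP: ne; exact: uniq_dl.
  rewrite -[in LHS](idem_sum ie v) (herm_sumr Hh) (bigD1 (dl p)) //= big1 ?addr0 => [|q qp]; last exact: h0.
  rewrite -[in RHS](idem_sum ie u) (herm_suml Hh) (bigD1 p) //= [X in _ + X]big1 ?addr0 // => q qp.
  by rewrite h0 //; apply: contra_neq qp => E1; apply/winj/funext => i; rewrite -[LHS]opprK -dlE -E1 dlE opprK.
- by move=> p pp i; apply/eqP; rewrite -eqNr -dlE pp.
Qed.

(** The weight projections commute with [beta], hence with all of $k[\beta]$, so their restrictions
    to $V_i$ lie in the centralizer of $E_i$, which is the image of [psi]. *)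
Lemma weight_factor (i : I) : exists f : 'I_r -> 'End(V' i), [/\ idem_family f,
  forall p v, psi i (f p) v = e p (iota i 1 v) &
  forall c : 'I_r -> k, exists g : 'End(V' i),
    (forall v, g v = \sum_p rscale (tower i (c p)) (f p v)) /\
    forall v, psi i g v = \sum_p cs (c p) (e p (iota i 1 v))].
Proof.
have ie := tw_idem tw.
have fex p : exists f : 'End(V' i), psi i f = (e p \o iota i 1)%VF.
  have : [set a | (iota i 1 \o a \o iota i 1 = a)%VF /\
                  forall x, (a \o iota i x = iota i x \o a)%VF] (e p \o iota i 1)%VF.
    split; first by apply/lfunP => v; rewrite !comp_lfunE -!weight_iota !iota_idem.
    move=> x; apply/lfunP => v; rewrite !comp_lfunE -weight_iota; congr (e p _).
    by rewrite -!comp_lfunE -!(pf_mul HE) mulrC.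
  by rewrite -(ci_image (Hpsi i)) => -[f _ fE]; exists f.
have [f fE] := choice fex.
have fv p v : psi i (f p) v = e p (iota i 1 v) by rewrite fE comp_lfunE.
have idf : idem_family f.
  split=> [p q v|v].
    have -> : f p (f q v) = (f p \o f q)%VF v by rewrite comp_lfunE.
    have -> : (f p \o f q)%VF = if p == q then f q else 0.
      apply: (ci_inj (Hpsi i)); rewrite (ci_mul (Hpsi i)); apply/lfunP => x.
      rewrite comp_lfunE !fv -weight_iota iota_idem (idem_orth ie).
      by case: ifP => _; rewrite ?fv // (psi0 (Hpsi i)) zero_lfunE.
    by case: ifP => _ //; rewrite zero_lfunE.
  rewrite -sum_lfunE; have -> : \sum_p f p = \1%VF; last by rewrite id_lfunE.
  apply: (ci_inj (Hpsi i)); rewrite (psi_sum (Hpsi i)) (psi1 (Hpsi i)); apply/lfunP => x.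
  by rewrite sum_lfunE -[RHS](idem_sum ie); apply: eq_bigr => p _; rewrite fv.
exists f; split=> // c.
have [s sE] := choice (fun p => scalar_End (V' i) ((c p)%:A : E i)).
exists (\sum_p (s p \o f p)%VF); split=> v.
  by rewrite sum_lfunE; apply: eq_bigr => p _; rewrite comp_lfunE sE.
rewrite (psi_sum (Hpsi i)) sum_lfunE; apply: eq_bigr => p _.
rewrite (ci_mul (Hpsi i)) comp_lfunE (psi_scalarE (sE p)) fv.
by rewrite -weight_iota iota_idem.
Qed.


Definition toral_factor (i : I) : Prop := exists (J : finType) (F : option J -> 'End(V)) (dl : J -> J)
  (S : set (R -> set (V' i))) (Ti : set 'End(V' i)),
  [/\ local_data F dl S Ti,
      @torus_factor_apartment R k D rho V sigma I E iota sI D' nu' V' psi h' i Ti S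
    & forall g, T g -> exists2 f, Ti f & psi i f = (g \o iota i 1)%VF].

Let tower_comm (i : I) (a : k) (x : D' i) : tower i a * x = x * tower i a.
Proof. by rewrite /tower_scalar mulr_algl mulr_algr. Qed.

Let towerM (i : I) (a b : k) : tower i (a * b) = tower i a * tower i b.
Proof. by rewrite /tower_scalar -!in_algE !rmorphM. Qed.

Let line_tower (i : I) (f : 'End(V' i)) (a : k) u :
  f u = rscale (tower i a) u -> forall v, line u v -> f v = rscale (tower i a) v.
Proof. by move=> fu v [x _ <-]; rewrite lfun_rscale fu -!rscaleM tower_comm. Qed.

Let char_fixed (t : 'I_n -> k) p : torus_points k0 t -> k0 (torus_char t (w p)).
Proof.
move=> tP; apply: (torus_char_fixed (fixed_field1 Hrho) (fixed_fieldM Hrho) (fixed_fieldV Hrho)).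
by move=> i; case: (tP i).
Qed.

(** A weight equal to its negative is 0, so the grading of $V'_i$ by weights has at most one
    self-dual degree. The Witt kernel lies in weight 0, where [T] acts trivially. *)
Lemma toral_factor_I0 (i : I) : sI i = i -> toral_factor i.
Proof.
move=> si; have [dl [dlK sdl dl0]] := weight_dual_ex.
have [f [idf fE fc]] := weight_factor i.
have hh' := Hh' si; have ih' := Hrho' si.
have fadj p x y : h' i (f p x) y = h' i x (f (dl p) y).
  apply: (Hsigma' si) x y; apply/lfunP => v; rewrite fE.
  have -> : psi i (f p) = (e p \o iota i 1)%VF by apply/lfunP => y; rewrite fE comp_lfunE.
  rewrite (sigma_comp Hh Hrho Hsigma) (si_action HI) si sdl comp_lfunE.
  exact: weight_iota.
have fdl p q x y : q != dl p -> h' i (f p x) (f q y) = 0.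
  by move=> ne; rewrite fadj (idem_neq idf) ?(herm0r hh') // eq_sym.
have fix1 p q : dl p = p -> dl q = q -> p = q.
  by move=> pp qq; apply/(tw_inj tw)/funext => j; rewrite !dl0.
have [D'2 w'2] := two_D' i.
have [//|//|//|J [u [st [wu wd gu gk _]]]] := @graded_witt _ _ _ (nz_cdv (normalized_D' i)) _ _ _ _
  hh' ih' D'2 w'2 _ _ (normalized_D' i) _ _ _ idf dlK fdl fix1 False (fun=> setT).
have [F [dlF ld]] := local_data_I0 si wd.
exists J, F, dlF; do 2 eexists; split; first exact: ld.
  by rewrite /torus_factor_apartment si eqxx; exists J, (fun p => line (u p)).
move=> g Tg; have := Tg; rewrite (tw_torus tw) => -[t tP gE].
have [f' [f'E psif']] := fc (fun p => torus_char t (w p)).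
have psif : psi i f' = (g \o iota i 1)%VF by apply/lfunP => v; rewrite psif' comp_lfunE gE.
exists f' => //; split=> [|p|v].
- rewrite /factor_unitary_group /= psif (sigma_comp Hh Hrho Hsigma) (si_action HI) si.
  have gU := TU Tg; apply/lfunP => v; rewrite !comp_lfunE -[sigma g _]comp_lfunE gU.
  by rewrite id_lfunE iota_idem.
- have [q qu] := gu p; exists (tower i (torus_char t (w q))).
    by exists (torus_char t (w q)) => //; exact: char_fixed.
  apply: line_tower; rewrite f'E (bigD1 q) //= qu big1 ?addr0 // => q' qq'.
  by rewrite -qu (idem_neq idf) // rscaler0.
- move=> /(wb_kernelP hh' ih') kv; rewrite f'E -[RHS](idem_sum idf); apply: eq_bigr => q _.
  have [qq|qq] := eqVneq (dl q) q; last by rewrite (gk v kv q qq) rscaler0.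
  rewrite torus_char0; last exact: dl0.
  by rewrite /tower_scalar !scale1r rscale1.
Qed.

(** Bases of the single images are orthogonal bases for the restrictions of an auxiliary norm, taken
    from [nlf_vect]. *)
Lemma line_decomposition_idem (A : unitRingType) (wA : A -> R) (cA : cdv wA) (U : vectType A^c)
    (P : finType) (f : P -> 'End(U)) : idem_family f -> exists (J : finType) (u : J -> U),
  line_decomposition [set: U] (fun j => line (u j)) /\
  forall j, exists p, f p (u j) = u j.
Proof.
move=> idf; have [L nL] := nlf_vect U cA.
have bex p : exists z : {m : nat & 'I_m -> U},
    line_decomposition (im (f p)) (fun j => line (projT2 z j)).
  have mf := rmod_im (f p).
  have nLp : nlf wA (@rscale A U) (im (f p)) (fun t => L t `&` im (f p)).
    split.
    - by move=> t v [].
    - by move=> t; split; [exact: (nlf0 nL) | exact: (rmod0 mf)].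
    - by move=> t x y [? ?] [? ?]; split; [exact: (nlfD nL) | exact: (rmodD mf)].
    - by move=> t a v a0 [? ?]; split; [exact: (nlf_act nL) | exact: (rmod_act mf)].
    - by move=> s t v st [? ?]; split=> //; apply: (nlf_le nL) st _.
    - by move=> t v Xv H; split=> //; apply: (nlf_left nL) => // s /H[].
    - by move=> v Xv; have [//|t Lt] := nlf_ex nL (v := v); exists t.
    - by move=> v Xv H; apply: (nlf_sep nL) => // t; case: (H t).
  have [m [b ob]] := orth_basis_exists cA mf nLp (fgen_im (idem_id idf p)).
  by have [ld _] := orth_basis_split mf nLp ob; exists (existT _ m b).
have [z zP] := choice bex.
pose J : finType := {p : P & 'I_(projT1 (z p))}.
pose u (j : J) := projT2 (z (tag j)) (tagged j).
have uim j : f (tag j) (u j) = u j.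
  have [_ [fE _]] := zP (tag j); have : im (f (tag j)) (u j); last by [].
  rewrite fE; exists (fun q => if q == tagged j then projT2 (z (tag j)) q else 0).
    move=> q /=; case: ifP => _; first exact: line_id.
    by exists 0 => //; rewrite rscale0.
  by rewrite (bigD1 (tagged j)) //= eqxx big1 ?addr0 // => q /negPf ->.
have lim j v : line (u j) v -> f (tag j) v = v by move=> [x _ <-]; rewrite lfun_rscale uim.
exists J, u; split; last by move=> j; exists (tag j).
split=> [[p q]|]; first exact: (proj1 (zP p)).
split.
  apply/seteqP; split=> // v _.
  have vex p : exists y : 'I_(projT1 (z p)) -> U,
      (forall q, line (projT2 (z p) q) (y q)) /\ \sum_q y q = f p v.
    have : im (f p) (f p v) by exact: (idem_id idf).
    by have [_ [-> _]] := zP p => -[y yP yE]; exists y.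
  pose y p := sval (cid (vex p)).
  have yP p : (forall q, line (projT2 (z p) q) (y p q)) /\ \sum_q y p q = f p v.
    exact: (svalP (cid (vex p))).
  exists (fun j : J => y (tag j) (tagged j)); first by move=> [p q]; exact: ((yP p).1 q).
  rewrite -(sig_big_dep xpredT (fun=> xpredT) (fun p q => y p q)) /=.
  by rewrite -[RHS](idem_sum idf); apply: eq_bigr => p _; case: (yP p).
move=> y yl y0 [p q]; have [_ [_ ind]] := zP p.
pose yy p (q : 'I_(projT1 (z p))) := y (Tagged (fun p => 'I_(projT1 (z p))) q).
have yyl p' q' : line (projT2 (z p') q') (yy p' q') := yl (Tagged _ q').
have fy p' q' : f p' (yy p' q') = yy p' q' := lim (Tagged _ q') _ (yyl p' q').
apply: (ind (yy p) (yyl p) _ q); have := congr1 (f p) y0; rewrite linear0.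
rewrite (eq_bigr (fun j : J => yy (tag j) (tagged j))); last by case.
rewrite -(sig_big_dep xpredT (fun=> xpredT) yy) /=.
rewrite linear_sum (bigD1 p) //= [X in _ + X]big1 ?addr0 => [E0|p' pp'].
  by rewrite -[RHS]E0 linear_sum; apply: eq_bigr => q' _; rewrite -[RHS]/(f p _) fy.
rewrite linear_sum big1 // => q' _ /=.
by rewrite -fy (idem_neq idf) // eq_sym.
Qed.

Lemma toral_factor_Ip (i : I) : i \in Ip -> toral_factor i.
Proof.
move=> ip; have [f [idf fE fc]] := weight_factor i.
have [J [u [ld gu]]] := line_decomposition_idem (cdv_D' i) idf.
have [J' [F [dlF lo]]] := local_data_Ip ip ld.
exists J', F, dlF; do 2 eexists; split; first exact: lo.
  rewrite /torus_factor_apartment (negPf (si_plus_moved HI ip)).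
  by exists J, (fun p => line (u p)).
move=> g Tg; have := Tg; rewrite (tw_torus tw) => -[t tP gE].
have t0 j : t j != 0 by case: (tP j).
have [f1 [f1E psi1]] := fc (fun p => torus_char t (w p)).
have [f2 [f2E _]] := fc (fun p => (torus_char t (w p))^-1).
have fK (a b : 'I_r -> k) (x y : 'End(V' i)) : (forall p, b p * a p = 1) ->
    (forall v, x v = \sum_p rscale (tower i (a p)) (f p v)) ->
    (forall v, y v = \sum_p rscale (tower i (b p)) (f p v)) -> (x \o y)%VF = \1%VF.
  move=> ab xE yE; apply/lfunP => v; rewrite comp_lfunE id_lfunE xE -[RHS](idem_sum idf).
  apply: eq_bigr => p _; rewrite yE linear_sum (bigD1 p) //= [X in _ + X]big1 ?addr0 => [|q qp].
    rewrite lfun_rscale (idem_id idf) -rscaleM -towerM ab.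
    by rewrite /tower_scalar !scale1r rscale1.
  by rewrite lfun_rscale (idem_neq idf) ?rscaler0 // eq_sym.
exists f1; last by apply/lfunP => v; rewrite psi1 comp_lfunE gE.
split=> [|p].
  by exists f2; split; [apply: fK f1E f2E | apply: fK f2E f1E] => q;
    rewrite ?mulVf ?mulfV ?torus_char_neq0.
have [q qu] := gu p; exists (tower i (torus_char t (w q))).
  by exists (torus_char t (w q)) => //; exact: char_fixed.
apply: line_tower; rewrite f1E (bigD1 q) //= qu big1 ?addr0 // => q' qq'.
by rewrite -qu (idem_neq idf) // rscaler0.
Qed.

End Toral.

Lemma map_j_toral : toral d nuD rho h sigma beta iota sI Ip nu' psi h' jt.
Proof.
move=> T [Ts Tmax]; have [tau [kt t0 tf]] := tau_ex.
have [TG [n [r [w [e tw]]]]] :=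
  split_torus_weights (fixed_field1 Hrho) (fixed_fieldM Hrho) kt t0 tf Ts.
pose Z (i : idx) := {J : finType & ((option J -> 'End(V)) * (J -> J) *
  (set (R -> set (V' (val i))) * set 'End(V' (val i))))%type}.
pose good (i : idx) (z : Z i) :=
  [/\ local_data (projT2 z).1.1 (projT2 z).1.2 (projT2 z).2.1 (projT2 z).2.2,
      @torus_factor_apartment R k D rho V sigma I E iota sI D' nu' V' psi h' (val i)
        (projT2 z).2.2 (projT2 z).2.1
    & forall g, T g -> exists2 f, (projT2 z).2.2 f & psi (val i) f = (g \o iota (val i) 1)%VF].
have zex i : exists z : Z i, good i z.
  have : toral_factor T (val i).
    have /orP[/eqP si|ip] := valP i; first exact: (toral_factor_I0 tw TG si).
    exact: (toral_factor_Ip tw TG ip).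
  by move=> [J [F [dl [S [Ti H]]]]]; exists (existT _ J ((F, dl), (S, Ti))).
pose z i := sval (cid (zex i)); have zP i : good i (z i) := svalP (cid (zex i)).
pose J i := projT1 (z i); pose F i : option (J i) -> 'End(V) := (projT2 (z i)).1.1.
pose dl i : J i -> J i := (projT2 (z i)).1.2.
pose Si i := (projT2 (z i)).2.1; pose Ti i := (projT2 (z i)).2.2.
have ld i : local_data (F i) (dl i) (Si i) (Ti i) by case: (zP i).
have idf := grading_idem ld.
pose st (x : {i : idx & J i}) : {i : idx & J i} := Tagged J (dl (tag x) (tagged x)).
have stK : involutive st.
  by move=> [i a]; have := grading_dualK ld (Some (Tagged J a)) => -[].
have stN x : st x != x.
  by apply/eqP => E1; have := grading_dual_fix ld (o := Some x); rewrite /= -/(st x) E1 => /(_ erefl).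
have f0 x : grading F (Some x) != 0 by exact: (ld_neq0 (ld (tag x))).
have fs o : sigma (grading F o) = grading F (omap st o) := sigma_grading ld o.
pose TW := [set g | centralizer_group sigma beta g /\
  forall i : idx, exists2 f, Ti i f & psi (val i) f = (g \o iota (val i) 1)%VF].
have grading_beta o v : grading F o (beta v) = beta (grading F o v).
  case: o => [[i a]|] /=; first exact: (ld_beta (ld i)).
  by rewrite !sum_lfunE linear_sum; apply: eq_bigr => i _; exact: (ld_beta (ld i)).
have TWE : TW = orth_torus rho sigma (grading F).
  apply/seteqP; split=> g.
    move=> [cg gi]; have gF i := (ld_torus (ld i) cg).1 (gi i).
    split; first by case: cg.
    split=> [[i a]|v]; first by have [+ _] := gF i; apply.
    by rewrite /= sum_lfunE linear_sum; apply: eq_bigr => i _; have [_] := gF i; apply.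
  move=> [gU [gS gN]].
  have cg : centralizer_group sigma beta g.
    split=> //; apply/lfunP => v; rewrite !comp_lfunE -[v](idem_sum idf) !linear_sum.
    apply: eq_bigr => o _; rewrite -[LHS]/(g (beta (grading F o v))).
    rewrite -[RHS]/(beta (g (grading F o v))) -grading_beta.
    case: o => [x|]; last by rewrite !gN grading_beta.
    by have [a _ aP] := gS x; rewrite !aP lfun_rscale grading_beta.
  split=> // i; apply/(ld_torus (ld i) cg); split=> [j|v].
    exact: (gS (Tagged J j)).
  have <- : grading F None (F i None v) = F i None v by rewrite /= sum_lfunE (bigD1 i) //=
    (ld_orth (ld i)) eqxx big1 ?addr0 // => j ji; apply: (F_neq ld).
  exact: gN.
have TTW : T `<=` TW by move=> g Tg; split; [exact: TG | move=> i; case: (zP i) => _ _; apply].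
have TWs : split_torus (fixed_field rho) (centralizer_group sigma beta) TW.
  rewrite TWE; apply: (orth_torus_split cdv_D0 Hh Hrho Hsigma idf stK stN f0 fs).
  by rewrite -TWE => g [].
(* The maximality of [T] makes it the torus of an apartment, which so far was only known to contain
   it. *)
have TE : TW = T := Tmax _ TWs TTW.
have [K [u [stu [wu wd gu kg ap]]]] := global_witt ld.
exists (witt_torus h ((fun a : k => a%:A : D) @` fixed_field rho) (unitary_group sigma)
  (fun p => line (u p))), [set x | forall i, Si i (x i)],
  (witt_apartment nuD h (d%:R^-1) (fun p => line (u p))); split.
- exact: (witt_torus_maximal cdv_D0 Hh Hrho Hsigma kt t0 tf wu wd).
- rewrite -TE TWE => g [gU [gS gN]]; split=> // [p|v].
    have [[x|] xu] := gu p.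
      have [a ka aP] := gS x; exists (a%:A : D); first by exists a.
      by move=> _ [b _ <-]; rewrite lfun_rscale -xu aP xu -!rscaleM mulr_algl mulr_algr.
    (* A basis vector in the kernel degree is fixed by [T], whence the scalar 1. *)
    exists (1%:A : D); first by exists 1 => //; exact: fixed_field1.
    by move=> _ [b _ <-]; rewrite lfun_rscale -xu gN xu scale1r rscale1.
  move=> /(wb_kernelP Hh Hrho) kv.
  have <- : grading F None v = v; last exact: gN.
  rewrite -[RHS](idem_sum idf) sum_option [X in _ + X]big1 ?addr0 // => x _; exact: kg.
- by exists Ti, Si; split=> [i||//]; [case: (zP i) | rewrite -TE].
- by exists K, (fun p => line (u p)).
- by move=> _ [x Sx <-]; exact: ap.
Qed.

End Centralizer.

Theorem proposition12p3 (R : realType)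
  (k : fieldType) (nu : k -> \bar R) (Hk : odd_local_field nu)
  (D : falgType k) (HD : central_division_algebra D)
  (d : nat) (Hd : \dim {:D} = (d ^ 2)%N)
  (nuD : D -> \bar R) (HnuD : extends_val nu (fun a : k => a%:A : D) nuD)
  (rho : D -> D) (Hrho : ring_involution rho)
  (V : vectType D^c) (eps : D) (h : V -> V -> D) (Hh : hermitian_form h rho eps)
  (sigma : 'End(V) -> 'End(V)) (Hsigma : forall f, adjoint_pair h f (sigma f))
  (beta : 'End(V)) (Hbeta : sigma beta = - beta)
  (I : finType) (E : I -> fieldExtType k) (iota : forall i, E i -> 'End(V))
  (HE : product_of_fields beta iota)
  (sI : I -> I) (Ip : {set I}) (HI : sigma_indices sigma iota sI Ip)
  (D' : forall i, falgType (E i)) (HD' : forall i, central_division_algebra (D' i))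
  (nu' : forall i, D' i -> \bar R)
  (Hnu' : forall i, extends_val nu (@tower_scalar k (E i) (D' i)) (nu' i))
  (V' : forall i, vectType (D' i)^c) (psi : forall i, 'End(V' i) -> 'End(V))
  (Hpsi : forall i, centralizer_iso (iota i) (psi i))
  (rho' : forall i, D' i -> D' i) (eps' : forall i, D' i)
  (h' : forall i, V' i -> V' i -> D' i)
  (Hrho' : forall i, sI i = i -> ring_involution (rho' i))
  (Hh' : forall i, sI i = i -> hermitian_form (h' i) (rho' i) (eps' i))
  (Hsigma' : forall i, sI i = i -> forall f g,
     psi i g = sigma (psi i f) -> adjoint_pair (h' i) f g)
  (jt : forall i, (R -> set (V' i)) -> (R -> set V))
  (Hjt : forall i, broussous_lemaire d nuD (iota i) (nu' i) (psi i) (jt i)) :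
  maps_apartments_into_apartments d nuD h iota sI Ip nu' h' jt
  /\ ((forall i, separable 1 {:E i}) ->
      toral d nuD rho h sigma beta iota sI Ip nu' psi h' jt).
Proof.
split=> [|_].
  exact: (map_j_apartment Hk HD Hd HnuD Hrho Hh Hsigma Hbeta HE HI HD' Hnu' Hpsi
    Hrho' Hh' Hsigma' Hjt).
exact: (map_j_toral Hk HD Hd HnuD Hrho Hh Hsigma Hbeta HE HI HD' Hnu' Hpsi
  Hrho' Hh' Hsigma' Hjt).
Qed.
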